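(* Let $\kappa \in (0,1)$. Let $p_{\kappa} = \wp(\,\cdot\,; g_2, g_3)$ be the Weierstrass $\wp$ function with invariants $$g_2 = \tfrac{4}{27}(9 - 8\kappa^2), \qquad g_3 = \tfrac{8}{729}(27 - 36\kappa^2 + 8\kappa^4),$$ and let $\delta_{\kappa}$ (Shen's function $\mathrm{dn}_3$) be the elliptic function defined by $(1 - \delta_{\kappa})(\tfrac13 + p_{\kappa}) = \tfrac49 \kappa^2$. Let $(2\omega_{\kappa}, 2\omega_{\kappa}')$ be the fundamental pair of periods of $p_{\kappa}$ (equivalently of $\delta_{\kappa}$) for which $\omega_{\kappa}$ and $-i\,\omega_{\kappa}'$ are strictly positive. Then $$\omega_{\kappa} = \tfrac12 \pi\, F(\tfrac13, \tfrac23; 1; \kappa^2), \qquad \omega_{\kappa}' = i\,\tfrac{\sqrt3}{2}\pi\, F(\tfrac13, \tfrac23; 1; 1-\kappa^2).$$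
   Context: $F(a,b;c;x)$ denotes the Gauss hypergeometric function ${}_2F_1$. $\wp(\,\cdot\,; g_2, g_3)$ is the Weierstrass elliptic function with invariants $g_2,g_3$. Background on $\delta_\kappa$: if $\phi:\mathbb{R}\to\mathbb{R}$ is the inverse of $T \mapsto \int_0^T F(\tfrac13,\tfrac23;\tfrac12;\kappa^2\sin^2 t)\,dt$, then $\phi'$ is the restriction to $\mathbb{R}$ of $\delta_\kappa$; this is how Shen's elliptic function $\mathrm{dn}_3$ arises. *)

(* Defs.v *)
From Stdlib Require Import Reals List ZArith.
From Coquelicot Require Import Coquelicot.
Open Scope R_scope.

Fixpoint pochhammer (a : R) (n : nat) : R :=
  match n with
  | O => 1
  | S m => pochhammer a m * (a + INR m)
  end.

(* Gauss's series; meaningful for |x| < 1 and c not a non-positive integer. *)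
Definition hypergeom (a b c x : R) : R :=
  PSeries (fun n => pochhammer a n * pochhammer b n
                    / (pochhammer c n * INR (Factorial.fact n))) x.

Definition sum_list (f : C -> C) (l : list C) : C :=
  fold_right (fun w s => Cplus (f w) s) (RtoC 0) l.

(* Unordered summation over A: convergence along the directed set of finite
   subsets of A, which for complex terms is absolute convergence. *)
Definition has_sum (A : C -> Prop) (f : C -> C) (s : C) : Prop :=
  forall eps : R, 0 < eps ->
    exists F0 : list C, (forall w, In w F0 -> A w) /\
      forall F : list C, NoDup F -> incl F0 F -> (forall w, In w F -> A w) ->
        Cmod (sum_list f F - s)%C < eps.

Definition real_independent (w1 w2 : C) : Prop :=
  forall a b : R, (a * w1 + b * w2)%C = RtoC 0 -> a = 0 /\ b = 0.

Definition lattice (w1 w2 w : C) : Prop :=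
  exists m n : Z, w = (IZR m * w1 + IZR n * w2)%C.

Definition nonzero_in (L : C -> Prop) (w : C) : Prop := L w /\ w <> RtoC 0.

Definition lattice_invariants (L : C -> Prop) (g2 g3 : C) : Prop :=
  exists G4 G6 : C,
    has_sum (nonzero_in L) (fun w => 1 / w ^ 4)%C G4 /\
    has_sum (nonzero_in L) (fun w => 1 / w ^ 6)%C G6 /\
    g2 = (60 * G4)%C /\ g3 = (140 * G6)%C.

(* Meromorphic functions on the plane are maps to the Riemann sphere
   [option C], where [None] is the point at infinity (the value at a pole). *)
Definition is_wp_of_lattice (L : C -> Prop) (p : C -> option C) : Prop :=
  forall z : C,
    (L z -> p z = None) /\
    (~ L z -> exists s : C,
        has_sum (nonzero_in L) (fun w => 1 / (z - w) ^ 2 - 1 / w ^ 2)%C s /\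
        p z = Some (1 / z ^ 2 + s)%C).

Definition is_weierstrass_p (g2 g3 : C) (p : C -> option C) : Prop :=
  exists w1 w2 : C,
    real_independent w1 w2 /\
    lattice_invariants (lattice w1 w2) g2 g3 /\
    is_wp_of_lattice (lattice w1 w2) p.

Definition is_period (f : C -> option C) (w : C) : Prop :=
  forall z : C, f (z + w)%C = f z.

Definition fundamental_periods (f : C -> option C) (w1 w2 : C) : Prop :=
  real_independent w1 w2 /\
  forall w : C, is_period f w <-> lattice w1 w2 w.

Definition strictly_positive (z : C) : Prop := Im z = 0 /\ 0 < Re z.

Definition wp_g2 (kappa : R) : R := 4 / 27 * (9 - 8 * kappa ^ 2).

Definition wp_g3 (kappa : R) : R :=
  8 / 729 * (27 - 36 * kappa ^ 2 + 8 * kappa ^ 4).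

(* The relation (1 - delta) (1/3 + p) = (4/9) kappa^2 between functions with
   values in the Riemann sphere. As the right-hand side is finite and nonzero,
   one factor is infinite exactly where the other one vanishes. *)
Definition shen_relation (kappa : R) (p delta : C -> option C) : Prop :=
  forall z : C,
    match p z, delta z with
    | Some u, Some v => ((1 - v) * (1 / 3 + u) = 4 / 9 * kappa ^ 2)%C
    | None, Some v => (1 - v = 0)%C
    | Some u, None => (1 / 3 + u = 0)%C
    | None, None => False
    end.

(* Main.v *)
Require Import Defs.
From Stdlib Require Import Reals ZArith Lra Lia List Permutation Classical ClassicalEpsilon.
From Coquelicot Require Import Coquelicot.
Open Scope R_scope.

(** The difference [p (z + w) - p z] telescopes along a generator [w] of the
    lattice, so the periods of [p] are its poles and the lattice is rectangular.
    The function [p'' - 6 p^2 + g2 / 2] is doubly periodic and tends to [0] at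
    the poles, hence vanishes by the maximum principle; on the real axis it
    integrates to [p'^2 = 4 p^3 - g2 p - g3], the constant being read off at [0].

    Put [sin z = kappa sin t]. Then [F(1/3,2/3;1/2;kappa^2 sin^2 t)] equals
    [cos (z/3) / cos z]; let [u] be its integral from [0] to [t]. Both
    [1 / (1/3 + p u)] and [9 sin^2 (z/3) / kappa^2] solve one second-order
    equation in [u] with zero initial data, so they agree. The latter first
    returns to [0] at [t = PI], whence [2 omega] is the integral over [[0, PI]],
    which is computed term by term.

    On the line [Re = omega] the same formula holds with [z / 3] replaced by
    [PI/6 + y/3], where [sin y = kappa' sin t] and [kappa'^2 = 1 - kappa^2]. The
    part of the integrand that is odd in [y] integrates to [0], and the even part
    is [cos (PI/6)] times the integrand for [kappa'], whence the factor
    [sqrt 3 / 2]. The critical point reached at [t = PI/2] is a half period since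
    [p] is symmetric about each of its critical points. *)

(** * Unordered sums *)

(** With X = 1/3 + p and c = 4 kappa^2 / 27, the cubic 4 p^3 - g2 p - g3 becomes 4 (X^3 - (X -
    c)^2); this explains the shift 1/3 and the two invariants. For X = kappa^2 / (9 s^2) with 3 s -
    4 s^3 = kappa sin t it equals 4 X^3 cos^2 t, and s = sin (z/3) solves this triple-angle
    relation. Solutions are compared through second-order equations because p'^2 = 4 p^3 - g2 p - g3
    alone does not determine p beyond a zero of p', where the sign of the square root is undecided.
    The difference of two solutions satisfies a linear system, and Gronwall's inequality makes it
    vanish. The real axis starts at a pole, hence the passage to 1/X there. The imaginary period is
    measured on Re = omega, and not on the imaginary axis, because p has no pole on that line.
    Lattice points are never counted: absolute convergence of the sum of 1/w^3 is extracted from the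
    convergence of the given series of p, and it carries all the term-by-term estimates. *)

Definition finite_in (A : C -> Prop) (F : list C) : Prop :=
  NoDup F /\ forall w, In w F -> A w.

(** The filter along which [has_sum] converges, so that the general theory of limits gives
    uniqueness, sums and the Cauchy criterion. *)
Definition finite_sets (A : C -> Prop) (P : list C -> Prop) : Prop :=
  exists F0 : list C, (forall w, In w F0 -> A w) /\
    forall F, finite_in A F -> incl F0 F -> P F.

Lemma C_eq_dec (x y : C) : {x = y} + {x <> y}.
Proof. apply excluded_middle_informative. Qed.

Global Instance finite_sets_proper (A : C -> Prop) : ProperFilter (finite_sets A).
Proof.
constructor.
- intros P [F0 [H0 H]].
  (* [F0] may repeat entries, so it is not itself an admissible finite set. *)
  exists (nodup C_eq_dec F0). apply H.
  + split; [apply NoDup_nodup|].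
    intros w Hw. apply H0. now apply (nodup_In C_eq_dec).
  + intros w Hw. now apply nodup_In.
- constructor.
  + exists nil. split; [easy|easy].
  + intros P Q [F0 [H0 H]] [F1 [H1 H']].
    exists (F0 ++ F1). split.
    * intros w Hw. apply in_app_or in Hw. destruct Hw; auto.
    * intros F HF Hi. split; [apply H|apply H']; auto; intros w Hw; apply Hi, in_or_app; auto.
  + intros P Q HPQ [F0 [H0 H]]. exists F0. split; auto.
Qed.

Lemma has_sum_filterlim (A : C -> Prop) (f : C -> C) (s : C) :
  has_sum A f s <-> filterlim (sum_list f) (finite_sets A) (locally (s : C_R_NormedModule)).
Proof.
split.
- intros H. apply filterlim_locally. intros eps.
  destruct (H eps (cond_pos eps)) as [F0 [H0 H1]].
  exists F0. split; [exact H0|]. intros F [HF1 HF2] Hi.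
  apply C_NormedModule_mixin_compat1.
  exact (H1 F HF1 Hi HF2).
- intros H eps Heps.
  (* Balls of [C_R_NormedModule] are coordinatewise and control [Cmod] only up to the factor
     [sqrt 2]. *)
  assert (He : 0 < eps / sqrt 2).
  { apply Rdiv_lt_0_compat; [exact Heps|apply Rlt_sqrt2_0]. }
  destruct (proj1 (filterlim_locally _ _) H (mkposreal _ He)) as [F0 [H0 H1]].
  exists F0. split; [exact H0|]. intros F HF1 Hi HF2.
  assert (Hb := H1 F (conj HF1 HF2) Hi).
  apply C_NormedModule_mixin_compat2 in Hb. simpl in Hb.
  replace (sqrt 2 * (eps / sqrt 2)) with eps in Hb; [exact Hb|].
  field. apply Rgt_not_eq, Rlt_sqrt2_0.
Qed.

Lemma has_sum_unique (A : C -> Prop) (f : C -> C) (s t : C) :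
  has_sum A f s -> has_sum A f t -> s = t.
Proof.
rewrite !has_sum_filterlim. apply (filterlim_locally_unique (V := C_R_NormedModule)).
Qed.

Lemma sum_list_cons (f : C -> C) (w : C) (F : list C) :
  sum_list f (w :: F) = (f w + sum_list f F)%C.
Proof. reflexivity. Qed.

Lemma sum_list_ext (f g : C -> C) (F : list C) :
  (forall w, In w F -> f w = g w) -> sum_list f F = sum_list g F.
Proof.
induction F as [|w F IH]; intros H; [reflexivity|].
rewrite !sum_list_cons, H, IH; [reflexivity| |now left]. intros; apply H; now right.
Qed.

Lemma sum_list_plus (f g : C -> C) (F : list C) :
  sum_list (fun w => f w + g w)%C F = (sum_list f F + sum_list g F)%C.
Proof.
induction F as [|w F IH]; [unfold sum_list; cbn [fold_right app]; ring|]. rewrite !sum_list_cons, IH. ring.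
Qed.

Lemma sum_list_scal (c : C) (f : C -> C) (F : list C) :
  sum_list (fun w => c * f w)%C F = (c * sum_list f F)%C.
Proof.
induction F as [|w F IH]; [unfold sum_list; cbn [fold_right app]; ring|]. rewrite !sum_list_cons, IH. ring.
Qed.

Lemma sum_list_app (f : C -> C) (F G : list C) :
  sum_list f (F ++ G) = (sum_list f F + sum_list f G)%C.
Proof.
induction F as [|w F IH]; [unfold sum_list; cbn [fold_right app]; ring|]. cbn [app]. rewrite !sum_list_cons, IH. ring.
Qed.

Lemma sum_list_map (f g : C -> C) (F : list C) :
  sum_list f (map g F) = sum_list (fun w => f (g w)) F.
Proof. induction F as [|w F IH]; [reflexivity|]. cbn. now f_equal. Qed.

Lemma sum_list_perm (f : C -> C) (F G : list C) :
  Permutation F G -> sum_list f F = sum_list f G.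
Proof.
induction 1; cbn; [reflexivity| | |congruence].
- now f_equal.
- ring.
Qed.

Lemma incl_permutation (F0 F : list C) :
  NoDup F0 -> NoDup F -> incl F0 F -> exists G, Permutation F (F0 ++ G).
Proof.
revert F. induction F0 as [|w F0 IH]; intros F H0 HF Hi.
- exists F. reflexivity.
- destruct (in_split w F) as [l1 [l2 E]]; [apply Hi; now left|]. subst F.
  inversion H0; subst.
  destruct (IH (l1 ++ l2)) as [G HG]; auto.
  + now apply NoDup_remove_1 in HF.
  + intros x Hx. assert (Hx' : In x (l1 ++ w :: l2)) by (apply Hi; now right).
    apply in_app_or in Hx'. apply in_or_app. destruct Hx' as [?|[?|?]]; auto.
    subst. contradiction.
  + exists G. rewrite <- Permutation_middle. cbn. now constructor.
Qed.

Lemma has_sum_plus (A : C -> Prop) (f g : C -> C) (s t : C) :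
  has_sum A f s -> has_sum A g t -> has_sum A (fun w => f w + g w)%C (s + t)%C.
Proof.
rewrite !has_sum_filterlim. intros Hf Hg.
eapply filterlim_ext; [intros F; symmetry; apply sum_list_plus|].
eapply filterlim_comp_2; [exact Hf|exact Hg|].
apply (filterlim_plus (V := C_R_NormedModule)).
Qed.

Lemma has_sum_scal (A : C -> Prop) (c : C) (f : C -> C) (s : C) :
  has_sum A f s -> has_sum A (fun w => c * f w)%C (c * s)%C.
Proof.
intros H eps Heps.
assert (Hc := Cmod_ge_0 c).
destruct (H (eps / (Cmod c + 1))) as [F0 [H0 H1]].
{ apply Rdiv_lt_0_compat; lra. }
exists F0. split; [exact H0|]. intros F HF Hi HA.
rewrite sum_list_scal.
replace (c * sum_list f F - c * s)%C with (c * (sum_list f F - s))%C by ring.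
rewrite Cmod_mult.
apply Rle_lt_trans with (Cmod c * (eps / (Cmod c + 1))).
- apply Rmult_le_compat_l; [exact Hc|]. left. now apply H1.
- apply Rlt_le_trans with ((Cmod c + 1) * (eps / (Cmod c + 1))).
  + apply Rmult_lt_compat_r; [apply Rdiv_lt_0_compat|]; lra.
  + right. field. lra.
Qed.

Lemma has_sum_minus (A : C -> Prop) (f g : C -> C) (s t : C) :
  has_sum A f s -> has_sum A g t -> has_sum A (fun w => f w - g w)%C (s - t)%C.
Proof.
intros Hf Hg. apply (has_sum_scal _ (- (1))%C) in Hg.
assert (H := has_sum_plus _ _ _ _ _ Hf Hg).
replace (s - t)%C with (s + - (1) * t)%C by ring.
intros eps Heps. destruct (H eps Heps) as [F0 [H0 H1]].
exists F0. split; auto. intros F HF Hi HA.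
rewrite (sum_list_ext _ (fun w => f w + - (1) * g w)%C); [now apply H1|].
intros; ring.
Qed.

Lemma has_sum_ext (A B : C -> Prop) (f g : C -> C) (s : C) :
  (forall w, A w <-> B w) -> (forall w, A w -> f w = g w) ->
  has_sum A f s -> has_sum B g s.
Proof.
intros HAB Hfg H eps Heps. destruct (H eps Heps) as [F0 [H0 H1]].
exists F0. split; [intros; apply HAB; auto|]. intros F HF Hi HA.
rewrite <- (sum_list_ext f).
- apply H1; auto. intros; apply HAB; auto.
- intros; apply Hfg, HAB, HA; auto.
Qed.

(** Used with [Copp] and [Cconj]: an involution of [A] carries finite subsets to finite subsets, and
    a list containing the image of [F0] to one containing [F0]. *)
Lemma has_sum_reindex (A : C -> Prop) (phi : C -> C) (f : C -> C) (s : C) :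
  (forall w, A w -> A (phi w)) -> (forall w, phi (phi w) = w) ->
  has_sum A f s -> has_sum A (fun w => f (phi w)) s.
Proof.
intros HA Hphi H eps Heps. destruct (H eps Heps) as [F0 [H0 H1]].
exists (map phi F0). split.
- intros w Hw. apply in_map_iff in Hw. destruct Hw as [x [<- Hx]]. auto.
- intros F HF Hi HAF. rewrite <- sum_list_map. apply H1.
  + apply FinFun.Injective_map_NoDup; [|exact HF].
    intros x y E. rewrite <- (Hphi x), <- (Hphi y). now rewrite E.
  + intros w Hw. apply in_map_iff. exists (phi w). split; [apply Hphi|].
    apply Hi. now apply in_map.
  + intros w Hw. apply in_map_iff in Hw. destruct Hw as [x [<- Hx]]. auto.
Qed.

Lemma has_sum_conj (A : C -> Prop) (f : C -> C) (s : C) :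
  has_sum A f s -> has_sum A (fun w => Cconj (f w)) (Cconj s).
Proof.
intros H eps Heps. destruct (H eps Heps) as [F0 [H0 H1]].
exists F0. split; [exact H0|]. intros F HF Hi HA.
replace (sum_list (fun w => Cconj (f w)) F) with (Cconj (sum_list f F)).
- rewrite <- Cminus_conj, Cmod_conj. auto.
- clear. induction F as [|w F IH].
  + apply injective_projections; cbn; ring.
  + rewrite !sum_list_cons, Cplus_conj. now f_equal.
Qed.

Definition norm_sum (f : C -> C) (F : list C) : R :=
  fold_right (fun w s => Cmod (f w) + s) 0 F.

Lemma norm_sum_cons (f : C -> C) (w : C) (F : list C) :
  norm_sum f (w :: F) = Cmod (f w) + norm_sum f F.
Proof. reflexivity. Qed.

Definition abs_summable (A : C -> Prop) (f : C -> C) (B : R) : Prop :=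
  forall F, finite_in A F -> norm_sum f F <= B.

Lemma norm_sum_ge_0 (f : C -> C) (F : list C) : 0 <= norm_sum f F.
Proof.
induction F as [|w F IH]; [cbn; lra|]. rewrite norm_sum_cons. assert (H := Cmod_ge_0 (f w)). lra.
Qed.

Lemma norm_sum_app (f : C -> C) (F G : list C) :
  norm_sum f (F ++ G) = norm_sum f F + norm_sum f G.
Proof. induction F as [|w F IH]; cbn [app]; [unfold norm_sum; cbn [fold_right app filter]; ring|]. rewrite !norm_sum_cons, IH. ring. Qed.

Lemma norm_sum_perm (f : C -> C) (F G : list C) :
  Permutation F G -> norm_sum f F = norm_sum f G.
Proof. induction 1; rewrite ?norm_sum_cons; lra. Qed.

Lemma Cmod_sum_list_le (f : C -> C) (F : list C) : Cmod (sum_list f F) <= norm_sum f F.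
Proof.
induction F as [|w F IH].
- cbn. rewrite Cmod_0. lra.
- rewrite sum_list_cons, norm_sum_cons. eapply Rle_trans; [apply Cmod_triangle|]. lra.
Qed.

Lemma norm_sum_le (f g : C -> C) (K : R) (F : list C) :
  (forall w, In w F -> Cmod (f w) <= K * Cmod (g w)) -> norm_sum f F <= K * norm_sum g F.
Proof.
induction F as [|w F IH]; intros H; [cbn; lra|].
assert (H1 := H w (or_introl eq_refl)).
assert (H2 := IH (fun x Hx => H x (or_intror Hx))).
rewrite !norm_sum_cons, Rmult_plus_distr_l. lra.
Qed.

Lemma abs_summable_le (A : C -> Prop) (f g : C -> C) (K B : R) :
  0 <= K -> (forall w, A w -> Cmod (f w) <= K * Cmod (g w)) ->
  abs_summable A g B -> abs_summable A f (K * B).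
Proof.
intros HK H Hg F HF. eapply Rle_trans; [apply norm_sum_le|].
- intros w Hw. apply H, HF, Hw.
- apply Rmult_le_compat_l; auto.
Qed.

(** Cauchy criterion: once the norm sum over [F0] is within eps/2 of the supremum, whatever is added
    to [F0] has norm sum below eps/2. *)
Lemma abs_summable_has_sum (A : C -> Prop) (f : C -> C) (B : R) :
  abs_summable A f B -> exists s, has_sum A f s.
Proof.
intros HB.
destruct (completeness (fun x => exists F, finite_in A F /\ x = norm_sum f F)) as [S [HS1 HS2]].
- exists B. intros x [F [HF ->]]. auto.
- exists (norm_sum f nil), nil. split; [|reflexivity]. split; [constructor|easy].
- assert (Hex : exists s : C_R_CompleteNormedModule,
     filterlim (sum_list f) (finite_sets A) (locally s)).
  { apply (filterlim_locally_cauchy (U := C_R_CompleteNormedModule)). intros eps.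
    assert (Hn : exists F0, finite_in A F0 /\ S - eps / 2 < norm_sum f F0).
    { apply NNPP. intros Hno. assert (S <= S - eps / 2); [|generalize (cond_pos eps); lra].
      apply HS2. intros x [F [HF ->]]. apply Rnot_lt_le. intros Hlt. apply Hno. now exists F. }
    destruct Hn as [F0 [HF0 Hlt]].
    assert (Hclose : forall F, finite_in A F -> incl F0 F ->
              Cmod (sum_list f F - sum_list f F0) < eps / 2).
    { intros F HF Hi. destruct (incl_permutation F0 F (proj1 HF0) (proj1 HF) Hi) as [G HG].
      rewrite (sum_list_perm _ _ _ HG), sum_list_app.
      replace (sum_list f F0 + sum_list f G - sum_list f F0)%C with (sum_list f G) by ring.
      eapply Rle_lt_trans; [apply Cmod_sum_list_le|].
      assert (HSF : norm_sum f F <= S) by (apply HS1; now exists F).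
      rewrite (norm_sum_perm _ _ _ HG), norm_sum_app in HSF. lra. }
    exists (fun F => finite_in A F /\ incl F0 F). split.
    - exists F0. split; [apply HF0|]. auto.
    - intros F G [HF HiF] [HG HiG].
      apply C_NormedModule_mixin_compat1.
      change (Cmod (sum_list f G - sum_list f F)%C < eps).
      replace (sum_list f G - sum_list f F)%C with
        ((sum_list f G - sum_list f F0) + - (sum_list f F - sum_list f F0))%C by ring.
      eapply Rle_lt_trans; [apply Cmod_triangle|]. rewrite Cmod_opp.
      generalize (Hclose F HF HiF) (Hclose G HG HiG). lra. }
  destruct Hex as [s Hs]. exists s. apply has_sum_filterlim. exact Hs.
Qed.

Lemma has_sum_Cmod_le (A : C -> Prop) (f : C -> C) (s : C) (B : R) :
  has_sum A f s -> abs_summable A f B -> Cmod s <= B.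
Proof.
intros H HB. apply le_epsilon. intros eps Heps.
destruct (H eps Heps) as [F0 [H0 H1]].
set (F := nodup C_eq_dec F0).
assert (HF : finite_in A F).
{ split; [apply NoDup_nodup|]. intros w Hw. apply H0. now apply (nodup_In C_eq_dec). }
assert (H2 : Cmod (sum_list f F - s)%C < eps).
{ apply H1; [apply HF| |apply HF]. intros w Hw. now apply nodup_In. }
replace s with (sum_list f F + - (sum_list f F - s))%C by ring.
eapply Rle_trans; [apply Cmod_triangle|]. rewrite Cmod_opp.
assert (H3 := Cmod_sum_list_le f F). assert (H4 := HB F HF). lra.
Qed.

(* Split [F] by the signs of the real and of the imaginary part of [f]. *)
Lemma norm_sum_le_subsets (f : C -> C) (F : list C) (M : R) :
  (forall q : C -> bool, Cmod (sum_list f (filter q F)) <= M) ->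
  norm_sum f F <= 4 * M.
Proof.
intros H.
assert (HRe : forall G, Re (sum_list f G) = fold_right (fun w s => Re (f w) + s) 0 G).
{ induction G as [|w G IH]; [reflexivity|]. cbn. unfold Re in *. cbn. now rewrite <- IH. }
assert (HIm : forall G, Im (sum_list f G) = fold_right (fun w s => Im (f w) + s) 0 G).
{ induction G as [|w G IH]; [reflexivity|]. cbn. unfold Im in *. cbn. now rewrite <- IH. }
assert (Hex : exists pos : R -> bool, forall x b, pos x = b -> Rabs x = if b then x else - x).
{ exists (fun x => if Rle_dec 0 x then true else false).
  intros x b <-. destruct (Rle_dec 0 x); [apply Rabs_right|apply Rabs_left]; lra. }
destruct Hex as [pos Hpos].
assert (Hs : norm_sum f F <=
  Re (sum_list f (filter (fun w => pos (Re (f w))) F))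
  - Re (sum_list f (filter (fun w => negb (pos (Re (f w)))) F))
  + Im (sum_list f (filter (fun w => pos (Im (f w))) F))
  - Im (sum_list f (filter (fun w => negb (pos (Im (f w)))) F))).
{ rewrite !HRe, !HIm. clear H.
  induction F as [|w F IH]; [cbn; lra|].
  rewrite norm_sum_cons. cbn [filter].
  assert (Hw : Cmod (f w) <= Rabs (Re (f w)) + Rabs (Im (f w))).
  { replace (f w) with ((Re (f w), 0) + (0, Im (f w)))%C at 1
      by (apply injective_projections; unfold Re, Im; cbn; ring).
    eapply Rle_trans; [apply Cmod_triangle|]. unfold Cmod; cbn.
    right. f_equal; rewrite <- sqrt_Rsqr_abs; f_equal; unfold Rsqr; ring. }
  destruct (pos (Re (f w))) eqn:E1; destruct (pos (Im (f w))) eqn:E2;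
    apply Hpos in E1; apply Hpos in E2; rewrite E1, E2 in Hw; cbn [negb fold_right]; lra. }
assert (HR : forall q, Rabs (Re (sum_list f (filter q F))) <= M).
{ intros q. eapply Rle_trans; [apply re_le_Cmod|apply H]. }
assert (HI : forall q, Rabs (Im (sum_list f (filter q F))) <= M).
{ intros q. eapply Rle_trans; [|apply (H q)]. eapply Rle_trans; [|apply Rmax_Cmod]. apply Rmax_r. }
generalize (proj1 (Rabs_le_between _ _) (HR (fun w => pos (Re (f w)))))
  (proj1 (Rabs_le_between _ _) (HR (fun w => negb (pos (Re (f w))))))
  (proj1 (Rabs_le_between _ _) (HI (fun w => pos (Im (f w)))))
  (proj1 (Rabs_le_between _ _) (HI (fun w => negb (pos (Im (f w)))))).
lra.
Qed.

(** The sum over a finite set disjoint from [F0] is the difference of two partial sums over sets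
    containing [F0], so its modulus is at most 2; [norm_sum_le_subsets] passes from such sums to the
    norm sum. *)
Lemma has_sum_abs_summable (A : C -> Prop) (f : C -> C) (s : C) :
  has_sum A f s -> exists B, abs_summable A f B.
Proof.
intros H. destruct (H 1 Rlt_0_1) as [F0' [H0' H1']].
pose (F0 := nodup C_eq_dec F0').
assert (H0 : finite_in A F0).
{ split; [apply NoDup_nodup|]. intros w Hw. apply H0'. now apply (nodup_In C_eq_dec). }
assert (H1 : forall F, finite_in A F -> incl F0 F -> Cmod (sum_list f F - s) < 1).
{ intros F HF Hi. apply H1'; [apply HF| |apply HF].
  intros w Hw. apply Hi. now apply nodup_In. }
assert (H2 : forall G, finite_in A G -> (forall w, In w G -> ~ In w F0) -> Cmod (sum_list f G) <= 2).
{ intros G HG Hd.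
  replace (sum_list f G) with ((sum_list f (F0 ++ G) - s) + - (sum_list f F0 - s))%C
    by (rewrite sum_list_app; ring).
  eapply Rle_trans; [apply Cmod_triangle|]. rewrite Cmod_opp.
  assert (Cmod (sum_list f F0 - s) < 1) by (apply H1; [exact H0|apply incl_refl]).
  assert (Cmod (sum_list f (F0 ++ G) - s) < 1); [|lra].
  apply H1.
  - split.
    + apply NoDup_app; [apply H0|apply HG|]. intros w Hw1 Hw2. exact (Hd w Hw2 Hw1).
    + intros w Hw. apply in_app_or in Hw. destruct Hw; [now apply H0|now apply HG].
  - intros w Hw. apply in_or_app. now left. }
(* The entries of [F] in [F0] contribute at most [norm_sum f F0], the others at most 4 * 2. *)
exists (norm_sum f F0 + 8). intros F HF.
pose (q := fun w => if in_dec C_eq_dec w F0 then true else false).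
assert (Hsplit : norm_sum f F = norm_sum f (filter q F) + norm_sum f (filter (fun w => negb (q w)) F)).
{ clear. induction F as [|w F IH]; [unfold norm_sum; cbn [fold_right app filter]; ring|]. cbn [filter]. rewrite norm_sum_cons, IH. destruct (q w); cbn [negb]; rewrite norm_sum_cons; ring. }
rewrite Hsplit. apply Rplus_le_compat.
- assert (Hi : incl (filter q F) F0).
  { intros w Hw. apply filter_In in Hw. destruct Hw as [_ Hw]. unfold q in Hw.
    destruct (in_dec C_eq_dec w F0); [assumption|discriminate]. }
  destruct (incl_permutation (filter q F) F0) as [G HG]; auto.
  + apply NoDup_filter, HF.
  + apply H0.
  + rewrite (norm_sum_perm _ _ _ HG), norm_sum_app. assert (Hg := norm_sum_ge_0 f G). lra.
- replace 8 with (4 * 2) by ring. apply norm_sum_le_subsets. intros r. apply H2.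
  + split; [apply NoDup_filter, NoDup_filter, HF|].
    intros w Hw. apply filter_In in Hw. destruct Hw as [Hw _]. apply filter_In in Hw. apply HF, Hw.
  + intros w Hw. apply filter_In in Hw. destruct Hw as [Hw _]. apply filter_In in Hw.
    destruct Hw as [_ Hw]. unfold q in Hw. destruct (in_dec C_eq_dec w F0); [discriminate|assumption].
Qed.

(** * Periods of the Weierstrass function *)

Lemma Cmod_inv_le (a : C) (r : R) : 0 < r -> r <= Cmod a -> Cmod (/ a) <= / r.
Proof.
intros Hr H. rewrite Cmod_inv.
- now apply Rinv_le_contravar.
- apply Cmod_gt_0. lra.
Qed.

Lemma Cmod_sub_ge (a b : C) : Cmod a - Cmod b <= Cmod (a - b).
Proof.
generalize (Cmod_triangle (a - b) b). replace (a - b + b)%C with a by ring. lra.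
Qed.

(** Controls the two end terms that survive when a row of the lattice sum telescopes. *)
Lemma inv_sq_eventually_small (u w : C) (eps : R) :
  w <> 0 -> 0 < eps ->
  exists M0 : nat, forall m : Z, (Z.of_nat M0 <= Z.abs m)%Z ->
    Cmod (1 / (u - IZR m * w) ^ 2) < eps.
Proof.
intros Hw Heps. assert (Hw' := proj1 (Cmod_gt_0 w) Hw).
assert (Hi := Rinv_0_lt_compat _ Heps).
assert (Hu := Cmod_ge_0 u).
destruct (archimed ((Cmod u + 1 + / eps) / Cmod w)) as [Hup _].
exists (Z.to_nat (up ((Cmod u + 1 + / eps) / Cmod w))). intros m Hm.
assert (Hm' : (Cmod u + 1 + / eps) / Cmod w < Rabs (IZR m)).
{ rewrite <- abs_IZR. eapply Rlt_le_trans; [exact Hup|]. apply IZR_le. lia. }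
apply Rlt_div_l in Hm'; [|lra].
assert (Ha : 1 + / eps < Cmod (u - IZR m * w)).
{ generalize (Cmod_sub_ge (IZR m * w) u).
  replace (IZR m * w - u)%C with (- (u - IZR m * w))%C by ring.
  rewrite Cmod_opp, Cmod_mult, Cmod_R. lra. }
set (a := (u - IZR m * w)%C) in *.
assert (Ha0 : a <> 0) by (apply Cmod_gt_0; lra).
replace (1 / a ^ 2)%C with (/ a * / a)%C by (field; exact Ha0).
rewrite Cmod_mult, !Cmod_inv by exact Ha0.
assert (H1 : / Cmod a < eps).
{ rewrite <- (Rinv_inv eps). apply Rinv_lt_contravar; [|lra].
  apply Rmult_lt_0_compat; lra. }
assert (H2 : / Cmod a <= 1) by (rewrite <- Rinv_1; apply Rinv_le_contravar; lra).
assert (H3 : 0 < / Cmod a) by (apply Rinv_0_lt_compat; lra).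
nra.
Qed.

Definition csum (l : list C) : C := fold_right Cplus (RtoC 0) l.

Lemma sum_list_csum (f : C -> C) (F : list C) : sum_list f F = csum (map f F).
Proof. induction F as [|w F IH]; [reflexivity|]. rewrite sum_list_cons, IH. reflexivity. Qed.

Lemma csum_app (l l' : list C) : csum (l ++ l') = (csum l + csum l')%C.
Proof.
induction l as [|x l IH]; [unfold csum; cbn [app fold_right]; ring|].
change (x + csum (l ++ l') = x + csum l + csum l')%C. rewrite IH. ring.
Qed.

Definition centered_range (M : nat) : list Z :=
  map (fun k => (Z.of_nat k - Z.of_nat M)%Z) (seq 0 (2 * M + 1)).

Lemma in_centered_range (M : nat) (m : Z) : (Z.abs m <= Z.of_nat M)%Z -> In m (centered_range M).
Proof.
intros H. apply in_map_iff. exists (Z.to_nat (m + Z.of_nat M)). split; [lia|].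
apply in_seq. lia.
Qed.

Lemma NoDup_centered_range (M : nat) : NoDup (centered_range M).
Proof. apply FinFun.Injective_map_NoDup; [intros x y E; lia|apply seq_NoDup]. Qed.

Lemma csum_telescope (phi : Z -> C) (M : nat) :
  csum (map (fun m => phi (m - 1)%Z - phi m)%C (centered_range M)) =
  (phi (- Z.of_nat M - 1)%Z - phi (Z.of_nat M))%C.
Proof.
unfold centered_range. rewrite map_map.
assert (H : forall n, csum (map (fun k => phi (Z.of_nat k - Z.of_nat M - 1)%Z - phi (Z.of_nat k - Z.of_nat M)%Z)%C (seq 0 n))
  = (phi (- Z.of_nat M - 1)%Z - phi (Z.of_nat n - 1 - Z.of_nat M)%Z)%C).
{ induction n as [|n IH].
  - replace (Z.of_nat 0 - 1 - Z.of_nat M)%Z with (- Z.of_nat M - 1)%Z by lia.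
    unfold csum; cbn [seq map fold_right]. ring.
  - rewrite seq_S, map_app, csum_app, IH.
    replace (Z.of_nat (S n) - 1 - Z.of_nat M)%Z with (Z.of_nat n - Z.of_nat M)%Z by lia.
    replace (Z.of_nat n - 1 - Z.of_nat M)%Z with (Z.of_nat n - Z.of_nat M - 1)%Z by lia.
    rewrite Nat.add_0_l. unfold csum; cbn [map fold_right]. ring. }
rewrite H. do 2 f_equal. f_equal. lia.
Qed.

Lemma csum_list_prod (f : Z * Z -> C) (l l' : list Z) :
  csum (map f (list_prod l l')) = csum (map (fun n => csum (map (fun m => f (n, m)) l')) l).
Proof.
induction l as [|n l IH]; [reflexivity|].
cbn [list_prod]. rewrite map_app, map_map, csum_app, IH. reflexivity.
Qed.

Lemma NoDup_list_prod (l l' : list Z) : NoDup l -> NoDup l' -> NoDup (list_prod l l').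
Proof.
intros H H'. induction H as [|n l Hn H IH]; [constructor|].
cbn [list_prod]. apply NoDup_app.
- apply FinFun.Injective_map_NoDup; [intros x y E; now inversion E|exact H'].
- exact IH.
- intros [a b] H1 H2. apply in_map_iff in H1. destruct H1 as [x [E _]]. inversion E; subst.
  apply in_prod_iff in H2. tauto.
Qed.

Lemma lattice_swap (w1 w2 w : C) : lattice w1 w2 w <-> lattice w2 w1 w.
Proof. split; intros [m [n ->]]; exists n, m; ring. Qed.

Lemma lattice_0 (w1 w2 : C) : lattice w1 w2 0.
Proof. exists 0%Z, 0%Z. ring. Qed.

Lemma lattice_plus (w1 w2 u v : C) : lattice w1 w2 u -> lattice w1 w2 v -> lattice w1 w2 (u + v).
Proof.
intros [m [n ->]] [m' [n' ->]]. exists (m + m')%Z, (n + n')%Z.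
rewrite !plus_IZR, !RtoC_plus. ring.
Qed.

Lemma lattice_opp (w1 w2 u : C) : lattice w1 w2 u -> lattice w1 w2 (- u).
Proof.
intros [m [n ->]]. exists (- m)%Z, (- n)%Z. rewrite !opp_IZR, !RtoC_opp. ring.
Qed.

Lemma real_independent_swap (w1 w2 : C) : real_independent w1 w2 -> real_independent w2 w1.
Proof.
intros H a b E. destruct (H b a); [|tauto]. rewrite <- E. ring.
Qed.

(** The sum of 1/(z+w1-w)^2 - 1/(z-w)^2 over the whole lattice, 0 included, vanishes because every
    row of direction [w1] telescopes. Unordered convergence allows the sum to be evaluated along
    rectangles. *)
Lemma wp_generator_period (w1 w2 : C) (p : C -> option C) :
  real_independent w1 w2 -> is_wp_of_lattice (lattice w1 w2) p -> is_period p w1.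
Proof.
intros Hind Hp z.
assert (Hw1 : lattice w1 w2 w1) by (exists 1%Z, 0%Z; ring).
destruct (classic (lattice w1 w2 z)) as [Hz|Hz].
{ rewrite (proj1 (Hp _) Hz). apply Hp. now apply lattice_plus. }
assert (Hz' : ~ lattice w1 w2 (z + w1)).
{ intros H. apply Hz. replace z with (z + w1 + - w1)%C by ring.
  apply lattice_plus; [exact H|now apply lattice_opp]. }
destruct (proj2 (Hp _) Hz) as [s [Hs ->]].
destruct (proj2 (Hp _) Hz') as [t [Ht ->]].
assert (HT := has_sum_minus _ _ _ _ _ Ht Hs).
(* The corrections 1/w^2 cancel between the two values of p. *)
pose (T := fun w => (1 / (z + w1 - w) ^ 2 - 1 / (z - w) ^ 2)%C).
assert (HT' : has_sum (nonzero_in (lattice w1 w2)) T (t - s)).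
{ eapply has_sum_ext; [reflexivity| |exact HT]. intros w _. unfold T; cbn beta.
  set (x := (1 / w ^ 2)%C). ring. }
clear HT Hs Ht.
assert (w1 <> 0).
{ intros ->. destruct (Hind 1 0) as [H _]; [ring|]. lra. }
(* [t - s] omits the index w = 0; the principal parts of the two values supply it as [T 0]. *)
assert (Hz00 : (t - s + T 0 = 0)%C).
{ apply Cmod_eq_0. apply Rle_antisym; [|apply Cmod_ge_0]. apply le_epsilon. intros eps Heps.
  rewrite Rplus_0_l.
  destruct (HT' (eps / 2)) as [F0 [HF0 HF]]; [lra|].
  pose (g := fun q : Z * Z => (IZR (snd q) * w1 + IZR (fst q) * w2)%C).
  assert (Hg : forall q q', g q = g q' -> q = q').
  { intros [n m] [n' m'] E. unfold g in E; cbn in E.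
    destruct (Hind (IZR m - IZR m') (IZR n - IZR n')) as [E1 E2].
    - rewrite !RtoC_minus.
      transitivity ((IZR m * w1 + IZR n * w2) - (IZR m' * w1 + IZR n' * w2))%C; [ring|].
      rewrite E; ring.
    - f_equal; apply eq_IZR; lra. }
  assert (HN : exists N, forall w, In w F0 -> exists q,
    w = g q /\ (Z.abs (fst q) <= Z.of_nat N)%Z /\ (Z.abs (snd q) <= Z.of_nat N)%Z).
  { clear HF HT'. induction F0 as [|w F0 IH]; [exists 0%nat; easy|].
    destruct IH as [N HN]; [intros; apply HF0; now right|].
    destruct (HF0 w (or_introl eq_refl)) as [[m [n E]] _].
    exists (N + Z.to_nat (Z.abs m) + Z.to_nat (Z.abs n))%nat.
    intros x [<-|Hx].
    - exists (n, m). cbn. split; [exact E|lia].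
    - destruct (HN x Hx) as [q [E' Hq]]. exists q. split; [exact E'|lia]. }
  destruct HN as [N HN].
  (* For a fixed list [l] of rows the total tends to 0 as the half-length [M] of the rows grows. *)
  assert (Hsmall : forall (l : list Z) (d : R), 0 < d -> exists M0 : nat, forall M, (M0 <= M)%nat ->
     Cmod (csum (map (fun n => csum (map (fun m => T (g (n, m))) (centered_range M))) l)) < d).
  { induction l as [|n l IH]; intros d Hd.
    - exists 0%nat. intros. unfold csum; cbn [map fold_right]. now rewrite Cmod_0.
    - destruct (IH (d / 2)) as [M1 H1]; [lra|].
      destruct (inv_sq_eventually_small (z - IZR n * w2) w1 (d / 4)) as [M2 H2]; [assumption|lra|].
      exists (M1 + M2)%nat. intros M HM. cbn [map].
      match goal with |- Cmod (csum (?x :: ?y)) < _ => change (csum (x :: y)) with (x + csum y)%C end.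
      eapply Rle_lt_trans; [apply Cmod_triangle|].
      specialize (H1 M ltac:(lia)).
      pose (phi := fun m => (1 / (z - IZR n * w2 - IZR m * w1) ^ 2)%C).
      rewrite (map_ext (fun m => T (g (n, m))) (fun m => (phi (m - 1)%Z - phi m)%C)).
      2:{ intros m. unfold T, g, phi; cbn [fst snd]. rewrite minus_IZR, RtoC_minus.
          replace (z + w1 - (IZR m * w1 + IZR n * w2))%C
            with (z - IZR n * w2 - (IZR m - 1) * w1)%C by ring.
          replace (z - (IZR m * w1 + IZR n * w2))%C
            with (z - IZR n * w2 - IZR m * w1)%C by ring.
          reflexivity. }
      rewrite csum_telescope.
      assert (Ha := H2 (- Z.of_nat M - 1)%Z ltac:(lia)).
      assert (Hb := H2 (Z.of_nat M)%Z ltac:(lia)).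
      fold (phi (- Z.of_nat M - 1)%Z) in Ha. fold (phi (Z.of_nat M)) in Hb.
      generalize (Cmod_triangle (phi (- Z.of_nat M - 1)%Z) (- phi (Z.of_nat M))). rewrite Cmod_opp.
      unfold Cminus. lra. }
  destruct (Hsmall (centered_range N) (eps / 2)) as [M0 HM0]; [lra|].
  (* The number of rows is fixed before their length; adding [N] keeps [F0] inside the rectangle. *)
  pose (M := (M0 + N)%nat). specialize (HM0 M ltac:(lia)).
  pose (G := map g (list_prod (centered_range N) (centered_range M))).
  assert (HG : NoDup G).
  { apply FinFun.Injective_map_NoDup; [exact Hg|].
    apply NoDup_list_prod; apply NoDup_centered_range. }
  assert (HG0 : incl (RtoC 0 :: nil) G).
  { intros x [<-|[]]. apply in_map_iff. exists (0%Z, 0%Z). split; [unfold g; cbn [fst snd]; ring|].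
    apply in_prod; apply in_centered_range; lia. }
  assert (Hnd : NoDup (RtoC 0 :: nil)) by (constructor; [easy|constructor]).
  (* [F] is the rectangle without 0, a set of nonzero lattice points that contains [F0]. *)
  destruct (incl_permutation _ _ Hnd HG HG0) as [F HGF].
  cbn [app] in HGF.
  assert (HFn : NoDup (RtoC 0 :: F)) by (eapply Permutation_NoDup; eassumption).
  inversion HFn as [|? ? HF1 HF2]; subst.
  assert (HFs : Cmod (sum_list T F - (t - s)) < eps / 2).
  { apply HF; [exact HF2| |].
    - intros w Hw. destruct (HN w Hw) as [q [-> Hq]].
      assert (Hin : In (g q) (RtoC 0 :: F)).
      { eapply Permutation_in; [exact HGF|]. apply in_map. destruct q as [n m]. cbn in Hq.
        apply in_prod; apply in_centered_range; unfold M; lia. }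
      destruct Hin as [E|]; [|assumption]. destruct (HF0 _ Hw) as [_ H0]. now rewrite <- E in H0.
    - intros w Hw. split; [|intros ->; contradiction].
      assert (Hin : In w G).
      { eapply Permutation_in; [symmetry; exact HGF|now right]. }
      apply in_map_iff in Hin. destruct Hin as [[n m] [<- _]]. exists m, n. reflexivity. }
  assert (HGs : sum_list T G = (T 0 + sum_list T F)%C).
  { rewrite (sum_list_perm _ _ _ HGF). reflexivity. }
  assert (HGs' : Cmod (sum_list T G) < eps / 2).
  { unfold G. rewrite sum_list_csum, map_map, csum_list_prod. exact HM0. }
  replace (t - s + T 0)%C with (sum_list T G + - (sum_list T F - (t - s)))%C by (rewrite HGs; ring).
  eapply Rle_trans; [apply Cmod_triangle|]. rewrite Cmod_opp. lra. }
f_equal. unfold T in Hz00.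
replace (z + w1 - 0)%C with (z + w1)%C in Hz00 by ring.
replace (z - 0)%C with z in Hz00 by ring.
replace (1 / z ^ 2 + s)%C with (1 / z ^ 2 + s + (t - s + (1 / (z + w1) ^ 2 - 1 / z ^ 2)))%C
  by (rewrite Hz00; ring).
set (x := (1 / z ^ 2)%C). set (y := (1 / (z + w1) ^ 2)%C). ring.
Qed.

Lemma is_period_plus (p : C -> option C) (u v : C) :
  is_period p u -> is_period p v -> is_period p (u + v).
Proof. intros Hu Hv z. rewrite Cplus_assoc, Hv. apply Hu. Qed.

Lemma is_period_opp (p : C -> option C) (u : C) : is_period p u -> is_period p (- u).
Proof. intros Hu z. rewrite <- (Hu (z + - u)%C). f_equal. ring. Qed.

Lemma is_period_multiple (p : C -> option C) (u : C) (m : Z) :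
  is_period p u -> is_period p (IZR m * u).
Proof.
intros Hu.
assert (Hn : forall n : nat, is_period p (INR n * u)).
{ induction n as [|n IH].
  - intros z. f_equal. cbn [INR]. ring.
  - rewrite S_INR, RtoC_plus. replace ((INR n + 1) * u)%C with (INR n * u + u)%C by ring.
    now apply is_period_plus. }
destruct (Z_le_gt_dec 0 m).
- rewrite <- (Z2Nat.id m), <- INR_IZR_INZ by assumption. apply Hn.
- replace (IZR m * u)%C with (- (IZR (- m) * u))%C by (rewrite opp_IZR, RtoC_opp; ring).
  apply is_period_opp. rewrite <- (Z2Nat.id (- m)), <- INR_IZR_INZ by lia. apply Hn.
Qed.

(** A period moves the pole 0 to a pole, hence to a lattice point; conversely both generators are
    periods. *)
Lemma wp_periods (w1 w2 : C) (p : C -> option C) :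
  real_independent w1 w2 -> is_wp_of_lattice (lattice w1 w2) p ->
  forall w, is_period p w <-> lattice w1 w2 w.
Proof.
intros Hind Hp w. split.
- intros Hw. apply NNPP. intros Hn. destruct (proj2 (Hp w) Hn) as [s [_ E]].
  rewrite <- (Cplus_0_l w), Hw, (proj1 (Hp _) (lattice_0 _ _)) in E. discriminate.
- intros [m [n ->]]. apply is_period_plus; apply is_period_multiple.
  + eapply wp_generator_period; eassumption.
  + apply (wp_generator_period w2 w1); [now apply real_independent_swap|].
    intros z. destruct (Hp z) as [H1 H2]. split.
    * intros Hz. apply H1. now apply lattice_swap.
    * intros Hz. destruct H2 as [s [Hs E]]; [intros H; apply Hz; now apply lattice_swap|].
      exists s. split; [|exact E]. eapply has_sum_ext; [|reflexivity|exact Hs].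
      intros x. unfold nonzero_in. rewrite (lattice_swap w1 w2). reflexivity.
Qed.

(** * Eisenstein series *)

(* Complex differentiability with a quadratic remainder; unlike the bare limit
   definition it passes through absolutely convergent sums term by term. *)
Definition qdiff (f : C -> C) (z l : C) : Prop :=
  exists d K : R, 0 < d /\ 0 <= K /\
    forall k : C, Cmod k < d -> Cmod (f (z + k) - f z - l * k)%C <= K * Cmod k ^ 2.

Lemma qdiff_Lipschitz (f : C -> C) (z l : C) :
  qdiff f z l -> exists d K : R, 0 < d /\ 0 <= K /\
    forall k, Cmod k < d -> Cmod (f (z + k) - f z)%C <= K * Cmod k.
Proof.
intros [d [K [Hd [HK H]]]]. exists (Rmin d 1), (K + Cmod l).
split; [apply Rmin_glb_lt; lra|]. assert (Hl := Cmod_ge_0 l). split; [lra|].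
intros k Hk. assert (H1 := Rmin_l d 1). assert (H2 := Rmin_r d 1).
replace (f (z + k) - f z)%C with ((f (z + k) - f z - l * k) + l * k)%C by ring.
eapply Rle_trans; [apply Cmod_triangle|]. rewrite Cmod_mult.
specialize (H k ltac:(lra)). assert (Hk0 := Cmod_ge_0 k).
assert (K * Cmod k ^ 2 <= K * Cmod k).
{ apply Rmult_le_compat_l; [exact HK|]. nra. }
lra.
Qed.

Lemma qdiff_const (c z : C) : qdiff (fun _ => c) z 0.
Proof.
exists 1, 0. split; [lra|split; [lra|]]. intros k _.
replace (c - c - 0 * k)%C with (RtoC 0) by ring. rewrite Cmod_0. lra.
Qed.

Lemma qdiff_plus (f g : C -> C) (z l m : C) :
  qdiff f z l -> qdiff g z m -> qdiff (fun x => f x + g x)%C z (l + m)%C.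
Proof.
intros [d [K [Hd [HK H]]]] [d' [K' [Hd' [HK' H']]]].
exists (Rmin d d'), (K + K'). split; [now apply Rmin_glb_lt|]. split; [lra|].
intros k Hk. assert (H1 := Rmin_l d d'). assert (H2 := Rmin_r d d').
replace (f (z + k) + g (z + k) - (f z + g z) - (l + m) * k)%C
  with ((f (z + k) - f z - l * k) + (g (z + k) - g z - m * k))%C by ring.
eapply Rle_trans; [apply Cmod_triangle|].
specialize (H k ltac:(lra)). specialize (H' k ltac:(lra)). lra.
Qed.

Lemma qdiff_mult (f g : C -> C) (z l m : C) :
  qdiff f z l -> qdiff g z m -> qdiff (fun x => f x * g x)%C z (l * g z + f z * m)%C.
Proof.
intros Hf Hg.
destruct (qdiff_Lipschitz _ _ _ Hf) as [d1 [K1 [Hd1 [HK1 H1]]]].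
destruct (qdiff_Lipschitz _ _ _ Hg) as [d2 [K2 [Hd2 [HK2 H2]]]].
destruct Hf as [d3 [K3 [Hd3 [HK3 H3]]]]. destruct Hg as [d4 [K4 [Hd4 [HK4 H4]]]].
exists (Rmin (Rmin d1 d2) (Rmin d3 d4)), (K1 * K2 + (K3 * Cmod (g z) + Cmod (f z) * K4)).
assert (Hg0 := Cmod_ge_0 (g z)). assert (Hf0 := Cmod_ge_0 (f z)).
split; [repeat apply Rmin_glb_lt; assumption|].
split; [assert (0 <= K1 * K2) by nra; assert (0 <= K3 * Cmod (g z)) by nra;
        assert (0 <= Cmod (f z) * K4) by nra; lra|].
intros k Hk.
generalize (Rmin_l (Rmin d1 d2) (Rmin d3 d4)), (Rmin_r (Rmin d1 d2) (Rmin d3 d4)),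
  (Rmin_l d1 d2), (Rmin_r d1 d2), (Rmin_l d3 d4), (Rmin_r d3 d4). intros.
specialize (H1 k ltac:(lra)). specialize (H2 k ltac:(lra)).
specialize (H3 k ltac:(lra)). specialize (H4 k ltac:(lra)).
replace (f (z + k) * g (z + k) - f z * g z - (l * g z + f z * m) * k)%C
  with ((f (z + k) - f z) * (g (z + k) - g z)
        + ((f (z + k) - f z - l * k) * g z + f z * (g (z + k) - g z - m * k)))%C by ring.
assert (Hk0 := Cmod_ge_0 k).
eapply Rle_trans; [apply Cmod_triangle|].
eapply Rle_trans; [apply Rplus_le_compat_l, Cmod_triangle|].
rewrite !Cmod_mult, !Rmult_plus_distr_r.
apply Rplus_le_compat; [|apply Rplus_le_compat].
- replace (K1 * K2 * Cmod k ^ 2) with ((K1 * Cmod k) * (K2 * Cmod k)) by ring.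
  apply Rmult_le_compat; try apply Cmod_ge_0; assumption.
- replace (K3 * Cmod (g z) * Cmod k ^ 2) with ((K3 * Cmod k ^ 2) * Cmod (g z)) by ring.
  apply Rmult_le_compat_r; assumption.
- rewrite Rmult_assoc. apply Rmult_le_compat_l; assumption.
Qed.

Lemma qdiff_scal (c : C) (f : C -> C) (z l : C) :
  qdiff f z l -> qdiff (fun x => c * f x)%C z (c * l)%C.
Proof.
intros H. assert (H' := qdiff_mult _ _ _ _ _ (qdiff_const c z) H).
cbn beta in H'. now replace (0 * f z + c * l)%C with (c * l)%C in H' by ring.
Qed.

(** [c] and [b] stand for 1/a and 1/(a + k). The statement is purely algebraic in them, so one
    constant serves all lattice points at once and the bound can be summed. *)
Lemma inv_pow_taylor (n : nat) :
  exists K, 0 <= K /\ forall b c k : C,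
    (b - c = - k * b * c)%C -> Cmod b <= 2 * Cmod c ->
    Cmod (b ^ n - c ^ n + INR n * k * c ^ (n + 1))%C <= K * Cmod k ^ 2 * Cmod c ^ (n + 2).
Proof.
induction n as [|n [K [HK IH]]].
- exists 0. split; [lra|]. intros b c k _ _. cbn [INR].
  replace (b ^ 0 - c ^ 0 + 0 * k * c ^ (0 + 1))%C with (RtoC 0) by (cbn [Cpow]; ring).
  rewrite Cmod_0. lra.
- exists (2 * K + 2 * INR (S n)). assert (Hn := pos_INR (S n)). split; [lra|].
  intros b c k E Hb. specialize (IH b c k E Hb).
  assert (E2 : (b = c - k * b * c)%C).
  { replace b with (b - c + c)%C at 1 by ring. rewrite E. ring. }
  (* Multiplying the remainder of order [n] by [b] leaves an error that is exactly quadratic in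
     [k]. *)
  replace (b ^ S n - c ^ S n + INR (S n) * k * c ^ (S n + 1))%C
    with (b * (b ^ n - c ^ n + INR n * k * c ^ (n + 1)) + INR (S n) * (k * k * b * c ^ (n + 2)))%C.
  2:{ replace (n + 2)%nat with (S (S n)) by lia. replace (S n + 1)%nat with (S (S n)) by lia.
      replace (n + 1)%nat with (S n) by lia. rewrite S_INR, RtoC_plus. cbn [Cpow].
      set (X := (c ^ n)%C). set (Y := (b ^ n)%C).
      assert (E3 : (b * X = c * X - k * b * c * X)%C) by (rewrite E2 at 1; ring).
      assert (E4 : (k * c * (b * X) = k * c * (c * X - k * b * c * X))%C) by now rewrite <- E3.
      transitivity (b * Y - b * X + INR n * (k * c * (b * X)) + (INR n + 1) * (k * k * b * (c * (c * X))))%C; [ring|].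
      assert (E5 : (b * X = c * X - k * c * (c * X - k * b * c * X))%C).
      { rewrite E3 at 1. replace (k * b * c * X)%C with (k * c * (b * X))%C at 1 by ring. now rewrite E4. }
      rewrite E4, E5. ring. }
  eapply Rle_trans; [apply Cmod_triangle|].
  rewrite !Cmod_mult, !Cmod_pow, Cmod_R, (Rabs_right (INR (S n))) by lra.
  assert (Hc := Cmod_ge_0 c). assert (Hb0 := Cmod_ge_0 b). assert (Hk := Cmod_ge_0 k).
  assert (Hp : 0 <= Cmod c ^ (n + 2)) by (apply pow_le, Hc).
  replace ((2 * K + 2 * INR (S n)) * Cmod k ^ 2 * Cmod c ^ (S n + 2))
    with (2 * Cmod c * (K * Cmod k ^ 2 * Cmod c ^ (n + 2))
          + INR (S n) * (Cmod k * Cmod k * (2 * Cmod c) * Cmod c ^ (n + 2)))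
    by (cbn [Nat.add pow]; ring).
  apply Rplus_le_compat.
  + apply Rmult_le_compat; try assumption; apply Cmod_ge_0.
  + apply Rmult_le_compat_l; [lra|]. apply Rmult_le_compat_r; [exact Hp|].
    apply Rmult_le_compat_l; [nra|exact Hb].
Qed.

Lemma inv_shift (a k : C) : a <> 0 -> (a + k)%C <> 0 ->
  (/ (a + k) - / a = - k * / (a + k) * / a)%C.
Proof. intros. field. auto. Qed.

Lemma Cmod_shift_inv (a k : C) : a <> 0 -> Cmod k <= Cmod a / 2 ->
  (a + k)%C <> 0 /\ Cmod (/ (a + k)) <= 2 * Cmod (/ a).
Proof.
intros Ha Hk. assert (Ha' := proj1 (Cmod_gt_0 a) Ha).
assert (H : Cmod a / 2 <= Cmod (a + k)).
{ generalize (Cmod_sub_ge a (- k)). rewrite Cmod_opp.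
  replace (a - - k)%C with (a + k)%C by ring. lra. }
split; [apply Cmod_gt_0; lra|].
eapply Rle_trans; [apply (Cmod_inv_le _ (Cmod a / 2)); lra|].
rewrite Cmod_inv by exact Ha. right. field. lra.
Qed.

Lemma qdiff_inv_pow (n : nat) (z : C) : z <> 0 ->
  qdiff (fun x => (/ x) ^ n)%C z (- INR n * (/ z) ^ (n + 1))%C.
Proof.
intros Hz. assert (Hz' := proj1 (Cmod_gt_0 z) Hz).
destruct (inv_pow_taylor n) as [K [HK H]].
exists (Cmod z / 2), (K * Cmod (/ z) ^ (n + 2)). split; [lra|].
split; [apply Rmult_le_pos; [exact HK|apply pow_le, Cmod_ge_0]|].
intros k Hk. destruct (Cmod_shift_inv z k Hz ltac:(lra)) as [H1 H2].
replace ((/ (z + k)) ^ n - (/ z) ^ n - - INR n * (/ z) ^ (n + 1) * k)%C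
  with ((/ (z + k)) ^ n - (/ z) ^ n + INR n * k * (/ z) ^ (n + 1))%C by ring.
eapply Rle_trans; [apply H; [now apply inv_shift|exact H2]|]. right; ring.
Qed.

(** Choice makes the sum a total function, so that series can be handled as functions of [z]; its
    value is meaningful once a sum is known to exist. *)
Definition lsum (A : C -> Prop) (f : C -> C) : C :=
  epsilon (inhabits (RtoC 0)) (has_sum A f).

Lemma lsum_correct (A : C -> Prop) (f : C -> C) (s : C) : has_sum A f s -> has_sum A f (lsum A f).
Proof. intros H. unfold lsum. apply epsilon_spec. now exists s. Qed.

Lemma lsum_unique (A : C -> Prop) (f : C -> C) (s : C) : has_sum A f s -> lsum A f = s.
Proof. intros H. eapply has_sum_unique; [eapply lsum_correct|]; exact H. Qed.

(** An additive subgroup with a gap [r] around 0. The gap is what makes the estimates below uniform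
    over lattice points. *)
Record discrete_group (L : C -> Prop) (r : R) : Prop := {
  dg_pos : 0 < r;
  dg_0 : L 0;
  dg_minus : forall u v, L u -> L v -> L (u - v)%C;
  dg_gap : forall w, L w -> w <> 0 -> r <= Cmod w
}.

Arguments dg_pos {L r}. Arguments dg_0 {L r}. Arguments dg_minus {L r}. Arguments dg_gap {L r}.

Lemma dg_opp (L : C -> Prop) (r : R) (w : C) : discrete_group L r -> L w -> L (- w)%C.
Proof.
intros HL Hw. replace (- w)%C with (0 - w)%C by ring. apply (dg_minus HL); [apply (dg_0 HL)|exact Hw].
Qed.

Lemma dg_plus (L : C -> Prop) (r : R) (u v : C) : discrete_group L r -> L u -> L v -> L (u + v)%C.
Proof.
intros HL Hu Hv. replace (u + v)%C with (u - (- v))%C by ring.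
apply (dg_minus HL); [exact Hu|eapply dg_opp; eassumption].
Qed.

(** Two lattice points closer than r/2 to [z] would be closer than [r] to each other, so there is at
    most one such point. *)
Lemma dg_distance (L : C -> Prop) (r : R) (z : C) :
  discrete_group L r -> exists d, 0 < d /\ forall w, L w -> w <> z -> d <= Cmod (z - w)%C.
Proof.
intros HL. assert (Hr := dg_pos HL).
destruct (classic (exists w0, L w0 /\ w0 <> z /\ Cmod (z - w0) < r / 2)) as [[w0 [H0 [H1 H2]]]|Hn].
- exists (Cmod (z - w0)). split.
  + apply Cmod_gt_0. intros E. apply H1. replace w0 with (z - (z - w0))%C by ring. rewrite E. ring.
  + intros w Hw Hwz. destruct (C_eq_dec w w0) as [->|Hne]; [lra|].
    assert (Hg : r <= Cmod (w - w0)).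
    { apply (dg_gap HL); [now apply (dg_minus HL)|]. intros E. apply Hne.
      replace w with (w0 + (w - w0))%C by ring. rewrite E. ring. }
    generalize (Cmod_sub_ge (w - w0) (z - w0)).
    replace (w - w0 - (z - w0))%C with (- (z - w))%C by ring. rewrite Cmod_opp. lra.
- exists (r / 2). split; [lra|]. intros w Hw Hwz. apply Rnot_lt_le. intros Hlt. apply Hn.
  now exists w.
Qed.

Definition off_poles (L : C -> Prop) (z : C) : Prop := forall w, nonzero_in L w -> w <> z.

Lemma off_poles_0 (L : C -> Prop) : off_poles L 0.
Proof. intros w [_ H]. exact H. Qed.

Lemma off_poles_notin (L : C -> Prop) (z : C) : ~ L z -> off_poles L z.
Proof. intros H w [Hw _] ->. contradiction. Qed.

Lemma inv_sub_bound (L : C -> Prop) (r : R) (z : C) :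
  discrete_group L r -> off_poles L z ->
  exists K, 0 < K /\ forall w, nonzero_in L w ->
    (z - w)%C <> 0 /\ Cmod (/ (z - w)) <= K * Cmod (/ w).
Proof.
intros HL Hz. destruct (dg_distance L r z HL) as [d [Hd H]].
assert (Hz0 := Cmod_ge_0 z).
(* The factor 2 serves the points with |w| >= 2 (|z| + 1), which are at least |w|/2 away from [z];
   the second factor serves the remaining bounded set, at distance at least [d]. *)
exists (Rmax 2 (2 * (Cmod z + 1) / d)).
split; [eapply Rlt_le_trans; [|apply Rmax_l]; lra|].
intros w Hw. assert (Hwz := Hz w Hw). assert (Hd' := H w (proj1 Hw) Hwz).
assert (Hne : (z - w)%C <> 0) by (apply Cmod_gt_0; lra).
split; [exact Hne|].
assert (Hw0 := proj1 (Cmod_gt_0 w) (proj2 Hw)).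
assert (Hiw : 0 < / Cmod w) by now apply Rinv_0_lt_compat.
rewrite !Cmod_inv by (try apply (proj2 Hw); exact Hne).
destruct (Rle_dec (2 * (Cmod z + 1)) (Cmod w)) as [Hle|Hgt].
- apply Rle_trans with (2 * / Cmod w).
  + replace (2 * / Cmod w) with (/ (Cmod w / 2)) by (field; lra).
    apply Rinv_le_contravar; [lra|].
    generalize (Cmod_sub_ge w z). replace (w - z)%C with (- (z - w))%C by ring. rewrite Cmod_opp. lra.
  + apply Rmult_le_compat_r; [lra|apply Rmax_l].
- apply Rle_trans with (2 * (Cmod z + 1) / d * / Cmod w).
  + apply Rle_trans with (/ d); [now apply Rinv_le_contravar|].
    assert (Hid : 0 < / d) by now apply Rinv_0_lt_compat.
    replace (/ d) with (Cmod w * / d * / Cmod w) at 1 by (field; lra).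
    apply Rmult_le_compat_r; [lra|]. unfold Rdiv. apply Rmult_le_compat_r; lra.
  + apply Rmult_le_compat_r; [lra|apply Rmax_r].
Qed.

(** Obtained in [cube_summable_of_wp] from the given series of p; together with the gap it yields
    all higher weights. *)
Definition cube_summable (L : C -> Prop) : Prop :=
  exists B, abs_summable (nonzero_in L) (fun w => (/ w) ^ 3)%C B.

Lemma pow_summable (L : C -> Prop) (r : R) (n : nat) :
  discrete_group L r -> cube_summable L ->
  exists B, 0 <= B /\ abs_summable (nonzero_in L) (fun w => (/ w) ^ (n + 3))%C B.
Proof.
intros HL [B HB]. assert (Hr := dg_pos HL). assert (Hir := Rinv_0_lt_compat _ Hr).
assert (Hrn : 0 <= (/ r) ^ n) by (apply pow_le; lra).
assert (HB0 : 0 <= B).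
{ apply Rle_trans with (norm_sum (fun w => (/ w) ^ 3)%C nil); [cbn; lra|].
  apply HB. split; [constructor|easy]. }
exists ((/ r) ^ n * B). split; [nra|].
eapply abs_summable_le; [exact Hrn| |exact HB].
intros w [Hw Hw0]. cbn beta. rewrite !Cmod_pow, pow_add.
apply Rmult_le_compat_r; [apply pow_le, Cmod_ge_0|].
apply pow_incr. split; [apply Cmod_ge_0|]. apply Cmod_inv_le; [exact Hr|].
now apply (dg_gap HL).
Qed.

(* The nonpolar part at 0 of the Eisenstein series of weight [n], corrected by
   the usual convergence term when [n = 2]. *)
Definition eis_term (n : nat) (z w : C) : C :=
  ((/ (z - w)) ^ n - (if Nat.eqb n 2 then (/ w) ^ 2 else 0))%C.

Definition eis (L : C -> Prop) (n : nat) (z : C) : C := lsum (nonzero_in L) (eis_term n z).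

(** In weight 2 the correction makes the terms O(|w|^(-3)), by factoring the difference of two
    squares; in higher weight [inv_sub_bound] suffices. *)
Lemma eis_has_sum (L : C -> Prop) (r : R) (n : nat) (z : C) :
  discrete_group L r -> cube_summable L -> off_poles L z ->
  has_sum (nonzero_in L) (eis_term (n + 2) z) (eis L (n + 2) z).
Proof.
intros HL HB Hz. destruct (inv_sub_bound L r z HL Hz) as [K [HK Hinv]].
assert (Hsum : exists B, abs_summable (nonzero_in L) (eis_term (n + 2) z) B).
{ destruct n as [|n].
  - destruct HB as [B HB].
    exists ((Cmod z * (K * (K + 1))) * B).
    assert (Hz0 := Cmod_ge_0 z).
    eapply abs_summable_le; [|  |exact HB].
    + apply Rmult_le_pos; [exact Hz0|nra].
    + intros w Hw. destruct (Hinv w Hw) as [H1 H2]. unfold eis_term; cbn [Nat.add Nat.eqb].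
      replace ((/ (z - w)) ^ 2 - (/ w) ^ 2)%C with
        ((z * / (z - w) * / w) * (/ (z - w) + - / w))%C.
      2:{ replace (z * / (z - w) * / w)%C with (/ (z - w) + / w)%C
            by (field; split; [apply (proj2 Hw)|exact H1]). ring. }
      rewrite !Cmod_mult, Cmod_pow.
      generalize (Cmod_triangle (/ (z - w)) (- / w)). rewrite Cmod_opp. intros H3.
      set (x := Cmod (/ w)) in *. set (y := Cmod (/ (z - w))) in *.
      assert (Hx : 0 <= x) by apply Cmod_ge_0. assert (Hy : 0 <= y) by apply Cmod_ge_0.
      replace (Cmod z * (K * (K + 1)) * x ^ 3) with ((Cmod z * (K * x) * x) * ((K + 1) * x)) by ring.
      apply Rmult_le_compat.
      * repeat apply Rmult_le_pos; assumption.
      * apply Cmod_ge_0.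
      * apply Rmult_le_compat_r; [exact Hx|]. apply Rmult_le_compat_l; assumption.
      * lra.
  - destruct (pow_summable L r n HL HB) as [B' [_ HB']].
    exists (K ^ (n + 3) * B'). eapply abs_summable_le; [apply pow_le; lra| |exact HB'].
    intros w Hw. destruct (Hinv w Hw) as [H1 H2]. unfold eis_term.
    replace (Nat.eqb (S n + 2) 2) with false by (symmetry; apply Nat.eqb_neq; lia).
    replace (S n + 2)%nat with (n + 3)%nat by lia.
    replace ((/ (z - w)) ^ (n + 3) - 0)%C with ((/ (z - w)) ^ (n + 3))%C by ring.
    rewrite !Cmod_pow, <- Rpow_mult_distr. apply pow_incr. split; [apply Cmod_ge_0|exact H2]. }
destruct Hsum as [B' HB']. destruct (abs_summable_has_sum _ _ _ HB') as [s Hs].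
eapply lsum_correct; exact Hs.
Qed.

Lemma qdiff_eis (L : C -> Prop) (r : R) (n : nat) (z : C) :
  discrete_group L r -> cube_summable L -> off_poles L z ->
  qdiff (eis L (n + 2)) z (- INR (n + 2) * eis L (n + 3) z)%C.
Proof.
intros HL HB Hz. destruct (inv_sub_bound L r z HL Hz) as [K [HK Hinv]].
assert (Hr := dg_pos HL).
destruct (inv_pow_taylor (n + 2)) as [T [HT HTay]].
destruct (pow_summable L r (n + 1) HL HB) as [B' [HB0 HB']].
(* Since r <= |w| <= K |z - w| for every nonzero lattice point, this radius keeps |k| below half of
   each |z - w|. *)
exists (r / (2 * K)), (T * K ^ (n + 4) * B').
assert (HKn : 0 <= K ^ (n + 4)) by (apply pow_le; lra).
split; [apply Rdiv_lt_0_compat; lra|].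
split; [apply Rmult_le_pos; [apply Rmult_le_pos|]; assumption|].
intros k Hk.
assert (Hterm : forall w, nonzero_in L w -> (z - w + k)%C <> 0 /\ Cmod (/ (z - w + k)) <= 2 * Cmod (/ (z - w))).
{ intros w Hw. destruct (Hinv w Hw) as [H1 H2]. apply Cmod_shift_inv; [exact H1|].
  rewrite !Cmod_inv in H2 by (try apply (proj2 Hw); exact H1).
  assert (Hw0 := proj1 (Cmod_gt_0 w) (proj2 Hw)). assert (Hzw := proj1 (Cmod_gt_0 _) H1).
  assert (Hg := dg_gap HL w (proj1 Hw) (proj2 Hw)).
  assert (H3 : Cmod w <= K * Cmod (z - w)).
  { apply (Rmult_le_compat_l (Cmod w * Cmod (z - w))) in H2; [|nra].
    replace (Cmod w * Cmod (z - w) * / Cmod (z - w)) with (Cmod w) in H2 by (field; lra).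
    replace (Cmod w * Cmod (z - w) * (K * / Cmod w)) with (K * Cmod (z - w)) in H2 by (field; lra).
    exact H2. }
  apply Rlt_div_r in Hk; [|lra]. nra. }
assert (Hzk : off_poles L (z + k)).
{ intros w Hw ->. destruct (Hterm _ Hw) as [H1 _]. apply H1. ring. }
assert (S1 := eis_has_sum L r n (z + k) HL HB Hzk).
assert (S2 := eis_has_sum L r n z HL HB Hz).
assert (S3 := eis_has_sum L r (S n) z HL HB Hz).
replace (S n + 2)%nat with (n + 3)%nat in S3 by lia.
assert (S4 := has_sum_minus _ _ _ _ _ (has_sum_minus _ _ _ _ _ S1 S2)
  (has_sum_scal _ (- INR (n + 2) * k)%C _ _ S3)).
replace (eis L (n + 2) (z + k) - eis L (n + 2) z - - INR (n + 2) * eis L (n + 3) z * k)%C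
  with (eis L (n + 2) (z + k) - eis L (n + 2) z - (- INR (n + 2) * k) * eis L (n + 3) z)%C by ring.
replace (T * K ^ (n + 4) * B' * Cmod k ^ 2) with ((T * Cmod k ^ 2 * K ^ (n + 4)) * B') by ring.
assert (Hk2 : 0 <= Cmod k ^ 2) by (apply pow_le, Cmod_ge_0).
eapply has_sum_Cmod_le; [exact S4|].
eapply abs_summable_le; [|  |exact HB'].
- apply Rmult_le_pos; [apply Rmult_le_pos|]; assumption.
- intros w Hw. cbn beta. destruct (Hinv w Hw) as [H1 H2]. destruct (Hterm w Hw) as [H3 H4].
  unfold eis_term. replace (Nat.eqb (n + 3) 2) with false by (symmetry; apply Nat.eqb_neq; lia).
  replace (z + k - w)%C with (z - w + k)%C by ring.
  set (u := (if Nat.eqb (n + 2) 2 then (/ w) ^ 2 else 0)%C).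
  replace ((/ (z - w + k)) ^ (n + 2) - u - ((/ (z - w)) ^ (n + 2) - u)
           - - INR (n + 2) * k * ((/ (z - w)) ^ (n + 3) - 0))%C
    with ((/ (z - w + k)) ^ (n + 2) - (/ (z - w)) ^ (n + 2)
          + INR (n + 2) * k * (/ (z - w)) ^ (n + 2 + 1))%C
    by (replace (n + 2 + 1)%nat with (n + 3)%nat by lia; ring).
  eapply Rle_trans; [apply HTay; [now apply inv_shift|exact H4]|].
  rewrite Cmod_pow. replace (n + 2 + 2)%nat with (n + 4)%nat by lia.
  replace (n + 1 + 3)%nat with (n + 4)%nat by lia.
  rewrite (Rmult_assoc _ (K ^ (n + 4))), <- Rpow_mult_distr.
  apply Rmult_le_compat_l; [apply Rmult_le_pos; assumption|].
  apply pow_incr. split; [apply Cmod_ge_0|exact H2].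
Qed.

Lemma qdiff_eq (f : C -> C) (z l m : C) : l = m -> qdiff f z l -> qdiff f z m.
Proof. now intros ->. Qed.

Lemma qdiff_unique (f : C -> C) (z l m : C) : qdiff f z l -> qdiff f z m -> l = m.
Proof.
intros [d [K [Hd [HK H]]]] [d' [K' [Hd' [HK' H']]]].
assert (E : (l - m = 0)%C).
{ apply Cmod_eq_0, Rle_antisym; [|apply Cmod_ge_0]. apply le_epsilon. intros eps Heps.
  rewrite Rplus_0_l.
  pose (t := Rmin (Rmin (d / 2) (d' / 2)) (eps / (K + K' + 1))).
  assert (Ht : 0 < t).
  { repeat apply Rmin_glb_lt; try lra. apply Rdiv_lt_0_compat; lra. }
  assert (H1 : t <= Rmin (d / 2) (d' / 2)) by apply Rmin_l.
  assert (H2 := Rmin_l (d / 2) (d' / 2)). assert (H3 := Rmin_r (d / 2) (d' / 2)).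
  assert (H4 : t <= eps / (K + K' + 1)) by apply Rmin_r.
  apply Rle_div_r in H4; [|lra].
  assert (Hm : Cmod (RtoC t) = t) by (rewrite Cmod_R; apply Rabs_right; lra).
  specialize (H t ltac:(lra)). specialize (H' t ltac:(lra)).
  assert (H5 : Cmod ((l - m) * t)%C <= (K + K') * t ^ 2).
  { replace ((l - m) * t)%C with ((f (z + t) - f z - m * t) + - (f (z + t) - f z - l * t))%C by ring.
    eapply Rle_trans; [apply Cmod_triangle|]. rewrite Cmod_opp. rewrite Hm in *. lra. }
  rewrite Cmod_mult, Hm in H5.
  assert (H6 : Cmod (l - m) <= (K + K') * t).
  { apply (Rmult_le_reg_r t); [exact Ht|]. lra. }
  nra. }
replace l with (l - m + m)%C by ring. rewrite E. ring.
Qed.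

Lemma off_lattice_open (L : C -> Prop) (r : R) (z : C) :
  discrete_group L r -> ~ L z -> exists d, 0 < d /\ forall k, Cmod k < d -> ~ L (z + k)%C.
Proof.
intros HL Hz. destruct (dg_distance L r z HL) as [d [Hd H]]. exists d. split; [exact Hd|].
intros k Hk Hzk. assert (Hne : (z + k)%C <> z) by (intros E; rewrite E in Hzk; contradiction).
specialize (H _ Hzk Hne). replace (z - (z + k))%C with (- k)%C in H by ring.
rewrite Cmod_opp in H. lra.
Qed.

Lemma nonzero_in_opp (L : C -> Prop) (r : R) (w : C) :
  discrete_group L r -> nonzero_in L w -> nonzero_in L (- w)%C.
Proof.
intros HL [Hw H0]. split; [eapply dg_opp; eassumption|].
intros E. apply H0. replace w with (- - w)%C by ring. rewrite E. ring.
Qed.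

Lemma has_sum_odd (L : C -> Prop) (r : R) (f : C -> C) (s : C) :
  discrete_group L r -> (forall w : C, w <> 0 -> f (- w)%C = (- f w)%C) ->
  has_sum (nonzero_in L) f s -> s = 0.
Proof.
intros HL Hf H.
assert (H' := has_sum_reindex _ Copp _ _ (fun w => nonzero_in_opp L r w HL) (fun w => ltac:(ring)) H).
assert (H2 := has_sum_scal _ (- (1))%C _ _ H').
assert (E : s = (- (1) * s)%C).
{ eapply has_sum_unique; [exact H|]. eapply has_sum_ext; [reflexivity| |exact H2].
  intros w [_ Hw]. cbn beta. rewrite (Hf w Hw). ring. }
assert (E2 : (2 * s = 0)%C).
{ replace (2 * s)%C with (s + s)%C by ring. rewrite E at 1. ring. }
replace s with (/ 2 * (2 * s))%C by (field; intros H3; apply RtoC_inj in H3; lra). rewrite E2. ring.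
Qed.

Lemma pow_inv_has_sum (L : C -> Prop) (r : R) (n : nat) :
  discrete_group L r -> cube_summable L ->
  exists s, has_sum (nonzero_in L) (fun w => (/ w) ^ (n + 3))%C s.
Proof.
intros HL HB. destruct (pow_summable L r n HL HB) as [B [_ H]]. eapply abs_summable_has_sum; exact H.
Qed.

Lemma inv_sub_near_0 (z w : C) : w <> 0 -> Cmod z <= Cmod w / 2 ->
  (z - w)%C <> 0 /\ Cmod (/ (z - w)) <= 2 * Cmod (/ w) /\ Cmod (z * / w) <= / 2.
Proof.
intros Hw Hz. assert (Hw' := proj1 (Cmod_gt_0 w) Hw).
assert (Hw2 : (- w)%C <> 0) by (apply Cmod_gt_0; now rewrite Cmod_opp).
destruct (Cmod_shift_inv (- w) z) as [H1 H2]; [exact Hw2|rewrite Cmod_opp; exact Hz|].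
replace (- w + z)%C with (z - w)%C in * by ring.
split; [exact H1|]. split.
- rewrite (Cmod_inv (- w)), Cmod_opp, <- Cmod_inv in H2 by assumption. exact H2.
- rewrite Cmod_mult, Cmod_inv by exact Hw. apply Rle_div_l; lra.
Qed.

(** [c3] to [c6] are the coefficients of a single term expanded in powers of 1/w. The sums of odd
    powers vanish under w -> -w, which leaves [G4] and [G6]. *)
Lemma eis_expansion_bound (L : C -> Prop) (r : R) (n : nat) (z c3 c4 c5 c6 G4 G6 : C) (B K : R) :
  discrete_group L r -> cube_summable L -> off_poles L z ->
  has_sum (nonzero_in L) (fun w => (/ w) ^ 4)%C G4 ->
  has_sum (nonzero_in L) (fun w => (/ w) ^ 6)%C G6 ->
  abs_summable (nonzero_in L) (fun w => (/ w) ^ 7)%C B -> 0 <= K ->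
  (forall w, nonzero_in L w ->
     Cmod (eis_term (n + 2) z w
           - (c3 * (/ w) ^ 3 + c4 * (/ w) ^ 4 + c5 * (/ w) ^ 5 + c6 * (/ w) ^ 6)) <= K * Cmod ((/ w) ^ 7)) ->
  Cmod (eis L (n + 2) z - (c4 * G4 + c6 * G6))%C <= K * B.
Proof.
intros HL HB Hz H4 H6 HB7 HK Hle.
destruct (pow_inv_has_sum L r 0 HL HB) as [G3 H3].
destruct (pow_inv_has_sum L r 2 HL HB) as [G5 H5].
assert (E3 : G3 = 0) by (eapply has_sum_odd; [exact HL| |exact H3]; intros w Hw; cbn beta; cbn [Nat.add Cpow]; field; exact Hw).
assert (E5 : G5 = 0) by (eapply has_sum_odd; [exact HL| |exact H5]; intros w Hw; cbn beta; cbn [Nat.add Cpow]; field; exact Hw).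
subst G3 G5. cbn [Nat.add] in H3, H5.
assert (S := has_sum_minus _ _ _ _ _ (eis_has_sum L r n z HL HB Hz)
  (has_sum_plus _ _ _ _ _ (has_sum_plus _ _ _ _ _ (has_sum_plus _ _ _ _ _
    (has_sum_scal _ c3 _ _ H3) (has_sum_scal _ c4 _ _ H4)) (has_sum_scal _ c5 _ _ H5)) (has_sum_scal _ c6 _ _ H6))).
replace (c4 * G4 + c6 * G6)%C with (c3 * 0 + c4 * G4 + c5 * 0 + c6 * G6)%C by ring.
eapply has_sum_Cmod_le; [exact S|]. eapply abs_summable_le; [exact HK|exact Hle|exact HB7].
Qed.

Lemma off_poles_near_0 (L : C -> Prop) (r : R) (z : C) :
  discrete_group L r -> Cmod z <= r / 2 -> off_poles L z.
Proof.
intros HL Hz w [Hw Hw0] ->. assert (H := dg_gap HL z Hw Hw0). assert (Hr := dg_pos HL). lra.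
Qed.

Lemma eis_2_taylor (L : C -> Prop) (r : R) (G4 G6 : C) :
  discrete_group L r -> cube_summable L ->
  has_sum (nonzero_in L) (fun w => (/ w) ^ 4)%C G4 ->
  has_sum (nonzero_in L) (fun w => (/ w) ^ 6)%C G6 ->
  exists K, 0 <= K /\ forall z, Cmod z <= r / 2 ->
    Cmod (eis L 2 z - 3 * G4 * z ^ 2 - 5 * G6 * z ^ 4)%C <= K * Cmod z ^ 5.
Proof.
intros HL HB H4 H6. destruct (pow_summable L r 4 HL HB) as [B [HB0 HB7]]. cbn [Nat.add] in HB7.
(* 36 = 9 * 2^2: the modulus of 6 - 5 z/w is at most 9 for |z/w| <= 1/2, and |1/(z - w)| <= 2 |1/w|
   enters squared. *)
exists (36 * B). split; [lra|]. intros z Hz.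
replace (eis L 2 z - 3 * G4 * z ^ 2 - 5 * G6 * z ^ 4)%C with
  (eis L 2 z - (3 * z ^ 2 * G4 + 5 * z ^ 4 * G6))%C by ring.
replace (36 * B * Cmod z ^ 5) with ((36 * Cmod z ^ 5) * B) by ring.
assert (Hz5 : 0 <= Cmod z ^ 5) by (apply pow_le, Cmod_ge_0).
apply (eis_expansion_bound L r 0 z (2 * z) (3 * z ^ 2) (4 * z ^ 3) (5 * z ^ 4)); try assumption;
  [now apply (off_poles_near_0 L r)|lra|].
intros w [Hw Hw0]. cbn [Nat.add]. assert (Hg := dg_gap HL w Hw Hw0).
destruct (inv_sub_near_0 z w Hw0 ltac:(lra)) as [N1 [N2 N3]].
replace (eis_term 2 z w - (2 * z * (/ w) ^ 3 + 3 * z ^ 2 * (/ w) ^ 4 + 4 * z ^ 3 * (/ w) ^ 5 + 5 * z ^ 4 * (/ w) ^ 6))%C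
  with (z ^ 5 * (/ w) ^ 5 * (6 + - (5) * (z * / w)) * (/ (z - w)) ^ 2)%C
  by (unfold eis_term; cbn [Nat.eqb]; field; split; assumption).
rewrite !(Cmod_mult _ (_ ^ 2)), !(Cmod_mult _ (6 + _)), !(Cmod_mult (_ ^ 5)), !Cmod_pow.
assert (Hs : Cmod (6 + - (5) * (z * / w)) <= 9).
{ eapply Rle_trans; [apply Cmod_triangle|]. rewrite Cmod_mult, Cmod_opp, !Cmod_R.
  rewrite !Rabs_right by lra. lra. }
set (x := Cmod (/ w)) in *. assert (Hx : 0 <= x) by apply Cmod_ge_0.
replace (36 * Cmod z ^ 5 * x ^ 7) with (Cmod z ^ 5 * x ^ 5 * 9 * (2 * x) ^ 2) by ring.
assert (Hzx : 0 <= Cmod z ^ 5 * x ^ 5) by (apply Rmult_le_pos; [exact Hz5|apply pow_le; exact Hx]).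
apply Rmult_le_compat; [|apply pow_le, Cmod_ge_0| |].
- apply Rmult_le_pos; [exact Hzx|apply Cmod_ge_0].
- apply Rmult_le_compat_l; assumption.
- apply pow_incr. split; [apply Cmod_ge_0|exact N2].
Qed.

Lemma eis_3_taylor (L : C -> Prop) (r : R) (G4 G6 : C) :
  discrete_group L r -> cube_summable L ->
  has_sum (nonzero_in L) (fun w => (/ w) ^ 4)%C G4 ->
  has_sum (nonzero_in L) (fun w => (/ w) ^ 6)%C G6 ->
  exists K, 0 <= K /\ forall z, Cmod z <= r / 2 ->
    Cmod (eis L 3 z + 3 * G4 * z + 10 * G6 * z ^ 3)%C <= K * Cmod z ^ 4.
Proof.
intros HL HB H4 H6. destruct (pow_summable L r 4 HL HB) as [B [HB0 HB7]]. cbn [Nat.add] in HB7.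
(* 240 = 30 * 2^3: the polynomial factor of the remainder is at most 30, and |1/(z - w)| <= 2 |1/w|
   enters cubed. *)
exists (240 * B). split; [lra|]. intros z Hz.
replace (eis L 3 z + 3 * G4 * z + 10 * G6 * z ^ 3)%C with
  (eis L 3 z - (- (3) * z * G4 + - (10) * z ^ 3 * G6))%C by ring.
replace (240 * B * Cmod z ^ 4) with ((240 * Cmod z ^ 4) * B) by ring.
assert (Hz4 : 0 <= Cmod z ^ 4) by (apply pow_le, Cmod_ge_0).
apply (eis_expansion_bound L r 1 z (- (1)) (- (3) * z) (- (6) * z ^ 2) (- (10) * z ^ 3)); try assumption;
  [now apply (off_poles_near_0 L r)|lra|].
intros w [Hw Hw0]. cbn [Nat.add]. assert (Hg := dg_gap HL w Hw Hw0).
destruct (inv_sub_near_0 z w Hw0 ltac:(lra)) as [N1 [N2 N3]].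
replace (eis_term 3 z w - (- (1) * (/ w) ^ 3 + - (3) * z * (/ w) ^ 4 + - (6) * z ^ 2 * (/ w) ^ 5 + - (10) * z ^ 3 * (/ w) ^ 6))%C
  with (z ^ 4 * (/ w) ^ 4 * (15 + (- (24) * (z * / w) + 10 * (z * / w) ^ 2)) * (/ (z - w)) ^ 3)%C
  by (unfold eis_term; cbn [Nat.eqb]; field; split; assumption).
rewrite !(Cmod_mult _ (_ ^ 3)), !(Cmod_mult _ (15 + _)), !(Cmod_mult (_ ^ 4)), !Cmod_pow.
assert (Hs : Cmod (15 + (- (24) * (z * / w) + 10 * (z * / w) ^ 2)) <= 30).
{ eapply Rle_trans; [apply Cmod_triangle|].
  eapply Rle_trans; [apply Rplus_le_compat_l, Cmod_triangle|].
  rewrite (Cmod_mult (- _)), (Cmod_mult 10), Cmod_opp, Cmod_pow, !Cmod_R.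
  rewrite !Rabs_right by lra. assert (H := Cmod_ge_0 (z * / w)). nra. }
set (x := Cmod (/ w)) in *. assert (Hx : 0 <= x) by apply Cmod_ge_0.
replace (240 * Cmod z ^ 4 * x ^ 7) with (Cmod z ^ 4 * x ^ 4 * 30 * (2 * x) ^ 3) by ring.
assert (Hzx : 0 <= Cmod z ^ 4 * x ^ 4) by (apply Rmult_le_pos; [exact Hz4|apply pow_le; exact Hx]).
apply Rmult_le_compat; [|apply pow_le, Cmod_ge_0| |].
- apply Rmult_le_pos; [exact Hzx|apply Cmod_ge_0].
- apply Rmult_le_compat_l; assumption.
- apply pow_incr. split; [apply Cmod_ge_0|exact N2].
Qed.

Lemma eis_4_0 (L : C -> Prop) (G4 : C) :
  has_sum (nonzero_in L) (fun w => (/ w) ^ 4)%C G4 -> eis L 4 0 = G4.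
Proof.
intros H4. apply lsum_unique. eapply has_sum_ext; [reflexivity| |exact H4].
intros w [_ Hw]. unfold eis_term; cbn [Nat.eqb]. replace (0 - w)%C with (- w)%C by ring. field. exact Hw.
Qed.

(** * The Weierstrass function, its derivatives and its symmetries *)

Definition wp (L : C -> Prop) (z : C) : C := ((/ z) ^ 2 + eis L 2 z)%C.
Definition wp1 (L : C -> Prop) (z : C) : C := (- (2) * ((/ z) ^ 3 + eis L 3 z))%C.
Definition wp2 (L : C -> Prop) (z : C) : C := (6 * ((/ z) ^ 4 + eis L 4 z))%C.
(** The maximum principle differentiates its function twice and is applied to an expression in p'',
    which calls for the third and fourth derivatives. *)
Definition wp3 (L : C -> Prop) (z : C) : C := (- (24) * ((/ z) ^ 5 + eis L 5 z))%C.
Definition wp4 (L : C -> Prop) (z : C) : C := (120 * ((/ z) ^ 6 + eis L 6 z))%C.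

Lemma qdiff_pole_eis (L : C -> Prop) (r : R) (n : nat) (z : C) :
  discrete_group L r -> cube_summable L -> ~ L z ->
  qdiff (fun x => (/ x) ^ (n + 2) + eis L (n + 2) x)%C z
    (- INR (n + 2) * ((/ z) ^ (n + 3) + eis L (n + 3) z))%C.
Proof.
intros HL HB Hz.
assert (Hz0 : z <> 0) by (intros ->; apply Hz, (dg_0 HL)).
eapply qdiff_eq; [|apply qdiff_plus; [apply qdiff_inv_pow; exact Hz0|
  apply (qdiff_eis L r n z HL HB (off_poles_notin L z Hz))]].
replace (n + 2 + 1)%nat with (n + 3)%nat by lia. ring.
Qed.

Lemma qdiff_wp (L : C -> Prop) (r : R) (z : C) :
  discrete_group L r -> cube_summable L -> ~ L z -> qdiff (wp L) z (wp1 L z).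
Proof.
intros HL HB Hz. eapply qdiff_eq; [|exact (qdiff_pole_eis L r 0 z HL HB Hz)].
unfold wp1. cbn [Nat.add]. replace (INR 2) with 2 by (cbn; ring). reflexivity.
Qed.

Lemma qdiff_wp1 (L : C -> Prop) (r : R) (z : C) :
  discrete_group L r -> cube_summable L -> ~ L z -> qdiff (wp1 L) z (wp2 L z).
Proof.
intros HL HB Hz. eapply qdiff_eq; [|apply qdiff_scal; exact (qdiff_pole_eis L r 1 z HL HB Hz)].
unfold wp2. cbn [Nat.add]. replace (INR 3) with 3 by (cbn; ring). ring.
Qed.

Lemma qdiff_wp2 (L : C -> Prop) (r : R) (z : C) :
  discrete_group L r -> cube_summable L -> ~ L z -> qdiff (wp2 L) z (wp3 L z).
Proof.
intros HL HB Hz. eapply qdiff_eq; [|apply qdiff_scal; exact (qdiff_pole_eis L r 2 z HL HB Hz)].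
unfold wp3. cbn [Nat.add]. replace (INR 4) with 4 by (cbn; ring). ring.
Qed.

Lemma qdiff_wp3 (L : C -> Prop) (r : R) (z : C) :
  discrete_group L r -> cube_summable L -> ~ L z -> qdiff (wp3 L) z (wp4 L z).
Proof.
intros HL HB Hz. eapply qdiff_eq; [|apply qdiff_scal; exact (qdiff_pole_eis L r 3 z HL HB Hz)].
unfold wp4. cbn [Nat.add]. replace (INR 5) with 5 by (cbn; ring). ring.
Qed.

(** The complement of [L] is open, so f(z + w) = f(z) holds on a disc and can be differentiated;
    derivatives are unique. *)
Lemma periodic_derivative (L : C -> Prop) (r : R) (f g : C -> C) (w : C) :
  discrete_group L r -> L w ->
  (forall z, ~ L z -> qdiff f z (g z)) ->
  (forall z, ~ L z -> f (z + w)%C = f z) ->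
  forall z, ~ L z -> g (z + w)%C = g z.
Proof.
intros HL Hw Hd Hf z Hz.
destruct (off_lattice_open L r z HL Hz) as [d [Hd0 Hopen]].
assert (Hzw : ~ L (z + w)%C).
{ intros H. apply Hz. replace z with (z + w - w)%C by ring. now apply (dg_minus HL). }
eapply qdiff_unique; [|apply Hd, Hz].
destruct (Hd _ Hzw) as [d' [K [Hd' [HK H]]]].
exists (Rmin d d'), K. split; [now apply Rmin_glb_lt|split; [exact HK|]]. intros k Hk.
assert (H1 := Rmin_l d d'). assert (H2 := Rmin_r d d').
specialize (H k ltac:(lra)).
rewrite (Hf z Hz) in H. replace (z + w + k)%C with (z + k + w)%C in H by ring.
rewrite Hf in H by (apply Hopen; lra). exact H.
Qed.

(** Reindexing by -w; the sign is written with [n] because the weight n + 2 has the same parity. *)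
Lemma eis_opp (L : C -> Prop) (r : R) (n : nat) (z : C) :
  discrete_group L r -> cube_summable L -> off_poles L z ->
  eis L (n + 2) (- z)%C = ((- (1)) ^ n * eis L (n + 2) z)%C.
Proof.
intros HL HB Hz. apply lsum_unique.
assert (H := eis_has_sum L r n z HL HB Hz).
assert (H' := has_sum_reindex _ Copp _ _ (fun w => nonzero_in_opp L r w HL) (fun w => ltac:(ring)) H).
eapply has_sum_ext; [reflexivity| |apply has_sum_scal; exact H'].
intros w Hw. cbn beta.
assert (Hzw : (z + w)%C <> 0).
{ intros E. apply (Hz (- w)%C); [now apply (nonzero_in_opp L r)|].
  replace z with (z + w - w)%C by ring. rewrite E. ring. }
assert (Hw0 := proj2 Hw).
assert (Hm : (- z - w)%C <> 0).
{ intros E. apply Hzw. replace (z + w)%C with (- (- z - w))%C by ring. rewrite E; ring. }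
unfold eis_term.
replace (/ (- z - w))%C with (- (1) * / (z - - w))%C.
2:{ field. split; [exact Hm|]. replace (z - - w)%C with (z + w)%C by ring. exact Hzw. }
rewrite Cpow_mult_l. destruct n as [|n].
- cbn [Nat.add Nat.eqb]. field. split; [exact Hw0|]. replace (z - - w)%C with (z + w)%C by ring. exact Hzw.
- replace (Nat.eqb (S n + 2) 2) with false by (symmetry; apply Nat.eqb_neq; lia).
  rewrite (Cpow_add_r (- (1))). cbn [Cpow]. ring.
Qed.

Lemma wp_opp (L : C -> Prop) (r : R) (z : C) :
  discrete_group L r -> cube_summable L -> ~ L z -> wp L (- z)%C = wp L z.
Proof.
intros HL HB Hz. unfold wp.
assert (H := eis_opp L r 0 z HL HB (off_poles_notin L z Hz)). cbn [Nat.add] in H. rewrite H.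
assert (Hz0 : z <> 0) by (intros ->; apply Hz, (dg_0 HL)).
cbn [Cpow]. field. exact Hz0.
Qed.

Lemma eis_conj (L : C -> Prop) (r : R) (n : nat) (z : C) :
  discrete_group L r -> cube_summable L -> (forall w, L w -> L (Cconj w)) -> off_poles L z ->
  eis L (n + 2) (Cconj z) = Cconj (eis L (n + 2) z).
Proof.
intros HL HB Hconj Hz. apply lsum_unique.
assert (Hnz : forall w, nonzero_in L w -> nonzero_in L (Cconj w)).
{ intros w [Hw H0]. split; [now apply Hconj|]. intros E. apply H0.
  rewrite <- (Cconj_conj w), E. apply injective_projections; cbn; ring. }
assert (H := has_sum_conj _ _ _ (eis_has_sum L r n z HL HB Hz)).
assert (H' := has_sum_reindex _ Cconj _ _ Hnz Cconj_conj H).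
eapply has_sum_ext; [reflexivity| |exact H'].
intros w Hw. cbn beta. unfold eis_term.
assert (Hne : (z - Cconj w)%C <> 0).
{ intros E. apply (Hz _ (Hnz w Hw)). replace z with (z - Cconj w + Cconj w)%C by ring. rewrite E; ring. }
rewrite Cminus_conj, Cpow_conj, Cinv_conj, Cminus_conj, Cconj_conj by exact Hne.
f_equal. f_equal. destruct (Nat.eqb (n + 2) 2).
- rewrite Cpow_conj, Cinv_conj, Cconj_conj; [reflexivity|]. apply (Hnz w Hw).
- apply injective_projections; cbn; ring.
Qed.

Lemma wp_conj (L : C -> Prop) (r : R) (z : C) :
  discrete_group L r -> cube_summable L -> (forall w, L w -> L (Cconj w)) -> ~ L z ->
  wp L (Cconj z) = Cconj (wp L z).
Proof.
intros HL HB Hconj Hz. unfold wp.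
assert (H := eis_conj L r 0 z HL HB Hconj (off_poles_notin L z Hz)). cbn [Nat.add] in H.
assert (Hz0 : z <> 0) by (intros ->; apply Hz, (dg_0 HL)).
rewrite Cplus_conj, Cpow_conj, Cinv_conj by exact Hz0. now rewrite H.
Qed.

(** * The maximum principle *)

Lemma continuity_2d_pt_comp2 (f g h : R -> R -> R) (x y : R) :
  continuity_2d_pt f (g x y) (h x y) -> continuity_2d_pt g x y -> continuity_2d_pt h x y ->
  continuity_2d_pt (fun u v => f (g u v) (h u v)) x y.
Proof.
intros Hf Hg Hh eps. destruct (Hf eps) as [d Hd].
destruct (Hg d) as [d1 H1]. destruct (Hh d) as [d2 H2].
assert (Hm : 0 < Rmin d1 d2) by (apply Rmin_glb_lt; apply cond_pos).
exists (mkposreal _ Hm). cbn. intros u v Hu Hv.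
assert (L1 := Rmin_l d1 d2). assert (L2 := Rmin_r d1 d2).
apply Hd; [apply H1|apply H2]; lra.
Qed.

Lemma RInt_nonneg_eq_0 (f : R -> R) (a b x : R) :
  (forall t, continuous f t) -> (forall t, 0 <= f t) -> RInt f a b = 0 -> a < x < b -> f x = 0.
Proof.
intros Hc Hp Hi Hx. apply Rle_antisym; [|apply Hp]. apply Rnot_lt_le. intros Hpos.
assert (Hloc : locally x (fun t => 0 < f t)).
{ assert (H := Hc x). apply (H (fun y => 0 < y)).
  exists (mkposreal _ Hpos). intros y Hy. cbv [ball] in Hy. simpl in Hy. unfold AbsRing_ball in Hy.
  simpl in Hy. unfold abs, minus, plus, opp in Hy; simpl in Hy.
  apply Rabs_lt_between in Hy. lra. }
destruct Hloc as [d Hd].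
pose (e := Rmin (d / 2) (Rmin ((x - a) / 2) ((b - x) / 2))).
assert (Hdp := cond_pos d).
assert (He : 0 < e) by (repeat apply Rmin_glb_lt; lra).
assert (E1 : e <= d / 2) by apply Rmin_l.
assert (E2 : e <= Rmin ((x - a) / 2) ((b - x) / 2)) by apply Rmin_r.
assert (E3 := Rmin_l ((x - a) / 2) ((b - x) / 2)). assert (E4 := Rmin_r ((x - a) / 2) ((b - x) / 2)).
assert (Hex : forall u v, ex_RInt f u v) by (intros u v; apply (ex_RInt_continuous (V := R_CompleteNormedModule)); auto).
rewrite <- (RInt_Chasles f a (x - e) b), <- (RInt_Chasles f (x - e) (x + e) b) in Hi by apply Hex.
assert (H1 : 0 <= RInt f a (x - e)) by (apply RInt_ge_0; [lra|apply Hex|auto]).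
assert (H2 : 0 <= RInt f (x + e) b) by (apply RInt_ge_0; [lra|apply Hex|auto]).
assert (H3 : 0 < RInt f (x - e) (x + e)).
{ apply RInt_gt_0; [lra| |auto]. intros t Ht. apply Hd.
  cbv [ball]; simpl; unfold AbsRing_ball; simpl; unfold abs, minus, plus, opp; simpl.
  apply Rabs_def1; lra. }
unfold plus in Hi; simpl in Hi. lra.
Qed.

(** The Cauchy-Riemann equations, as partial derivatives to which the real chain rule applies. *)
Lemma qdiff_differentiable_pt_lim (f : C -> C) (x y : R) (l : C) :
  qdiff f (x, y) l ->
  differentiable_pt_lim (fun u v => Re (f (u, v))) x y (Re l) (- Im l) /\
  differentiable_pt_lim (fun u v => Im (f (u, v))) x y (Im l) (Re l).
Proof.
intros [d [K [Hd [HK H]]]].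
assert (Hmain : forall eps : posreal, locally_2d (fun u v =>
  Cmod (f (u, v) - f (x, y) - l * (u - x, v - y)) <= eps * Rmax (Rabs (u - x)) (Rabs (v - y))) x y).
{ intros eps. assert (He := cond_pos eps).
  assert (Hm : 0 < Rmin (d / 2) (eps / (2 * K + 1))).
  { apply Rmin_glb_lt; [lra|]. apply Rdiv_lt_0_compat; lra. }
  exists (mkposreal _ Hm). cbn [pos]. intros u v Hu Hv.
  assert (L1 := Rmin_l (d / 2) (eps / (2 * K + 1))). assert (L2 := Rmin_r (d / 2) (eps / (2 * K + 1))).
  set (k := (u - x, v - y) : C). set (M := Rmax (Rabs (u - x)) (Rabs (v - y))).
  assert (HM : M < Rmin (d / 2) (eps / (2 * K + 1))) by (apply Rmax_lub_lt; assumption).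
  assert (HM0 : 0 <= M) by (eapply Rle_trans; [apply Rabs_pos|apply Rmax_l]).
  assert (Hs := sqrt_sqrt 2 ltac:(lra)). assert (Hs0 := sqrt_pos 2).
  assert (Hk : Cmod k <= sqrt 2 * M) by exact (Cmod_2Rmax k).
  assert (Hs2 : sqrt 2 <= 2) by nra.
  assert (Hk0 := Cmod_ge_0 k).
  specialize (H k ltac:(nra)).
  replace ((x, y) + k)%C with (u, v) in H by (apply injective_projections; cbn; ring).
  eapply Rle_trans; [exact H|].
  assert (HK2 : Cmod k ^ 2 <= 2 * M * M).
  { replace (2 * M * M) with ((sqrt 2 * M) ^ 2) by (replace (2 * M * M) with ((sqrt 2 * sqrt 2) * M * M) by (rewrite Hs; ring); ring).
    apply pow_incr. split; assumption. }
  assert (HMe : M * (2 * K + 1) <= eps).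
  { apply Rle_div_r; lra. }
  assert (K * Cmod k ^ 2 <= K * (2 * M * M)) by (apply Rmult_le_compat_l; assumption).
  nra. }
split; intros eps; destruct (Hmain eps) as [dd Hdd]; exists dd; intros u v Hu Hv;
  (eapply Rle_trans; [|exact (Hdd u v Hu Hv)]).
- eapply Rle_trans; [|apply re_le_Cmod]. right. f_equal. unfold Re, Im; cbn. ring.
- eapply Rle_trans; [|eapply Rle_trans; [|apply Rmax_Cmod]; apply Rmax_r]. right. f_equal. unfold Re, Im; cbn. ring.
Qed.

Lemma qdiff_continuity_2d (f : C -> C) (x y : R) (l : C) :
  qdiff f (x, y) l ->
  continuity_2d_pt (fun u v => Re (f (u, v))) x y /\ continuity_2d_pt (fun u v => Im (f (u, v))) x y.
Proof.
intros H. destruct (qdiff_differentiable_pt_lim _ _ _ _ H) as [H1 H2].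
split; apply differentiable_continuity_pt; eexists; eexists; eassumption.
Qed.

(* The circle means of [Re G] around [z0] do not depend on the radius, since
   their radial derivative is the integral of the angular derivative of [Im G]. *)
Lemma Re_max_disc (G G1 G2 : C -> C) (z0 : C) (d A : R) :
  (forall k, Cmod k < d -> qdiff G (z0 + k)%C (G1 (z0 + k)%C)) ->
  (forall k, Cmod k < d -> qdiff G1 (z0 + k)%C (G2 (z0 + k)%C)) ->
  (forall k, Cmod k < d -> Re (G (z0 + k)%C) <= A) -> Re (G z0) = A ->
  forall h, Cmod h < d -> Re (G (z0 + h)%C) = A.
Proof.
intros HG HG1 Hle H0 h Hh. destruct z0 as [x0 y0]. destruct h as [h1 h2].
assert (Hd : 0 < d) by (generalize (Cmod_ge_0 (h1, h2)); lra).
(* Coordinates of z0 + rho exp(i t) h; [DU] below is the radial derivative of [U]. *)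
pose (gx := fun rho t => x0 + rho * (h1 * cos t - h2 * sin t)).
pose (gy := fun rho t => y0 + rho * (h1 * sin t + h2 * cos t)).
pose (U := fun rho t => Re (G (gx rho t, gy rho t))).
pose (V := fun rho t => Im (G (gx rho t, gy rho t))).
pose (DU := fun rho t => Re (G1 (gx rho t, gy rho t)) * (h1 * cos t - h2 * sin t)
   + - Im (G1 (gx rho t, gy rho t)) * (h1 * sin t + h2 * cos t)).
set (H := Cmod (h1, h2)) in *. assert (HH : 0 <= H) by apply Cmod_ge_0.
assert (Hin : forall rho t, exists k : C, Cmod k = Rabs rho * H /\ ((x0, y0) + k)%C = (gx rho t, gy rho t)).
{ intros rho t. exists (RtoC rho * ((h1, h2) * (cos t, sin t)))%C. split.
  - rewrite !Cmod_mult, Cmod_R. replace (Cmod (cos t, sin t)) with 1; [unfold H; ring|].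
    unfold Cmod; cbn [fst snd]. rewrite <- sqrt_1. f_equal.
    generalize (sin2_cos2 t). unfold Rsqr. lra.
  - apply injective_projections; unfold gx, gy; cbn; ring. }
assert (HGg : forall rho t, Rabs rho * H < d -> qdiff G (gx rho t, gy rho t) (G1 (gx rho t, gy rho t))).
{ intros rho t Hr. destruct (Hin rho t) as [k [Hk <-]]. apply HG. lra. }
assert (HG1g : forall rho t, Rabs rho * H < d -> qdiff G1 (gx rho t, gy rho t) (G2 (gx rho t, gy rho t))).
{ intros rho t Hr. destruct (Hin rho t) as [k [Hk <-]]. apply HG1. lra. }
assert (dU : forall rho t, Rabs rho * H < d -> derivable_pt_lim (fun r => U r t) rho (DU rho t)).
{ intros rho t Hr. destruct (qdiff_differentiable_pt_lim _ _ _ _ (HGg rho t Hr)) as [D1 _].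
  apply (derivable_pt_lim_comp_2d (fun u v => Re (G (u, v))) (fun r => gx r t) (fun r => gy r t)); [exact D1| |];
  apply is_derive_Reals; unfold gx, gy; auto_derive; auto; ring. }
(* The Cauchy-Riemann equation in polar form. *)
assert (dV : forall rho t, Rabs rho * H < d -> derivable_pt_lim (fun s => V rho s) t (rho * DU rho t)).
{ intros rho t Hr. destruct (qdiff_differentiable_pt_lim _ _ _ _ (HGg rho t Hr)) as [_ D1].
  replace (rho * DU rho t) with
   (Im (G1 (gx rho t, gy rho t)) * (rho * (- h1 * sin t - h2 * cos t))
    + Re (G1 (gx rho t, gy rho t)) * (rho * (h1 * cos t - h2 * sin t))) by (unfold DU; ring).
  apply (derivable_pt_lim_comp_2d (fun u v => Im (G (u, v))) (fun s => gx rho s) (fun s => gy rho s)); [exact D1| |];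
  apply is_derive_Reals; unfold gx, gy; auto_derive; auto; ring. }
assert (ccos : forall r t, continuity_2d_pt (fun _ v => cos v) r t).
{ intros r t. apply (continuity_1d_2d_pt_comp cos (fun _ v => v)); [apply continuity_cos|apply continuity_2d_pt_id2]. }
assert (csin : forall r t, continuity_2d_pt (fun _ v => sin v) r t).
{ intros r t. apply (continuity_1d_2d_pt_comp sin (fun _ v => v)); [apply continuity_sin|apply continuity_2d_pt_id2]. }
assert (c1 : forall r t, continuity_2d_pt (fun _ v => h1 * cos v - h2 * sin v) r t).
{ intros r t. apply (continuity_2d_pt_minus (fun _ v => h1 * cos v) (fun _ v => h2 * sin v));
  apply (continuity_2d_pt_mult (fun _ _ => _)); auto using continuity_2d_pt_const. }
assert (c2 : forall r t, continuity_2d_pt (fun _ v => h1 * sin v + h2 * cos v) r t).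
{ intros r t. apply (continuity_2d_pt_plus (fun _ v => h1 * sin v) (fun _ v => h2 * cos v));
  apply (continuity_2d_pt_mult (fun _ _ => _)); auto using continuity_2d_pt_const. }
assert (cgx : forall r t, continuity_2d_pt gx r t).
{ intros r t. apply (continuity_2d_pt_plus (fun _ _ => x0)); [apply continuity_2d_pt_const|].
  apply (continuity_2d_pt_mult (fun r _ => r)); [apply continuity_2d_pt_id1|apply c1]. }
assert (cgy : forall r t, continuity_2d_pt gy r t).
{ intros r t. apply (continuity_2d_pt_plus (fun _ _ => y0)); [apply continuity_2d_pt_const|].
  apply (continuity_2d_pt_mult (fun r _ => r)); [apply continuity_2d_pt_id1|apply c2]. }
assert (cU : forall r t, Rabs r * H < d -> continuity_2d_pt U r t).
{ intros r t Hr. destruct (qdiff_continuity_2d _ _ _ _ (HGg r t Hr)) as [D1 _].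
  apply (continuity_2d_pt_comp2 (fun u v => Re (G (u, v))) gx gy); auto. }
assert (cDU : forall r t, Rabs r * H < d -> continuity_2d_pt DU r t).
{ intros r t Hr. destruct (qdiff_continuity_2d _ _ _ _ (HG1g r t Hr)) as [D1 D2].
  apply (continuity_2d_pt_plus (fun r t => Re (G1 (gx r t, gy r t)) * (h1 * cos t - h2 * sin t))
     (fun r t => - Im (G1 (gx r t, gy r t)) * (h1 * sin t + h2 * cos t))).
  - apply (continuity_2d_pt_mult (fun r t => Re (G1 (gx r t, gy r t)))); [|apply c1].
    apply (continuity_2d_pt_comp2 (fun u v => Re (G1 (u, v))) gx gy); auto.
  - apply (continuity_2d_pt_mult (fun r t => - Im (G1 (gx r t, gy r t)))); [|apply c2].
    apply continuity_2d_pt_opp.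
    apply (continuity_2d_pt_comp2 (fun u v => Im (G1 (u, v))) gx gy); auto. }
assert (slice : forall (f : R -> R -> R) r t, continuity_2d_pt f r t -> continuous (fun s => f r s) t).
{ intros f r t Hf. apply continuity_pt_filterlim. apply continuity_pt_locally. intros eps.
  destruct (Hf eps) as [e He]. exists e. intros y Hy. apply He; [|exact Hy].
  replace (r - r) with 0 by ring. rewrite Rabs_R0. apply cond_pos. }
assert (Hnear : forall r, Rabs r * H < d -> locally r (fun y => Rabs y * H < d)).
{ intros r Hr. assert (Hpos : 0 < (d - Rabs r * H) / (H + 1)) by (apply Rdiv_lt_0_compat; lra).
  exists (mkposreal _ Hpos). intros y Hy.
  cbv [ball] in Hy; simpl in Hy; unfold AbsRing_ball in Hy; simpl in Hy; unfold abs, minus, plus, opp in Hy; simpl in Hy.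
  apply Rlt_div_r in Hy; [|lra].
  assert (Ht : Rabs y <= Rabs r + Rabs (y + - r)).
  { replace y with (r + (y + - r)) at 1 by ring. apply Rabs_triang. }
  assert (Hp := Rabs_pos (y + - r)). nra. }
pose (m := fun r => RInt (U r) (- PI) PI).
assert (HPI := PI_RGT_0).
assert (dm : forall r, Rabs r * H < d -> is_derive m r (RInt (DU r) (- PI) PI)).
{ intros r Hr. unfold m.
  assert (HD : RInt (fun t => Derive (fun u => U u t) r) (- PI) PI = RInt (DU r) (- PI) PI).
  { apply RInt_ext. intros t _. apply is_derive_unique, is_derive_Reals, dU, Hr. }
  rewrite <- HD. apply is_derive_RInt_param.
  - apply filter_imp with (2 := Hnear r Hr). intros y Hy t _. exists (DU y t).
    apply is_derive_Reals, dU, Hy.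
  - intros t _. apply continuity_2d_pt_ext_loc with DU; [|now apply cDU].
    destruct (Hnear r Hr) as [e He]. exists e. intros u v Hu _. symmetry.
    apply is_derive_unique, is_derive_Reals, dU. apply He. exact Hu.
  - apply filter_imp with (2 := Hnear r Hr). intros y Hy.
    apply (ex_RInt_continuous (V := R_CompleteNormedModule)). intros t _. now apply (slice U), cU. }
assert (Hone : Rabs 1 * H < d) by (rewrite Rabs_R1; lra).
assert (Hunit : forall r, 0 <= r <= 1 -> Rabs r * H < d) by (intros r Hr; rewrite Rabs_right by lra; nra).
(* [V r] has period 2 PI in the angle, so its derivative [r * DU r] integrates to 0; then divide by
   [r]. *)
assert (Hzero : forall r, 0 < r <= 1 -> RInt (DU r) (- PI) PI = 0).
{ intros r Hr. assert (Hr' := Hunit r ltac:(lra)).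
  assert (HI : is_RInt (fun t => r * DU r t) (- PI) PI (minus (V r PI) (V r (- PI)))).
  { apply (is_RInt_derive (V := R_CompleteNormedModule) (V r)).
    - intros t _. apply is_derive_Reals, dV, Hr'.
    - intros t _. apply (slice (fun r t => r * DU r t)).
      apply (continuity_2d_pt_mult (fun r _ => r)); [apply continuity_2d_pt_id1|now apply cDU]. }
  replace (minus (V r PI) (V r (- PI))) with 0 in HI.
  2:{ unfold V, gx, gy. rewrite cos_neg, sin_neg, sin_PI, Ropp_0. unfold minus, plus, opp; simpl. ring. }
  assert (HI2 := is_RInt_scal (V := R_NormedModule) _ _ _ (/ r) _ HI).
  apply is_RInt_unique. eapply is_RInt_ext; [|replace 0 with (scal (/ r) 0); [exact HI2|]].
  - intros t _. unfold scal; simpl; unfold mult; simpl. field. lra.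
  - unfold scal; simpl; unfold mult; simpl. ring. }
assert (Hm : m 1 = m 0).
{ destruct (MVT_gen m 0 1 (fun r => RInt (DU r) (- PI) PI)) as [c [Hc E]].
  - rewrite Rmin_left, Rmax_right by lra. intros r Hr. apply dm, Hunit. lra.
  - rewrite Rmin_left, Rmax_right by lra. intros r Hr. apply continuity_pt_filterlim.
    apply (ex_derive_continuous (V := R_NormedModule)). eexists. apply dm, Hunit. lra.
  - rewrite Rmin_left, Rmax_right in Hc by lra.
    destruct (Req_dec c 0) as [->|Hc0].
    (* The mean value theorem may return the center, where division by the radius fails; there
       [DU 0] is a trigonometric polynomial with the periodic primitive [W]. *)
    + replace (RInt (DU 0) (- PI) PI) with 0 in E; [lra|].
      symmetry. unfold DU. apply is_RInt_unique.
      set (p := Re (G1 (x0, y0))). set (q := Im (G1 (x0, y0))).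
      pose (W := fun t => p * (h1 * sin t + h2 * cos t) - q * (- h1 * cos t + h2 * sin t)).
      assert (HI : is_RInt (fun t => p * (h1 * cos t - h2 * sin t) - q * (h1 * sin t + h2 * cos t))
        (- PI) PI (minus (W PI) (W (- PI)))).
      { apply (is_RInt_derive (V := R_CompleteNormedModule) W).
        - intros t _. unfold W. auto_derive; [auto|ring].
        - intros t _. apply (ex_derive_continuous (V := R_NormedModule)). auto_derive. auto. }
      replace (minus (W PI) (W (- PI))) with 0 in HI.
      * eapply is_RInt_ext; [|exact HI].
        intros t _. unfold gx, gy. rewrite !Rmult_0_l, !Rplus_0_r. fold p q. simpl. ring.
      * unfold W. rewrite cos_neg, sin_neg, sin_PI. unfold minus, plus, opp; simpl. ring.
    + rewrite Hzero in E by lra. lra. }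
assert (HU0 : m 0 = 2 * PI * A).
{ unfold m. rewrite (RInt_ext _ (fun _ => A)).
  - rewrite RInt_const. unfold scal; simpl; unfold mult; simpl. ring.
  - intros t _. unfold U, gx, gy. rewrite !Rmult_0_l, !Rplus_0_r. exact H0. }
assert (cU1 : forall t, continuous (fun t => A - U 1 t) t).
{ intros t. apply (continuous_minus (V := R_NormedModule) (fun _ => A)); [apply continuous_const|].
  now apply (slice U), cU. }
(* [A - U 1] is continuous, nonnegative and has zero integral, hence vanishes inside the interval;
   the angle 0 gives the point z0 + h. *)
assert (Hz : A - U 1 0 = 0).
{ apply (RInt_nonneg_eq_0 (fun t => A - U 1 t) (- PI) PI 0); [exact cU1| | |lra].
  - intros t. unfold U. destruct (Hin 1 t) as [k [Hk <-]].
    assert (Re (G ((x0, y0) + k)%C) <= A); [apply Hle; lra|lra].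
  - rewrite (RInt_minus (V := R_CompleteNormedModule) (fun _ => A) (U 1)).
    + fold (m 1). rewrite Hm, HU0, RInt_const. unfold minus, plus, opp, scal; simpl; unfold mult; simpl. ring.
    + apply ex_RInt_const.
    + apply (ex_RInt_continuous (V := R_CompleteNormedModule)). intros t _. now apply (slice U), cU. }
unfold U, gx, gy in Hz. rewrite cos_0, sin_0 in Hz.
replace ((x0, y0) + (h1, h2))%C with (x0 + 1 * (h1 * 1 - h2 * 0), y0 + 1 * (h1 * 0 + h2 * 1)).
- lra.
- apply injective_projections; cbn; ring.
Qed.

(** Upper semicontinuity suffices. Without a maximum, each point has a neighbourhood on which [Phi]
    stays below some value taken in the rectangle; the largest of the values belonging to a finite
    subcover would be below itself. *)
Lemma rectangle_max (Phi : R -> R -> R) (a b : R) :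
  0 <= a -> 0 <= b ->
  (forall x y, 0 <= x <= a -> 0 <= y <= b -> forall eps, 0 < eps -> exists d, 0 < d /\
     forall u v, Rabs (u - x) < d -> Rabs (v - y) < d -> Phi u v < Phi x y + eps) ->
  exists x0 y0, 0 <= x0 <= a /\ 0 <= y0 <= b /\
    forall x y, 0 <= x <= a -> 0 <= y <= b -> Phi x y <= Phi x0 y0.
Proof.
intros Ha Hb Husc. apply NNPP. intros Hno.
(* [R * (R * unit)] is the type [Tn 2 R] of [compactness_list], unfolded. *)
pose (inr := fun t : R * (R * unit) => 0 <= fst t <= a /\ 0 <= fst (snd t) <= b).
pose (P := fun t : R * (R * unit) => Phi (fst t) (fst (snd t))).
assert (Hbetter : forall t, exists q : posreal * (R * (R * unit)), inr t ->
  inr (snd q) /\ forall u : R * (R * unit), Rabs (fst u - fst t) < fst q ->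
    Rabs (fst (snd u) - fst (snd t)) < fst q -> P u < P (snd q)).
{ intros t. destruct (classic (inr t)) as [Ht|Ht]; [|exists (mkposreal 1 Rlt_0_1, t); contradiction].
  destruct (classic (exists t', inr t' /\ P t < P t')) as [[t' [Ht' Hlt]]|Hn].
  - destruct Ht as [Ht1 Ht2].
    destruct (Husc _ _ Ht1 Ht2 (P t' - P t) ltac:(lra)) as [d [Hd H]].
    exists (mkposreal d Hd, t'). intros _. split; [exact Ht'|]. cbn [fst snd pos].
    intros u Hu Hv. specialize (H _ _ Hu Hv). unfold P in *. lra.
  - exfalso. apply Hno. exists (fst t), (fst (snd t)).
    destruct Ht as [Ht1 Ht2]. split; [exact Ht1|split; [exact Ht2|]].
    intros x y Hx Hy. apply Rnot_lt_le. intros Hlt. apply Hn. exists (x, (y, tt)).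
    split; [split; assumption|exact Hlt]. }
pose (q := fun t => proj1_sig (constructive_indefinite_description _ (Hbetter t))).
assert (Hq : forall t, inr t -> inr (snd (q t)) /\ forall u : R * (R * unit), Rabs (fst u - fst t) < fst (q t) ->
    Rabs (fst (snd u) - fst (snd t)) < fst (q t) -> P u < P (snd (q t))).
{ intros t. exact (proj2_sig (constructive_indefinite_description _ (Hbetter t))). }
apply (compactness_list 2 (0, (0, tt)) (a, (b, tt)) (fun t => fst (q t))). intros [l Hl].
assert (Hmax : exists x, inr x /\ forall t, In t l -> inr t -> P (snd (q t)) <= P x).
{ clear Hl. induction l as [|t l [x [Hx IH]]].
  - exists (0, (0, tt)). split; [split; cbn; lra|easy].
  - destruct (classic (inr t /\ P x < P (snd (q t)))) as [[Ht Hlt]|Hn].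
    + exists (snd (q t)). split; [apply Hq, Ht|]. intros s [<-|Hs] Hs'; [lra|].
      specialize (IH s Hs Hs'). lra.
    + exists x. split; [exact Hx|]. intros s [<-|Hs] Hs'; [|now apply IH].
      apply Rnot_lt_le. intros Hlt. now apply Hn. }
destruct Hmax as [[x1 [x2 []]] [[Hx1 Hx2] Hmax]].
destruct (Hl (x1, (x2, tt))) as [[t1 [t2 []]] [Hin [Hbd [Hc1 [Hc2 _]]]]].
- cbn in *. tauto.
- assert (Ht : inr (t1, (t2, tt))) by (cbn in Hbd; split; cbn; tauto).
  specialize (Hmax _ Hin Ht). apply Hq in Ht. destruct Ht as [_ Ht].
  specialize (Ht (x1, (x2, tt)) Hc1 Hc2). exact (Rlt_irrefl _ (Rlt_le_trans _ _ _ Ht Hmax)).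
Qed.

Lemma reduce_mod (x a : R) : 0 < a -> exists m : Z, 0 <= x - IZR m * a <= a.
Proof.
intros Ha. exists (up (x / a) - 1)%Z. rewrite minus_IZR.
destruct (archimed (x / a)) as [H1 H2].
assert (H3 : x / a * a = x) by (field; lra). nra.
Qed.

Lemma dg_multiple (L : C -> Prop) (r : R) (w : C) (m : Z) :
  discrete_group L r -> L w -> L (IZR m * w)%C.
Proof.
intros HL Hw.
assert (Hn : forall n : nat, L (INR n * w)%C).
{ induction n as [|n IH].
  - cbn [INR]. replace (0 * w)%C with (RtoC 0) by ring. apply (dg_0 HL).
  - rewrite S_INR, RtoC_plus. replace ((INR n + 1) * w)%C with (INR n * w + w)%C by ring.
    eapply dg_plus; eassumption. }
destruct (Z_le_gt_dec 0 m).
- rewrite <- (Z2Nat.id m), <- INR_IZR_INZ by assumption. apply Hn.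
- replace (IZR m * w)%C with (- (IZR (- m) * w))%C by (rewrite opp_IZR, RtoC_opp; ring).
  eapply dg_opp; [exact HL|]. rewrite <- (Z2Nat.id (- m)), <- INR_IZR_INZ by lia. apply Hn.
Qed.

(** After multiplication by the conjugate of [F z] the real part attains its maximum |F z|^2 at [z],
    so it is constant on the disc, which forces |F| = |F z| there. *)
Lemma max_modulus_disc (F F1 F2 : C -> C) (z : C) (d : R) :
  (forall k, Cmod k < d -> qdiff F (z + k)%C (F1 (z + k)%C)) ->
  (forall k, Cmod k < d -> qdiff F1 (z + k)%C (F2 (z + k)%C)) ->
  (forall k, Cmod k < d -> Cmod (F (z + k)%C) <= Cmod (F z)) ->
  forall h, Cmod h < d -> Cmod (F (z + h)%C) = Cmod (F z).
Proof.
intros H1 H2 Hle h Hh.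
destruct (Req_dec (Cmod (F z)) 0) as [E0|E0].
{ specialize (Hle h Hh). generalize (Cmod_ge_0 (F (z + h)%C)). lra. }
assert (Hpos := Cmod_ge_0 (F z)).
pose (c := Cconj (F z)).
assert (Hc : forall x, Re (c * F x)%C <= Cmod (F z) * Cmod (F x)).
{ intros x. eapply Rle_trans; [apply Rle_abs|]. eapply Rle_trans; [apply re_le_Cmod|].
  rewrite Cmod_mult. unfold c. rewrite Cmod_conj. lra. }
assert (E : Re (c * F (z + h))%C = Cmod (F z) ^ 2).
{ apply (Re_max_disc (fun x => c * F x)%C (fun x => c * F1 x)%C (fun x => c * F2 x)%C z d); try assumption.
  - intros k Hk. apply qdiff_scal. now apply H1.
  - intros k Hk. apply qdiff_scal. now apply H2.
  - intros k Hk. eapply Rle_trans; [apply Hc|]. specialize (Hle k Hk). nra.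
  - rewrite Cmod2_alt. unfold c, Re, Im; cbn. ring. }
specialize (Hc (z + h)%C). specialize (Hle h Hh). rewrite E in Hc. nra.
Qed.

(** Extended by 0 at the poles, |F| is periodic and upper semicontinuous, so it has a maximum. A
    positive maximum would spread along the segment from a maximal point to the lattice point 0,
    where the value is 0. *)
Lemma liouville_torus (L : C -> Prop) (r a b : R) (F F1 F2 : C -> C) :
  discrete_group L r -> 0 < a -> 0 < b -> L (a, 0) -> L (0, b) ->
  (forall z, ~ L z -> qdiff F z (F1 z)) -> (forall z, ~ L z -> qdiff F1 z (F2 z)) ->
  (forall z w, ~ L z -> L w -> F (z + w)%C = F z) ->
  (forall eps, 0 < eps -> exists d, 0 < d /\ forall z, ~ L z -> Cmod z < d -> Cmod (F z) < eps) ->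
  forall z, ~ L z -> F z = 0.
Proof.
intros HL Ha Hb La Lb HF HF1 Hper H0.
pose (Phi := fun z => if excluded_middle_informative (L z) then 0 else Cmod (F z)).
assert (PL : forall z, L z -> Phi z = 0).
{ intros z Hz. unfold Phi. destruct (excluded_middle_informative (L z)); tauto. }
assert (PN : forall z, ~ L z -> Phi z = Cmod (F z)).
{ intros z Hz. unfold Phi. destruct (excluded_middle_informative (L z)); tauto. }
assert (Pper : forall z w, L w -> Phi (z + w)%C = Phi z).
{ intros z w Hw. destruct (classic (L z)) as [Hz|Hz].
  - rewrite !PL; [reflexivity|exact Hz|]. eapply dg_plus; eassumption.
  - rewrite !PN; [now rewrite Hper|exact Hz|]. intros H. apply Hz.
    replace z with (z + w - w)%C by ring. now apply (dg_minus HL). }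
assert (Pusc : forall z eps, 0 < eps -> exists d, 0 < d /\ forall k, Cmod k < d -> Phi (z + k)%C < Phi z + eps).
{ intros z eps Heps. destruct (classic (L z)) as [Hz|Hz].
  - destruct (H0 eps Heps) as [d [Hd H]]. exists d. split; [exact Hd|]. intros k Hk.
    replace (z + k)%C with (k + z)%C by ring. rewrite Pper, (PL z) by exact Hz.
    destruct (classic (L k)) as [Hk'|Hk']; [rewrite PL by exact Hk'; lra|].
    rewrite PN by exact Hk'. specialize (H k Hk' Hk). lra.
  - destruct (qdiff_Lipschitz _ _ _ (HF z Hz)) as [d [K [Hd [HK H]]]].
    exists (Rmin d (eps / (K + 1))). split; [apply Rmin_glb_lt; [exact Hd|apply Rdiv_lt_0_compat; lra]|].
    intros k Hk. assert (L1 := Rmin_l d (eps / (K + 1))). assert (L2 := Rmin_r d (eps / (K + 1))).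
    rewrite (PN z) by exact Hz. assert (HFz := Cmod_ge_0 (F z)).
    destruct (classic (L (z + k)%C)) as [Hk'|Hk']; [rewrite PL by exact Hk'; lra|].
    rewrite PN by exact Hk'. specialize (H k ltac:(lra)).
    assert (Hke : Cmod k * (K + 1) < eps) by (apply Rlt_div_r; lra).
    generalize (Cmod_triangle (F z) (F (z + k) - F z)%C).
    replace (F z + (F (z + k) - F z))%C with (F (z + k)%C) by ring.
    assert (Hk0 := Cmod_ge_0 k). nra. }
assert (Hmax : exists z0, forall z, Phi z <= Phi z0).
{ destruct (rectangle_max (fun x y => Phi (x, y)) a b) as [x0 [y0 [_ [_ Hm]]]]; [lra|lra| |].
  - intros x y _ _ eps Heps. destruct (Pusc (x, y) eps Heps) as [d [Hd H]].
    exists (d / 2). split; [lra|]. intros u v Hu Hv.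
    replace (u, v) with ((x, y) + ((u - x)%R, (v - y)%R))%C by (apply injective_projections; cbn; ring).
    apply H. eapply Rle_lt_trans; [apply Cmod_2Rmax|]. cbn [fst snd].
    assert (HM : Rmax (Rabs (u - x)) (Rabs (v - y)) < d / 2) by (apply Rmax_lub_lt; assumption).
    assert (Hs := sqrt_sqrt 2 ltac:(lra)). assert (Hs0 := sqrt_pos 2).
    assert (Hs2 : sqrt 2 <= 2) by nra.
    assert (HM0 : 0 <= Rmax (Rabs (u - x)) (Rabs (v - y))) by (eapply Rle_trans; [apply Rabs_pos|apply Rmax_l]).
    nra.
  - exists (x0, y0). intros [x y].
    destruct (reduce_mod x a Ha) as [m Hmx]. destruct (reduce_mod y b Hb) as [n Hny].
    specialize (Hm _ _ Hmx Hny). cbn beta in Hm.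
    rewrite <- (Pper (x - IZR m * a, y - IZR n * b) (IZR m * (a, 0) + IZR n * (0, b))%C) in Hm.
    + replace (((x - IZR m * a)%R, (y - IZR n * b)%R) + (IZR m * (a, 0) + IZR n * (0, b)))%C with (x, y) in Hm
        by (apply injective_projections; cbn; ring). exact Hm.
    + eapply dg_plus; [exact HL| |]; eapply dg_multiple; eassumption. }
destruct Hmax as [z0 Hmax]. set (M := Phi z0) in *.
assert (HM0 : 0 <= M) by (rewrite <- (PL 0); [apply Hmax|apply (dg_0 HL)]).
assert (HM : M = 0).
{ apply Rle_antisym; [|exact HM0]. apply Rnot_lt_le. intros HMpos.
  assert (Hdisc : forall z, Phi z = M -> exists d, 0 < d /\ forall k, Cmod k < d -> Phi (z + k)%C = M).
  { intros z Hz. assert (Hzn : ~ L z) by (intros H; rewrite (PL _ H) in Hz; lra).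
    destruct (off_lattice_open L r z HL Hzn) as [d [Hd Hopen]]. exists d. split; [exact Hd|].
    intros k Hk. rewrite PN by now apply Hopen. rewrite <- Hz, PN by exact Hzn.
    apply (max_modulus_disc F F1 F2 z d); auto.
    intros h Hh. rewrite <- !PN by (try exact Hzn; now apply Hopen). rewrite Hz. apply Hmax. }
  pose (g := fun s : R => Phi (z0 * (1 - s))%C).
  pose (Eset := fun s => 0 <= s <= 1 /\ forall t, 0 <= t <= s -> g t = M).
  assert (E0 : Eset 0).
  { split; [lra|]. intros t Ht. replace t with 0 by lra. unfold g, M. f_equal. ring. }
  destruct (completeness Eset) as [s [Hs1 Hs2]].
  - exists 1. intros t [Ht _]. lra.
  - now exists 0.
  - assert (Hs01 : 0 <= s <= 1).
    { split; [apply Hs1, E0|]. apply Hs2. intros t [Ht _]. lra. }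
    assert (Hbelow : forall t, 0 <= t < s -> g t = M).
    { intros t Ht. apply NNPP. intros Hne. assert (s <= t); [|lra]. apply Hs2. intros u [Hu1 Hu2].
      apply Rnot_lt_le. intros Hlt. apply Hne, Hu2. lra. }
    assert (Hz0 := Cmod_ge_0 z0).
    (* By upper semicontinuity a value below [M] at [s] would persist just before [s]. *)
    assert (Hgs : g s = M).
    { destruct (Req_dec s 0) as [->|Hs0]; [apply E0; lra|].
      apply Rle_antisym; [apply Hmax|]. apply Rnot_lt_le. intros Hlt.
      destruct (Pusc (z0 * (1 - s))%C (M - g s) ltac:(lra)) as [d [Hd H]].
      pose (e := Rmin (s / 2) (d / (2 * (Cmod z0 + 1)))).
      assert (He : 0 < e) by (apply Rmin_glb_lt; [lra|apply Rdiv_lt_0_compat; lra]).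
      assert (He1 : e <= s / 2) by apply Rmin_l.
      assert (He2 : e <= d / (2 * (Cmod z0 + 1))) by apply Rmin_r.
      apply Rle_div_r in He2; [|lra].
      specialize (H (z0 * e)%C). rewrite Cmod_mult, Cmod_R, Rabs_right in H by lra.
      specialize (H ltac:(nra)). fold (g s) in H.
      replace (z0 * (1 - s) + z0 * e)%C with (z0 * (1 - (s - e)%R))%C in H by (rewrite RtoC_minus; ring).
      fold (g (s - e)) in H. rewrite Hbelow in H by lra. lra. }
    destruct (Req_dec s 1) as [->|Hs_1].
    + unfold g in Hgs. replace (z0 * (1 - 1))%C with (RtoC 0) in Hgs by ring.
      rewrite PL in Hgs by apply (dg_0 HL). lra.
    + destruct (Hdisc _ Hgs) as [d [Hd H]].
      pose (e := Rmin (1 - s) (d / (2 * (Cmod z0 + 1)))).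
      assert (He : 0 < e) by (apply Rmin_glb_lt; [lra|apply Rdiv_lt_0_compat; lra]).
      assert (He1 : e <= 1 - s) by apply Rmin_l.
      assert (He2 : e <= d / (2 * (Cmod z0 + 1))) by apply Rmin_r.
      apply Rle_div_r in He2; [|lra].
      assert (HE : Eset (s + e)).
      { split; [lra|]. intros t Ht. destruct (Rlt_le_dec t s) as [Hts|Hts]; [apply Hbelow; lra|].
        specialize (H (z0 * (s - t)%R)%C). rewrite Cmod_mult, Cmod_R, Rabs_left1 in H by lra.
        specialize (H ltac:(nra)). rewrite <- H. unfold g. f_equal. rewrite RtoC_minus. ring. }
      apply Hs1 in HE. lra. }
intros z Hz. apply Cmod_eq_0. rewrite <- PN by exact Hz.
apply Rle_antisym; [rewrite <- HM; apply Hmax|]. rewrite PN by exact Hz. apply Cmod_ge_0.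
Qed.

(** Near 0, p^2 = 1/z^4 + 6 G4 + o(1) and p'' = 6/z^4 + 6 G4 + o(1): the poles cancel and the
    constants 6 - 36 + 30 add up to 0. *)
Lemma wp2_defect_near_0 (L : C -> Prop) (r : R) (G4 G6 : C) :
  discrete_group L r -> cube_summable L ->
  has_sum (nonzero_in L) (fun w => (/ w) ^ 4)%C G4 ->
  has_sum (nonzero_in L) (fun w => (/ w) ^ 6)%C G6 ->
  exists d K, 0 < d /\ 0 <= K /\ forall z : C, z <> 0 -> Cmod z < d ->
    Cmod (wp2 L z - 6 * (wp L z * wp L z) + 30 * G4)%C <= K * Cmod z.
Proof.
intros HL HB H4 H6. assert (Hr := dg_pos HL).
destruct (eis_2_taylor L r G4 G6 HL HB H4 H6) as [K2 [HK2 T2]].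
assert (Hq := qdiff_eis L r 2 0 HL HB (off_poles_0 L)). cbn [Nat.add] in Hq.
apply qdiff_Lipschitz in Hq. destruct Hq as [d4 [K4 [Hd4 [HK4 T4]]]].
rewrite (eis_4_0 L G4 H4) in T4.
assert (P4 := Cmod_ge_0 G4). assert (P6 := Cmod_ge_0 G6).
(* For |z| <= 1, [Q] |z|^3 bounds [eis L 2 z] minus its quadratic term. *)
pose (Q := 5 * Cmod G6 + K2).
exists (Rmin (Rmin d4 1) (r / 2)), (6 * K4 + 12 * Q + 6 * (3 * Cmod G4 + Q) ^ 2).
split; [repeat apply Rmin_glb_lt; lra|]. split; [unfold Q; nra|].
intros z Hz Hd.
assert (L1 := Rmin_l (Rmin d4 1) (r / 2)). assert (L2 := Rmin_r (Rmin d4 1) (r / 2)).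
assert (L3 := Rmin_l d4 1). assert (L4 := Rmin_r d4 1).
specialize (T4 z ltac:(lra)). rewrite Cplus_0_l in T4.
specialize (T2 z ltac:(lra)).
set (x := Cmod z) in *. assert (Hx : 0 < x) by (apply Cmod_gt_0; exact Hz).
set (e := (eis L 2 z - 3 * G4 * z ^ 2)%C).
assert (He : Cmod e <= Q * x ^ 3).
{ replace e with ((eis L 2 z - 3 * G4 * z ^ 2 - 5 * G6 * z ^ 4) + 5 * G6 * z ^ 4)%C by (unfold e; ring).
  eapply Rle_trans; [apply Cmod_triangle|].
  rewrite !Cmod_mult, Cmod_pow, Cmod_R, Rabs_right by lra. fold x. unfold Q.
  assert (x ^ 4 <= x ^ 3) by (replace (x ^ 4) with (x * x ^ 3) by ring; assert (0 < x ^ 3) by (apply pow_lt; lra); nra).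
  assert (x ^ 5 <= x ^ 3) by (replace (x ^ 5) with (x * x * x ^ 3) by ring; assert (0 < x ^ 3) by (apply pow_lt; lra); nra).
  nra. }
assert (HQ : 0 <= Q) by (unfold Q; lra).
replace (wp2 L z - 6 * (wp L z * wp L z) + 30 * G4)%C with
  (6 * (eis L 4 z - G4) + (- (12) * (e * (/ z) ^ 2) + - (6) * (eis L 2 z) ^ 2))%C.
2:{ unfold wp2, wp, e. field. exact Hz. }
eapply Rle_trans; [apply Cmod_triangle|].
eapply Rle_trans; [apply Rplus_le_compat_l, Cmod_triangle|].
rewrite !Cmod_mult, !Cmod_opp, !Cmod_pow, Cmod_inv, !Cmod_R, !Rabs_right by (try exact Hz; lra). fold x.
assert (Hx3 : 0 < x ^ 3) by (apply pow_lt; lra).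
assert (A1 : Cmod e * (/ x) ^ 2 <= Q * x).
{ replace (Q * x) with (Q * x ^ 3 * (/ x) ^ 2) by (field; lra).
  apply Rmult_le_compat_r; [apply pow_le; left; now apply Rinv_0_lt_compat|exact He]. }
assert (A2 : Cmod (eis L 2 z) <= (3 * Cmod G4 + Q) * x).
{ replace (eis L 2 z) with (e + 3 * G4 * z ^ 2)%C by (unfold e; ring).
  eapply Rle_trans; [apply Cmod_triangle|].
  rewrite !Cmod_mult, Cmod_pow, Cmod_R, Rabs_right by lra. fold x.
  assert (x ^ 3 <= x) by (replace (x ^ 3) with (x * (x * x)) by ring; nra).
  assert (x ^ 2 <= x) by (replace (x ^ 2) with (x * x) by ring; nra). nra. }
assert (A3 : Cmod (eis L 2 z) ^ 2 <= (3 * Cmod G4 + Q) ^ 2 * x).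
{ apply Rle_trans with (((3 * Cmod G4 + Q) * x) ^ 2).
  - apply pow_incr. split; [apply Cmod_ge_0|exact A2].
  - rewrite Rpow_mult_distr. apply Rmult_le_compat_l; [apply pow2_ge_0|]. nra. }
lra.
Qed.

Lemma wp_second_order (L : C -> Prop) (r a b : R) (G4 G6 : C) :
  discrete_group L r -> cube_summable L -> 0 < a -> 0 < b -> L (a, 0) -> L (0, b) ->
  has_sum (nonzero_in L) (fun w => (/ w) ^ 4)%C G4 ->
  has_sum (nonzero_in L) (fun w => (/ w) ^ 6)%C G6 ->
  (forall z w, ~ L z -> L w -> wp L (z + w)%C = wp L z) ->
  forall z, ~ L z -> (wp2 L z = 6 * (wp L z * wp L z) - 30 * G4)%C.
Proof.
intros HL HB Ha Hb La Lb H4 H6 Hper z Hz.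
assert (Hper1 : forall z w, ~ L z -> L w -> wp1 L (z + w)%C = wp1 L z).
{ intros x w Hx Hw. apply (periodic_derivative L r (wp L) (wp1 L) w HL Hw); auto.
  intros y Hy. eapply qdiff_wp; eassumption. }
assert (Hper2 : forall z w, ~ L z -> L w -> wp2 L (z + w)%C = wp2 L z).
{ intros x w Hx Hw. apply (periodic_derivative L r (wp1 L) (wp2 L) w HL Hw); auto.
  intros y Hy. eapply qdiff_wp1; eassumption. }
assert (E : (wp2 L z + (- (6) * (wp L z * wp L z) + 30 * G4) = 0)%C).
{ apply (liouville_torus L r a b (fun z => wp2 L z + (- (6) * (wp L z * wp L z) + 30 * G4))%C
    (fun z => wp3 L z + (- (6) * (wp1 L z * wp L z + wp L z * wp1 L z) + 0))%C
    (fun z => wp4 L z + (- (6) * ((wp2 L z * wp L z + wp1 L z * wp1 L z) + (wp1 L z * wp1 L z + wp L z * wp2 L z)) + 0))%C);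
    try assumption.
  - intros x Hx. apply qdiff_plus; [eapply qdiff_wp2; eassumption|].
    apply qdiff_plus; [|apply qdiff_const]. apply qdiff_scal.
    apply qdiff_mult; eapply qdiff_wp; eassumption.
  - intros x Hx. apply qdiff_plus; [eapply qdiff_wp3; eassumption|].
    apply qdiff_plus; [|apply qdiff_const]. apply qdiff_scal.
    apply qdiff_plus; apply qdiff_mult; first [eapply qdiff_wp; eassumption|eapply qdiff_wp1; eassumption].
  - intros x w Hx Hw. now rewrite Hper, Hper2.
  - intros eps Heps.
    destruct (wp2_defect_near_0 L r G4 G6 HL HB H4 H6) as [d [K [Hd [HK H]]]].
    exists (Rmin d (eps / (K + 1))). split; [apply Rmin_glb_lt; [exact Hd|apply Rdiv_lt_0_compat; lra]|].
    intros x Hx Hk. assert (L1 := Rmin_l d (eps / (K + 1))). assert (L2 := Rmin_r d (eps / (K + 1))).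
    assert (Hx0 : x <> 0) by (intros ->; apply Hx, (dg_0 HL)).
    specialize (H x Hx0 ltac:(lra)).
    replace (wp2 L x + (- (6) * (wp L x * wp L x) + 30 * G4))%C
      with (wp2 L x - 6 * (wp L x * wp L x) + 30 * G4)%C by ring.
    eapply Rle_lt_trans; [exact H|].
    assert (Hke : Cmod x * (K + 1) < eps) by (apply Rlt_div_r; lra).
    assert (0 < Cmod x) by (apply Cmod_gt_0; exact Hx0). nra. }
replace (wp2 L z) with ((wp2 L z + (- (6) * (wp L z * wp L z) + 30 * G4)) + 6 * (wp L z * wp L z) - 30 * G4)%C by ring.
rewrite E. ring.
Qed.

(** * Rectangular lattices *)

(** [a] and [b] are 2 omega and 2 |omega'|. The record holds the facts on p from which both period
    computations start. *)
Record rect_wp (a b g2 g3 : R) (L : C -> Prop) : Prop := {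
  rw_a : 0 < a;
  rw_b : 0 < b;
  rw_mem : forall x y, L (x, y) <-> exists m n : Z, x = IZR m * a /\ y = IZR n * b;
  rw_dg : discrete_group L (Rmin a b);
  rw_cube : cube_summable L;
  rw_per : forall z w, ~ L z -> L w -> wp L (z + w)%C = wp L z;
  rw_G4 : has_sum (nonzero_in L) (fun w => (/ w) ^ 4)%C (RtoC (g2 / 60));
  rw_G6 : has_sum (nonzero_in L) (fun w => (/ w) ^ 6)%C (RtoC (g3 / 140))
}.

Arguments rw_a {a b g2 g3 L}. Arguments rw_b {a b g2 g3 L}. Arguments rw_mem {a b g2 g3 L}.
Arguments rw_dg {a b g2 g3 L}. Arguments rw_cube {a b g2 g3 L}. Arguments rw_per {a b g2 g3 L}.
Arguments rw_G4 {a b g2 g3 L}. Arguments rw_G6 {a b g2 g3 L}.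

Lemma discrete_group_rectangular (a b : R) (L : C -> Prop) : 0 < a -> 0 < b ->
  (forall x y, L (x, y) <-> exists m n : Z, x = IZR m * a /\ y = IZR n * b) ->
  discrete_group L (Rmin a b).
Proof.
intros Ha Hb HL. constructor.
- now apply Rmin_glb_lt.
- apply HL. exists 0%Z, 0%Z. split; ring.
- intros [x y] [x' y'] H H'. apply HL in H. apply HL in H'.
  destruct H as [m [n [-> ->]]]. destruct H' as [m' [n' [-> ->]]].
  change (L (IZR m * a + - (IZR m' * a), IZR n * b + - (IZR n' * b))). apply HL.
  exists (m - m')%Z, (n - n')%Z. rewrite !minus_IZR. split; ring.
- intros [x y] H H0. apply HL in H. destruct H as [m [n [-> ->]]].
  eapply Rle_trans; [|apply Rmax_Cmod]. cbn [fst snd].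
  assert (Habs : forall k : Z, k <> 0%Z -> 1 <= Rabs (IZR k)).
  { intros k Hk. rewrite <- abs_IZR. apply IZR_le. lia. }
  destruct (Z.eq_dec m 0) as [->|Hm].
  + destruct (Z.eq_dec n 0) as [->|Hn].
    * exfalso. apply H0. unfold RtoC. f_equal; ring.
    * eapply Rle_trans; [|apply Rmax_r]. eapply Rle_trans; [apply Rmin_r|].
      rewrite Rabs_mult, (Rabs_right b) by lra. specialize (Habs n Hn). nra.
  + eapply Rle_trans; [|apply Rmax_l]. eapply Rle_trans; [apply Rmin_l|].
    rewrite Rabs_mult, (Rabs_right a) by lra. specialize (Habs m Hm). nra.
Qed.

(** At the point r/4 the terms of the given series have modulus at least a constant times |w|^(-3),
    and an unordered sum converges absolutely. *)
Lemma cube_summable_of_wp (L : C -> Prop) (r : R) (p : C -> option C) :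
  discrete_group L r -> is_wp_of_lattice L p -> cube_summable L.
Proof.
intros HL Hp. assert (Hr := dg_pos HL).
pose (z := RtoC (r / 4)).
assert (Hz : Cmod z = r / 4) by (unfold z; rewrite Cmod_R; apply Rabs_right; lra).
assert (Hzn : ~ L z).
{ intros H. assert (H0 : z <> 0) by (apply Cmod_gt_0; lra).
  assert (Hg := dg_gap HL z H H0). lra. }
destruct (proj2 (Hp z) Hzn) as [s [Hs _]].
destruct (has_sum_abs_summable _ _ _ Hs) as [B HB].
exists (4 / Cmod z * B).
eapply abs_summable_le; [|  |exact HB].
- apply Rlt_le, Rdiv_lt_0_compat; lra.
- intros w [Hw Hw0]. cbn beta. assert (Hg := dg_gap HL w Hw Hw0).
  destruct (inv_sub_near_0 z w Hw0 ltac:(lra)) as [N1 _].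
  replace (1 / (z - w) ^ 2 - 1 / w ^ 2)%C with (z * (2 * w - z) * ((/ (z - w)) ^ 2 * (/ w) ^ 2))%C
    by (field; split; assumption).
  rewrite !Cmod_mult, !Cmod_pow, !Cmod_inv by assumption.
  assert (Hw' := proj1 (Cmod_gt_0 w) Hw0). assert (Hzw := proj1 (Cmod_gt_0 _) N1).
  assert (H1 : Cmod w <= Cmod (2 * w - z)).
  { generalize (Cmod_sub_ge (2 * w) z). rewrite Cmod_mult, Cmod_R, Rabs_right by lra. lra. }
  assert (H2 : Cmod (z - w) <= 2 * Cmod w).
  { unfold Cminus. eapply Rle_trans; [apply Cmod_triangle|]. rewrite Cmod_opp. lra. }
  assert (H3 : / (2 * Cmod w) <= / Cmod (z - w)) by (apply Rinv_le_contravar; lra).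
  assert (H4 : 0 < / (2 * Cmod w)) by (apply Rinv_0_lt_compat; lra).
  assert (H5 : (/ (2 * Cmod w)) ^ 2 <= (/ Cmod (z - w)) ^ 2) by (apply pow_incr; lra).
  set (Z := Cmod z) in *. set (x := Cmod w) in *. set (y := (/ Cmod (z - w)) ^ 2) in *.
  set (q := Cmod (2 * w - z)) in *.
  replace (4 / Z * (Z * q * (y * (/ x) ^ 2))) with (4 * (q * (y * (/ x) ^ 2))) by (field; lra).
  replace ((/ x) ^ 3) with (4 * (x * ((/ (2 * x)) ^ 2 * (/ x) ^ 2))) by (field; lra).
  apply Rmult_le_compat_l; [lra|].
  assert (H6 : 0 <= (/ x) ^ 2) by (apply pow2_ge_0).
  apply Rmult_le_compat; [lra| |exact H1|].
  + apply Rmult_le_pos; [apply pow2_ge_0|exact H6].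
  + apply Rmult_le_compat_r; assumption.
Qed.

Lemma line_derive (f : C -> C) (x0 y0 u1 u2 t : R) (l : C) :
  qdiff f (x0 + t * u1, y0 + t * u2) l ->
  is_derive (fun s => Re (f (x0 + s * u1, y0 + s * u2))) t (Re l * u1 - Im l * u2) /\
  is_derive (fun s => Im (f (x0 + s * u1, y0 + s * u2))) t (Im l * u1 + Re l * u2).
Proof.
intros H. destruct (qdiff_differentiable_pt_lim _ _ _ _ H) as [D1 D2].
split; apply is_derive_Reals.
- replace (Re l * u1 - Im l * u2) with (Re l * u1 + - Im l * u2) by ring.
  apply (derivable_pt_lim_comp_2d (fun u v => Re (f (u, v))) (fun s => x0 + s * u1) (fun s => y0 + s * u2)); [exact D1| |];
  apply is_derive_Reals; auto_derive; auto; ring.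
- apply (derivable_pt_lim_comp_2d (fun u v => Im (f (u, v))) (fun s => x0 + s * u1) (fun s => y0 + s * u2)); [exact D2| |];
  apply is_derive_Reals; auto_derive; auto; ring.
Qed.

Lemma horizontal_derive (f : C -> C) (x y : R) (l : C) :
  qdiff f (x, y) l ->
  is_derive (fun s => Re (f (s, y))) x (Re l) /\ is_derive (fun s => Im (f (s, y))) x (Im l).
Proof.
intros H. destruct (line_derive f 0 y 1 0 x l) as [D1 D2].
{ replace (0 + x * 1, y + x * 0) with (x, y) by (f_equal; ring). exact H. }
assert (E1 : forall s : R, (0 + s * 1, y + s * 0) = (s, y)) by (intros s; f_equal; ring).
split.
- eapply is_derive_ext; [|assert (E : (Re l * 1 - Im l * 0) = (Re l)) by ring; rewrite E in D1; exact D1].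
  intros s. cbn beta. now rewrite E1.
- eapply is_derive_ext; [|assert (E : (Im l * 1 + Re l * 0) = (Im l)) by ring; rewrite E in D2; exact D2].
  intros s. cbn beta. now rewrite E1.
Qed.

Lemma vertical_derive (f : C -> C) (x y : R) (l : C) :
  qdiff f (x, y) l ->
  is_derive (fun s => Re (f (x, s))) y (- Im l) /\ is_derive (fun s => Im (f (x, s))) y (Re l).
Proof.
intros H. destruct (line_derive f x 0 0 1 y l) as [D1 D2].
{ replace (x + y * 0, 0 + y * 1) with (x, y) by (f_equal; ring). exact H. }
assert (E1 : forall s : R, (x + s * 0, 0 + s * 1) = (x, s)) by (intros s; f_equal; ring).
split.
- eapply is_derive_ext; [|assert (E : (Re l * 0 - Im l * 1) = (- Im l)) by ring; rewrite E in D1; exact D1].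
  intros s. cbn beta. now rewrite E1.
- eapply is_derive_ext; [|assert (E : (Im l * 0 + Re l * 1) = (Re l)) by ring; rewrite E in D2; exact D2].
  intros s. cbn beta. now rewrite E1.
Qed.

Section RectWp.

Context (a b g2 g3 : R) (L : C -> Prop) (HR : rect_wp a b g2 g3 L).

Lemma rw_not_multiple (x y : R) (m : Z) : IZR m * a < x < (IZR m + 1) * a -> ~ L (x, y).
Proof.
intros Hx H. apply (rw_mem HR) in H. destruct H as [k [n [E _]]]. assert (Ha := rw_a HR).
assert (H1 : IZR m < IZR k) by nra. assert (H2 : IZR k < IZR (m + 1)) by (rewrite plus_IZR; nra).
apply lt_IZR in H1. apply lt_IZR in H2. lia.
Qed.

Lemma rw_not_multiple_im (x y : R) (m : Z) : IZR m * b < y < (IZR m + 1) * b -> ~ L (x, y).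
Proof.
intros Hx H. apply (rw_mem HR) in H. destruct H as [k [n [_ E]]]. assert (Hb := rw_b HR).
assert (H1 : IZR m < IZR n) by nra. assert (H2 : IZR n < IZR (m + 1)) by (rewrite plus_IZR; nra).
apply lt_IZR in H1. apply lt_IZR in H2. lia.
Qed.

Lemma rw_inside (x y : R) : 0 < x < a -> ~ L (x, y).
Proof. intros H. apply (rw_not_multiple x y 0). lra. Qed.

Lemma rw_conj (w : C) : L w -> L (Cconj w).
Proof.
destruct w as [x y]. intros H. apply (rw_mem HR) in H. destruct H as [m [n [-> ->]]].
change (L (IZR m * a, - (IZR n * b))). apply (rw_mem HR). exists m, (- n)%Z. rewrite opp_IZR. split; ring.
Qed.

Lemma rw_L_a : L (a, 0).
Proof. apply (rw_mem HR). exists 1%Z, 0%Z. split; ring. Qed.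

Lemma rw_L_b : L (0, b).
Proof. apply (rw_mem HR). exists 0%Z, 1%Z. split; ring. Qed.

Lemma rw_d0 (z : C) : ~ L z -> qdiff (wp L) z (wp1 L z).
Proof. intros. eapply qdiff_wp; [apply (rw_dg HR)|apply (rw_cube HR)|assumption]. Qed.

Lemma rw_d1 (z : C) : ~ L z -> qdiff (wp1 L) z (wp2 L z).
Proof. intros. eapply qdiff_wp1; [apply (rw_dg HR)|apply (rw_cube HR)|assumption]. Qed.

Lemma rw_ode (z : C) : ~ L z -> (wp2 L z = 6 * (wp L z * wp L z) - RtoC (g2 / 2))%C.
Proof.
intros Hz. rewrite (wp_second_order L _ a b _ _ (rw_dg HR) (rw_cube HR) (rw_a HR) (rw_b HR)
  rw_L_a rw_L_b (rw_G4 HR) (rw_G6 HR) (rw_per HR) z Hz).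
replace (RtoC (g2 / 2)) with (30 * RtoC (g2 / 60))%C; [reflexivity|].
rewrite <- RtoC_mult. f_equal. field.
Qed.

Lemma Im_0_of_conj (z : C) : Cconj z = z -> Im z = 0.
Proof. destruct z as [x y]. cbn. intros E. inversion E. lra. Qed.

Lemma Re_quadratic (z : C) (c : R) :
  Im z = 0 -> Re (6 * (z * z) - RtoC c)%C = 6 * Re z ^ 2 - c.
Proof. destruct z as [x y]. cbn. intros ->. ring. Qed.

Lemma wp_real_axis (x : R) : ~ L (x, 0) -> Im (wp L (x, 0)) = 0.
Proof.
intros Hx. apply Im_0_of_conj.
rewrite <- (wp_conj L _ (x, 0) (rw_dg HR) (rw_cube HR) rw_conj Hx). f_equal.
apply injective_projections; cbn; ring.
Qed.

(** On this line conj z = a - z, so the real structure, evenness and periodicity give conj (p z) = p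
    z. *)
Lemma wp_middle_line (y : R) : Im (wp L (a / 2, y)) = 0.
Proof.
assert (Ha := rw_a HR). assert (Hn : ~ L (a / 2, y)) by (apply rw_inside; lra).
apply Im_0_of_conj. rewrite <- (wp_conj L _ _ (rw_dg HR) (rw_cube HR) rw_conj Hn).
rewrite <- (wp_opp L _ _ (rw_dg HR) (rw_cube HR) Hn).
rewrite <- (rw_per HR (- ((a / 2)%R, y))%C (a, 0)).
- f_equal. apply injective_projections; cbn; lra.
- intros H. apply Hn. replace (a / 2, y) with (- - ((a / 2)%R, y))%C by ring.
  eapply dg_opp; [apply (rw_dg HR)|exact H].
- apply rw_L_a.
Qed.

(** p' is odd and has the period 2 z. *)
Lemma wp1_half_period (z : C) : ~ L z -> L (z + z)%C -> wp1 L z = 0.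
Proof.
intros Hz H2.
assert (Hm : ~ L (- z)%C).
{ intros H. apply Hz. replace z with (- - z)%C by ring. eapply dg_opp; [apply (rw_dg HR)|exact H]. }
assert (E1 : wp1 L z = wp1 L (- z)%C).
{ replace z with (- z + (z + z))%C at 1 by ring.
  apply (periodic_derivative L _ (wp L) (wp1 L) (z + z) (rw_dg HR) H2 rw_d0); [|exact Hm].
  intros x Hx. now apply (rw_per HR). }
assert (E2 : wp1 L (- z)%C = (- wp1 L z)%C).
{ unfold wp1. assert (E := eis_opp L _ 1 z (rw_dg HR) (rw_cube HR) (off_poles_notin L z Hz)).
  cbn [Nat.add] in E. rewrite E. cbn [Cpow]. field. intros ->. apply Hz, (dg_0 (rw_dg HR)). }
assert (E3 : (2 * wp1 L z = 0)%C).
{ replace (2 * wp1 L z)%C with (wp1 L z + wp1 L z)%C by ring. rewrite E1 at 1. rewrite E2. ring. }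
replace (wp1 L z) with (/ 2 * (2 * wp1 L z))%C by (field; intros H3; apply RtoC_inj in H3; lra).
rewrite E3. ring.
Qed.

Definition wp_real (x : R) : R := Re (wp L (x, 0)).
Definition wp1_real (x : R) : R := Re (wp1 L (x, 0)).

Lemma derive_wp_real (x : R) : 0 < x < a -> is_derive wp_real x (wp1_real x).
Proof. intros H. apply (horizontal_derive (wp L)), rw_d0, rw_inside, H. Qed.

Lemma derive_wp1_real (x : R) : 0 < x < a -> is_derive wp1_real x (6 * wp_real x ^ 2 - g2 / 2).
Proof.
intros H. assert (Hn := rw_inside x 0 H).
replace (6 * wp_real x ^ 2 - g2 / 2) with (Re (wp2 L (x, 0))).
- apply (horizontal_derive (wp1 L)), rw_d1, Hn.
- rewrite rw_ode by exact Hn. apply Re_quadratic, wp_real_axis, Hn.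
Qed.

(** Laurent expansions at 0, with g2/20 = 3 G4, g3/28 = 5 G6 and g3/14 = 10 G6. *)
Lemma wp_real_expansion : exists d K, 0 < d /\ 0 <= K /\ forall x, 0 < x < d -> exists h k,
  wp_real x = / x ^ 2 + h /\ wp1_real x = - 2 * (/ x ^ 3 + k) /\
  Rabs (h - g2 / 20 * x ^ 2 - g3 / 28 * x ^ 4) <= K * x ^ 5 /\
  Rabs (k + g2 / 20 * x + g3 / 14 * x ^ 3) <= K * x ^ 4.
Proof.
assert (Hr := dg_pos (rw_dg HR)). set (r := Rmin a b) in *.
destruct (eis_2_taylor L r _ _ (rw_dg HR) (rw_cube HR) (rw_G4 HR) (rw_G6 HR)) as [K2 [HK2 T2]].
destruct (eis_3_taylor L r _ _ (rw_dg HR) (rw_cube HR) (rw_G4 HR) (rw_G6 HR)) as [K3 [HK3 T3]].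
exists (r / 2), (K2 + K3). split; [lra|split; [lra|]]. intros x Hx.
assert (Hm : Cmod (x, 0) = x) by (change (x, 0) with (RtoC x); rewrite Cmod_R; apply Rabs_right; lra).
specialize (T2 (x, 0) ltac:(lra)). specialize (T3 (x, 0) ltac:(lra)). rewrite Hm in *.
exists (Re (eis L 2 (x, 0))), (Re (eis L 3 (x, 0))).
assert (Hinv : forall n, Re ((/ (x, 0)) ^ n)%C = / x ^ n).
{ intros n. change (x, 0) with (RtoC x). rewrite <- RtoC_inv by lra. rewrite <- RtoC_pow. apply pow_inv. }
split; [|split; [|split]].
- unfold wp_real, wp. rewrite <- Hinv. unfold Re. cbn. ring.
- unfold wp1_real, wp1. rewrite <- Hinv.
  set (u := ((/ (x, 0)) ^ 3)%C). set (v := eis L 3 (x, 0)). unfold Re. cbn. ring.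
- apply Rle_trans with (K2 * x ^ 5).
  + eapply Rle_trans; [|exact T2]. eapply Rle_trans; [|apply re_le_Cmod]. right. f_equal.
    change (x, 0) with (RtoC x). rewrite <- !RtoC_pow, <- !RtoC_mult.
    set (v := eis L 2 x). unfold Re. cbn. field.
  + apply Rmult_le_compat_r; [apply pow_le; lra|lra].
- apply Rle_trans with (K3 * x ^ 4).
  + eapply Rle_trans; [|exact T3]. eapply Rle_trans; [|apply re_le_Cmod]. right. f_equal.
    change (x, 0) with (RtoC x). rewrite <- !RtoC_pow, <- !RtoC_mult.
    set (v := eis L 3 x). unfold Re. cbn. field.
  + apply Rmult_le_compat_r; [apply pow_le; lra|lra].
Qed.

(** The first two bounds provide the initial data of 1/(1/3 + p); the third one fixes the constant
    of the first integral. *)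
Lemma wp_real_near_0 : exists d K, 0 < d <= 1 /\ 0 <= K /\ forall x, 0 < x < d ->
  Rabs (wp_real x - / x ^ 2) <= K * x ^ 2 /\ Rabs (wp1_real x + 2 * / x ^ 3) <= K * x /\
  Rabs (wp1_real x ^ 2 - 4 * wp_real x ^ 3 + g2 * wp_real x + g3) <= K * x.
Proof.
destruct wp_real_expansion as [d [K [Hd [HK H]]]].
assert (G2 := Rabs_pos g2). assert (G3 := Rabs_pos g3).
pose (M := Rabs g2 + Rabs g3 + K).
assert (HM : 0 <= M) by (unfold M; lra).
exists (Rmin d 1), (2 * M + (20 * K + 4 * M ^ 2 + 12 * M ^ 2 + 4 * M ^ 3 + Rabs g2 * M)).
split; [split; [apply Rmin_glb_lt; lra|apply Rmin_r]|].
assert (HM2 : 0 <= M ^ 2) by (apply pow_le, HM). assert (HM3 : 0 <= M ^ 3) by (apply pow_le, HM).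
assert (HgM : 0 <= Rabs g2 * M) by nra.
split; [lra|]. intros x Hx.
assert (L1 := Rmin_l d 1). assert (L2 := Rmin_r d 1).
destruct (H x ltac:(lra)) as [h [k [Ep [Eq [Hh Hk]]]]].
assert (Hx0 : 0 < x) by lra. assert (Hx1 : x <= 1) by lra.
assert (X2 : 0 < x ^ 2) by (apply pow_lt; lra). assert (X3 : 0 < x ^ 3) by (apply pow_lt; lra).
assert (X4 : 0 < x ^ 4) by (apply pow_lt; lra).
assert (O2 : x ^ 2 <= x) by (replace (x ^ 2) with (x * x) by ring; nra).
assert (O3 : x ^ 3 <= x ^ 2) by (replace (x ^ 3) with (x * x ^ 2) by ring; nra).
assert (O4 : x ^ 4 <= x ^ 3) by (replace (x ^ 4) with (x * x ^ 3) by ring; nra).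
assert (O5 : x ^ 5 <= x ^ 4) by (replace (x ^ 5) with (x * x ^ 4) by ring; nra).
assert (Bh : Rabs h <= M * x ^ 2).
{ replace h with ((h - g2 / 20 * x ^ 2 - g3 / 28 * x ^ 4) + (g2 * (x ^ 2 / 20) + g3 * (x ^ 4 / 28))) by field.
  eapply Rle_trans; [apply Rabs_triang|]. eapply Rle_trans; [apply Rplus_le_compat_l, Rabs_triang|].
  rewrite !Rabs_mult, (Rabs_right (x ^ 2 / 20)), (Rabs_right (x ^ 4 / 28)) by lra. unfold M. nra. }
assert (Bk : Rabs k <= M * x).
{ replace k with ((k + g2 / 20 * x + g3 / 14 * x ^ 3) + (g2 * (- x / 20) + g3 * (- x ^ 3 / 14))) by field.
  eapply Rle_trans; [apply Rabs_triang|]. eapply Rle_trans; [apply Rplus_le_compat_l, Rabs_triang|].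
  rewrite !Rabs_mult, (Rabs_left (- x / 20)), (Rabs_left (- x ^ 3 / 14)) by lra. unfold M. nra. }
set (eta := h - g2 / 20 * x ^ 2 - g3 / 28 * x ^ 4) in *.
set (kap := k + g2 / 20 * x + g3 / 14 * x ^ 3) in *.
split; [|split].
- rewrite Ep. replace (/ x ^ 2 + h - / x ^ 2) with h by ring. nra.
- rewrite Eq. replace (- 2 * (/ x ^ 3 + k) + 2 * / x ^ 3) with (- 2 * k) by ring.
  rewrite Rabs_mult, Rabs_left by lra. nra.
(* With [h] and [k] expressed by the remainders [eta] and [kap], the negative powers of [x] and the
   constant term cancel identically. *)
- replace (wp1_real x ^ 2 - 4 * wp_real x ^ 3 + g2 * wp_real x + g3) with
    (8 * (kap / x ^ 3) + (- 12 * (eta / x ^ 4) + (4 * k ^ 2 + (- 12 * (h / x) ^ 2 + (- 4 * h ^ 3 + g2 * h))))).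
  2:{ rewrite Ep, Eq. unfold eta, kap. field. lra. }
  assert (Q1 : Rabs (kap / x ^ 3) <= K * x).
  { unfold Rdiv. rewrite Rabs_mult, (Rabs_right (/ x ^ 3)) by (left; now apply Rinv_0_lt_compat).
    apply Rle_div_l; [exact X3|]. replace (K * x * x ^ 3) with (K * x ^ 4) by ring. exact Hk. }
  assert (Q2 : Rabs (eta / x ^ 4) <= K * x).
  { unfold Rdiv. rewrite Rabs_mult, (Rabs_right (/ x ^ 4)) by (left; now apply Rinv_0_lt_compat).
    apply Rle_div_l; [exact X4|]. replace (K * x * x ^ 4) with (K * x ^ 5) by ring. exact Hh. }
  assert (Q3 : Rabs (h / x) <= M * x).
  { unfold Rdiv. rewrite Rabs_mult, (Rabs_right (/ x)) by (left; now apply Rinv_0_lt_compat).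
    apply Rle_div_l; [exact Hx0|]. replace (M * x * x) with (M * x ^ 2) by ring. exact Bh. }
  assert (R1 : Rabs k ^ 2 <= M ^ 2 * x).
  { apply Rle_trans with ((M * x) ^ 2); [apply pow_incr; split; [apply Rabs_pos|exact Bk]|].
    rewrite Rpow_mult_distr. nra. }
  assert (R2 : Rabs (h / x) ^ 2 <= M ^ 2 * x).
  { apply Rle_trans with ((M * x) ^ 2); [apply pow_incr; split; [apply Rabs_pos|exact Q3]|].
    rewrite Rpow_mult_distr. nra. }
  assert (R3 : Rabs h ^ 3 <= M ^ 3 * x).
  { apply Rle_trans with ((M * x) ^ 3); [apply pow_incr; split; [apply Rabs_pos|nra]|].
    rewrite Rpow_mult_distr. nra. }
  assert (R4 : Rabs g2 * Rabs h <= Rabs g2 * M * x) by nra.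
  rewrite RPow_abs in R1, R2, R3. rewrite <- Rabs_mult in R4.
  apply Rabs_le_between in Q1. apply Rabs_le_between in Q2. apply Rabs_le_between in R1.
  apply Rabs_le_between in R2. apply Rabs_le_between in R3. apply Rabs_le_between in R4.
  apply Rabs_le_between. set (T := (2 * M + _) * x).
  assert (ET : T = 2 * (M * x) + (20 * (K * x) + 4 * (M ^ 2 * x) + 12 * (M ^ 2 * x) + 4 * (M ^ 3 * x) + Rabs g2 * M * x))
    by (unfold T; ring).
  assert (0 <= M * x) by nra. lra.
Qed.

End RectWp.

(** * Real-variable tools: mean values, Gronwall's inequality, continuation *)

Lemma is_derive_continuous_R (f : R -> R) (x l : R) : is_derive f x l -> continuous f x.
Proof. intros H. apply (ex_derive_continuous (V := R_NormedModule)). now exists l. Qed.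

Lemma MVT_derive (f df : R -> R) (s t : R) :
  s <= t -> (forall x, s <= x <= t -> is_derive f x (df x)) ->
  exists c, s <= c <= t /\ f t - f s = df c * (t - s).
Proof.
intros Hst H. destruct (MVT_gen f s t df) as [c Hc]; rewrite ?Rmin_left, ?Rmax_right in * by lra.
- intros x Hx. apply H. lra.
- intros x Hx. apply continuity_pt_filterlim. eapply is_derive_continuous_R. now apply H.
- now exists c.
Qed.

Lemma IVT_derive (f df : R -> R) (s t v : R) :
  s < t -> (forall x, is_derive f x (df x)) -> f s < v < f t -> exists c, s < c < t /\ f c = v.
Proof.
intros Hst H Hv. destruct (IVT_gen f s t v) as [c [Hc E]].
- intros x. apply continuity_pt_filterlim. eapply is_derive_continuous_R, H.
- rewrite Rmin_left, Rmax_right; lra.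
- rewrite Rmin_left, Rmax_right in Hc by lra. exists c. split; [|exact E].
  destruct (Req_dec c s) as [->|]; [lra|]. destruct (Req_dec c t) as [->|]; lra.
Qed.

Lemma constant_of_derive_0 (f : R -> R) (s t : R) :
  s <= t -> (forall x, s <= x <= t -> is_derive f x 0) -> f s = f t.
Proof.
intros Hst H. destruct (MVT_derive f (fun _ => 0) s t Hst H) as [c [_ E]]. lra.
Qed.

(** E(t) exp(-K t) is nonincreasing and tends to 0 at [a]. The initial condition is a limit at an
    open end, so that functions coming out of a pole can be compared. *)
Lemma gronwall_zero (E dE : R -> R) (a b K : R) :
  (forall t, a < t < b -> is_derive E t (dE t)) ->
  (forall t, a < t < b -> dE t <= K * E t) ->
  (forall t, a < t < b -> 0 <= E t) ->
  (forall eps, 0 < eps -> exists d, 0 < d /\ forall t, a < t < b -> t < a + d -> E t < eps) ->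
  forall t, a < t < b -> E t = 0.
Proof.
intros Hd Hle Hpos Hlim t Ht. apply Rle_antisym; [|now apply Hpos].
apply le_epsilon. intros eps Heps. rewrite Rplus_0_l.
(* [m] bounds exp(K (t - s)) on the interval, whatever the sign of [K]. *)
set (m := exp (Rabs K * (b - a))). assert (Hm : 0 < m) by apply exp_pos.
destruct (Hlim (eps / m)) as [d [Hd0 H]]; [now apply Rdiv_lt_0_compat|].
pose (s := a + Rmin (d / 2) ((t - a) / 2)).
assert (L1 := Rmin_l (d / 2) ((t - a) / 2)). assert (L2 := Rmin_r (d / 2) ((t - a) / 2)).
assert (L3 : 0 < Rmin (d / 2) ((t - a) / 2)) by (apply Rmin_glb_lt; lra).
assert (Hs : a < s < t) by (unfold s; lra).
specialize (H s ltac:(lra) ltac:(unfold s; lra)).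
pose (g := fun x => E x * exp (- K * (x - s))).
assert (Hg : forall x, a < x < b -> is_derive g x ((dE x - K * E x) * exp (- K * (x - s)))).
{ intros x Hx. unfold g.
  replace ((dE x - K * E x) * exp (- K * (x - s))) with
    (dE x * exp (- K * (x - s)) + E x * (- K * exp (- K * (x - s)))) by ring.
  apply (is_derive_mult E (fun x => exp (- K * (x - s)))); [now apply Hd| |intros; apply Rmult_comm].
  auto_derive; [auto|]. unfold Rminus. ring. }
destruct (MVT_derive g (fun x => (dE x - K * E x) * exp (- K * (x - s))) s t ltac:(lra)) as [c [Hc Eg]].
{ intros x Hx. apply Hg. lra. }
assert (Hneg : (dE c - K * E c) * exp (- K * (c - s)) <= 0).
{ specialize (Hle c ltac:(lra)). assert (He := exp_pos (- K * (c - s))). nra. }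
assert (Hts : g t <= g s) by nra.
unfold g in Hts. rewrite Rminus_diag, Rmult_0_r, exp_0, Rmult_1_r in Hts.
assert (Hexp : exp (K * (t - s)) * exp (- K * (t - s)) = 1).
{ rewrite <- exp_plus. replace (K * (t - s) + - K * (t - s)) with 0 by ring. apply exp_0. }
assert (Hkm : exp (K * (t - s)) <= m).
{ destruct (Req_dec (K * (t - s)) (Rabs K * (b - a))) as [->|Hne]; [unfold m; lra|].
  left. apply exp_increasing. assert (K <= Rabs K) by apply Rle_abs.
  assert (0 <= Rabs K) by apply Rabs_pos. nra. }
assert (Hp1 := exp_pos (K * (t - s))). assert (Hp2 := exp_pos (- K * (t - s))).
assert (HEs := Hpos s ltac:(lra)).
assert (H1 : E t <= E s * exp (K * (t - s))).
{ replace (E t) with (E t * exp (- K * (t - s)) * exp (K * (t - s))).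
  - apply Rmult_le_compat_r; lra.
  - rewrite Rmult_assoc, (Rmult_comm (exp (- K * (t - s)))), Hexp. ring. }
apply Rle_trans with (1 := H1). apply Rle_trans with (E s * m); [apply Rmult_le_compat_l; lra|].
apply Rlt_div_r in H; lra.
Qed.

Lemma continuous_eps (f : R -> R) (x eps : R) : continuous f x -> 0 < eps ->
  exists d, 0 < d /\ forall y, Rabs (y - x) < d -> Rabs (f y - f x) < eps.
Proof.
intros H Heps. apply continuity_pt_filterlim in H.
destruct (proj1 (continuity_pt_locally f x) H (mkposreal eps Heps)) as [d Hd].
exists d. split; [apply cond_pos|]. exact Hd.
Qed.

(** Continuity induction: the bound [c] cannot be lost for a first time, since up to that time it
    improves to [c']. *)
Lemma bootstrap (W : R -> R) (T c c' : R) :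
  c < c' -> (forall t, 0 < t < T -> continuous W t) ->
  (exists d, 0 < d /\ forall t, 0 < t < d -> c < W t) ->
  (forall tau, 0 < tau < T -> (forall t, 0 < t < tau -> c < W t) -> forall t, 0 < t < tau -> c' <= W t) ->
  forall t, 0 < t < T -> c < W t.
Proof.
intros Hc Hcont [d [Hd H0]] Hstep t Ht. apply NNPP. intros Hn.
pose (S := fun tau => 0 <= tau <= t /\ forall x, 0 < x < tau -> c < W x).
destruct (completeness S) as [s [Hs1 Hs2]].
- exists t. intros x [Hx _]. lra.
- exists 0. split; [lra|]. intros x Hx. lra.
- assert (Hst : s <= t) by (apply Hs2; intros x [Hx _]; lra).
  assert (Hs0 : 0 < s).
  { apply Rlt_le_trans with (Rmin d t); [apply Rmin_glb_lt; lra|]. apply Hs1.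
    split; [split; [left; apply Rmin_glb_lt; lra|apply Rmin_r]|].
    intros x Hx. apply H0. generalize (Rmin_l d t). lra. }
  assert (Hbelow : forall x, 0 < x < s -> c < W x).
  { intros x Hx. apply NNPP. intros Hnx. assert (s <= x); [|lra].
    apply Hs2. intros y [_ Hy2]. apply Rnot_lt_le. intros Hlt. apply Hnx, Hy2. lra. }
  assert (HW := Hstep s ltac:(lra) Hbelow).
  destruct (continuous_eps W s ((c' - c) / 2) (Hcont s ltac:(lra)) ltac:(lra)) as [e [He H]].
  assert (Hm : 0 < Rmin (e / 2) (s / 2)) by (apply Rmin_glb_lt; lra).
  assert (M1 := Rmin_l (e / 2) (s / 2)). assert (M2 := Rmin_r (e / 2) (s / 2)).
  assert (HWs : c + (c' - c) / 2 < W s).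
  { assert (H1 := H (s - Rmin (e / 2) (s / 2)) ltac:(apply Rabs_def1; lra)).
    assert (H2 := HW (s - Rmin (e / 2) (s / 2)) ltac:(lra)).
    apply Rabs_def2 in H1. lra. }
  destruct (Req_dec s t) as [->|Hne]; [apply Hn; lra|].
  assert (HS : S (Rmin (s + e / 2) t)).
  { assert (N1 := Rmin_l (s + e / 2) t). assert (N2 := Rmin_r (s + e / 2) t).
    split; [split; [left; apply Rmin_glb_lt; lra|exact N2]|].
    intros x Hx. destruct (Rlt_le_dec x s) as [Hxs|Hxs]; [apply Hbelow; lra|].
    specialize (H x ltac:(apply Rabs_def1; lra)). apply Rabs_def2 in H. lra. }
  apply Hs1 in HS. assert (s < Rmin (s + e / 2) t) by (apply Rmin_glb_lt; lra). lra.
Qed.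

(** * First integral, behaviour at the poles, and p on the line Re = omega *)

Section RectWp2.

Context (a b g2 g3 : R) (L : C -> Prop) (HR : rect_wp a b g2 g3 L).

Lemma wp_real_first_integral (x : R) : 0 < x < a -> wp1_real L x ^ 2 = 4 * wp_real L x ^ 3 - g2 * wp_real L x - g3.
Proof.
intros Hx. destruct (wp_real_near_0 a b g2 g3 L HR) as [d [K [Hd [HK H]]]].
pose (I := fun x => wp1_real L x ^ 2 - 4 * wp_real L x ^ 3 + g2 * wp_real L x + g3).
assert (HI : I x = 0).
{ apply Rabs_eq_0. apply Rle_antisym; [|apply Rabs_pos]. apply le_epsilon. intros eps Heps.
  rewrite Rplus_0_l.
  pose (s := Rmin (Rmin (d / 2) x) (eps / (K + 1))).
  assert (Hs : 0 < s) by (repeat apply Rmin_glb_lt; try lra; apply Rdiv_lt_0_compat; lra).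
  assert (M1 : s <= Rmin (d / 2) x) by apply Rmin_l.
  assert (M2 : s <= eps / (K + 1)) by apply Rmin_r.
  assert (M3 := Rmin_l (d / 2) x). assert (M4 := Rmin_r (d / 2) x).
  replace (I x) with (I s).
  - unfold I. destruct (H s ltac:(lra)) as [_ [_ H3]]. apply Rle_trans with (1 := H3).
    apply Rle_div_r in M2; nra.
  - apply constant_of_derive_0; [lra|]. intros y Hy.
    assert (D0 := derive_wp_real a b g2 g3 L HR y ltac:(lra)).
    assert (D1 := derive_wp1_real a b g2 g3 L HR y ltac:(lra)).
    unfold I. auto_derive.
    + repeat split; first [now exists (6 * wp_real L y ^ 2 - g2 / 2)|now exists (wp1_real L y)].
    + replace (Derive (fun x : R => wp_real L x) y) with (wp1_real L y) by (symmetry; apply is_derive_unique; exact D0).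
      replace (Derive (fun x : R => wp1_real L x) y) with (6 * wp_real L y ^ 2 - g2 / 2) by (symmetry; apply is_derive_unique; exact D1).
      field. }
unfold I in HI. lra.
Qed.

Lemma wp_blowup (M : R) : exists d, 0 < d /\ forall z : C, z <> 0 -> Cmod z < d -> M < Cmod (wp L z).
Proof.
assert (Hq := qdiff_eis L _ 0 0 (rw_dg HR) (rw_cube HR) (off_poles_0 L)). cbn [Nat.add] in Hq.
apply qdiff_Lipschitz in Hq. destruct Hq as [d [K [Hd [HK H]]]].
set (e0 := Cmod (eis L 2 0)). assert (He0 : 0 <= e0) by apply Cmod_ge_0.
pose (Q := Rabs M + e0 + K + 1). assert (HM := Rabs_pos M). assert (HM' := Rle_abs M).
exists (Rmin (Rmin d 1) (/ Q)).
assert (HQ : 0 < Q) by (unfold Q; lra). assert (HiQ := Rinv_0_lt_compat _ HQ).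
split; [repeat apply Rmin_glb_lt; lra|]. intros z Hz Hzd.
assert (L1 := Rmin_l (Rmin d 1) (/ Q)). assert (L2 := Rmin_r (Rmin d 1) (/ Q)).
assert (L3 := Rmin_l d 1). assert (L4 := Rmin_r d 1).
specialize (H z ltac:(lra)). rewrite Cplus_0_l in H.
assert (Hx : 0 < Cmod z) by (apply Cmod_gt_0; exact Hz).
assert (He : Cmod (eis L 2 z) <= e0 + K).
{ replace (eis L 2 z) with (eis L 2 0 + (eis L 2 z - eis L 2 0))%C by ring.
  eapply Rle_trans; [apply Cmod_triangle|]. fold e0. nra. }
assert (Hinv : Q <= / Cmod z).
{ rewrite <- (Rinv_inv Q). apply Rinv_le_contravar; lra. }
assert (H2 : / Cmod z <= Cmod ((/ z) ^ 2)).
{ rewrite Cmod_pow, Cmod_inv by exact Hz. assert (1 <= / Cmod z) by (unfold Q in Hinv; lra). nra. }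
generalize (Cmod_sub_ge ((/ z) ^ 2) (- eis L 2 z)). rewrite Cmod_opp.
replace ((/ z) ^ 2 - - eis L 2 z)%C with (wp L z) by (unfold wp; ring). unfold Q in *. lra.
Qed.

Lemma wp_real_blowup (M : R) : exists d, 0 < d /\ forall x, 0 < x < d -> M < wp_real L x.
Proof.
destruct (wp_real_near_0 a b g2 g3 L HR) as [d [K [Hd [HK H]]]].
pose (Q := Rabs M + K + 1). assert (HM := Rabs_pos M). assert (HM' := Rle_abs M).
assert (HQ : 0 < Q) by (unfold Q; lra). assert (HiQ := Rinv_0_lt_compat _ HQ).
exists (Rmin d (/ Q)). split; [apply Rmin_glb_lt; lra|]. intros x Hx.
assert (L1 := Rmin_l d (/ Q)). assert (L2 := Rmin_r d (/ Q)).
destruct (H x ltac:(lra)) as [H1 _]. apply Rabs_le_between in H1.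
assert (Hinv : Q <= / x) by (rewrite <- (Rinv_inv Q); apply Rinv_le_contravar; lra).
assert (H2 : / x <= / x ^ 2).
{ apply Rinv_le_contravar; [apply pow_lt; lra|]. nra. }
assert (x ^ 2 <= 1) by nra. unfold Q in *. nra.
Qed.

Lemma wp_real_reflect (x : R) : 0 < x < a -> wp_real L (a - x) = wp_real L x.
Proof.
intros Hx. unfold wp_real. f_equal. assert (Hn := rw_inside a b g2 g3 L HR x 0 Hx).
rewrite <- (wp_opp L _ (x, 0) (rw_dg HR) (rw_cube HR) Hn).
rewrite <- (rw_per HR (- (x, 0))%C (a, 0)).
- f_equal. apply injective_projections; cbn; ring.
- intros H. apply Hn. replace (x, 0) with (- - (x, 0))%C by ring.
  eapply dg_opp; [apply (rw_dg HR)|exact H].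
- apply (rw_L_a a b g2 g3 L HR).
Qed.

Lemma wp1_real_half : wp1_real L (a / 2) = 0.
Proof.
assert (Ha := rw_a HR). unfold wp1_real.
rewrite (wp1_half_period a b g2 g3 L HR); [reflexivity| |].
- apply (rw_inside a b g2 g3 L HR). lra.
- change (L (a / 2 + a / 2, 0 + 0)). apply (rw_mem HR). exists 1%Z, 0%Z. split; field.
Qed.

Definition wp_mid (y : R) : R := Re (wp L (a / 2, y)).
(** Along a vertical line the derivative of p is i p', whose real part is - Im p'. *)
Definition wp1_mid (y : R) : R := - Im (wp1 L (a / 2, y)).

Lemma middle_notin (y : R) : ~ L (a / 2, y).
Proof. assert (Ha := rw_a HR). apply (rw_inside a b g2 g3 L HR). lra. Qed.

Lemma derive_wp_mid (y : R) : is_derive wp_mid y (wp1_mid y).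
Proof. apply (vertical_derive (wp L)), (rw_d0 a b g2 g3 L HR), middle_notin. Qed.

Lemma derive_wp1_mid (y : R) : is_derive wp1_mid y (- (6 * wp_mid y ^ 2 - g2 / 2)).
Proof.
assert (Hn := middle_notin y).
destruct (vertical_derive (wp1 L) (a / 2) y (wp2 L (a / 2, y))) as [_ H].
{ apply (rw_d1 a b g2 g3 L HR), Hn. }
rewrite (rw_ode a b g2 g3 L HR _ Hn) in H.
rewrite Re_quadratic in H by apply (wp_middle_line a b g2 g3 L HR).
exact (is_derive_opp _ _ _ H).
Qed.

Lemma Re_wp1_middle (y : R) : Re (wp1 L (a / 2, y)) = 0.
Proof.
destruct (vertical_derive (wp L) (a / 2) y (wp1 L (a / 2, y))) as [_ H].
{ apply (rw_d0 a b g2 g3 L HR), middle_notin. }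
rewrite <- (is_derive_unique _ _ _ H).
rewrite (Derive_ext _ (fun _ => 0)); [apply Derive_const|].
intros s. apply (wp_middle_line a b g2 g3 L HR).
Qed.

Lemma wp1_mid_half : wp1_mid (b / 2) = 0.
Proof.
unfold wp1_mid. rewrite (wp1_half_period a b g2 g3 L HR).
- cbn. ring.
- apply middle_notin.
- change (L (a / 2 + a / 2, b / 2 + b / 2)). apply (rw_mem HR). exists 1%Z, 1%Z. split; field.
Qed.

Lemma wp1_mid_0 : wp1_mid 0 = 0.
Proof.
unfold wp1_mid. rewrite (wp1_half_period a b g2 g3 L HR).
- cbn. ring.
- apply middle_notin.
- change (L (a / 2 + a / 2, 0 + 0)). apply (rw_mem HR). exists 1%Z, 0%Z. split; field.
Qed.

End RectWp2.

Lemma continuous_bounded (f : R -> R) (s t : R) : s <= t ->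
  (forall x, s <= x <= t -> continuous f x) -> exists K, 0 <= K /\ forall x, s <= x <= t -> Rabs (f x) <= K.
Proof.
intros Hst Hf.
destruct (continuity_ab_maj (fun x => Rabs (f x)) s t Hst) as [m [Hm _]].
- intros c Hc. apply continuity_pt_filterlim. apply (continuous_comp f Rabs); [now apply Hf|].
  apply continuous_Rabs.
- exists (Rabs (f m)). split; [apply Rabs_pos|exact Hm].
Qed.

Lemma Rabs_mult_le_sum_sqr (p q E : R) : p ^ 2 + q ^ 2 <= E -> Rabs (p * q) <= E / 2.
Proof. intros H. apply Rabs_le. assert (0 <= (p - q) ^ 2) by apply pow2_ge_0. assert (0 <= (p + q) ^ 2) by apply pow2_ge_0. nra. Qed.

(** The left side is the derivative of the energy in [wp_reflect]. It consists of twelve products of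
    two unknowns and a bounded factor; each product of two unknowns is at most half the energy. *)
Lemma energy_bound (d1 d2 e1 e2 x y m1 m2 X M : R) :
  Rabs x <= X -> Rabs y <= X -> Rabs m1 <= M -> Rabs m2 <= M ->
  2 * (d1 * (e1 * x - e2 * y) + d2 * (e2 * x + e1 * y)
       + e1 * ((m1 * d1 - m2 * d2) * x - (m1 * d2 + m2 * d1) * y)
       + e2 * ((m1 * d2 + m2 * d1) * x + (m1 * d1 - m2 * d2) * y))
  <= (4 * X + 8 * (M * X)) * (d1 ^ 2 + d2 ^ 2 + e1 ^ 2 + e2 ^ 2).
Proof.
intros Hx Hy Hm1 Hm2. set (E := d1 ^ 2 + d2 ^ 2 + e1 ^ 2 + e2 ^ 2).
assert (HX : 0 <= X) by (eapply Rle_trans; [apply Rabs_pos|exact Hx]).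
assert (HM : 0 <= M) by (eapply Rle_trans; [apply Rabs_pos|exact Hm1]).
assert (Sq : forall u : R, 0 <= u ^ 2) by (intros; apply pow2_ge_0).
assert (B : forall p q r C : R, p ^ 2 + q ^ 2 <= E -> Rabs r <= C -> p * q * r <= E / 2 * C).
{ intros p q r C Hpq Hr. eapply Rle_trans; [apply Rle_abs|]. rewrite Rabs_mult.
  apply Rmult_le_compat; try apply Rabs_pos; [now apply Rabs_mult_le_sum_sqr|exact Hr]. }
assert (N : forall r C, Rabs r <= C -> Rabs (- r) <= C) by (intros; now rewrite Rabs_Ropp).
assert (MX : forall m r, Rabs m <= M -> Rabs r <= X -> Rabs (m * r) <= M * X).
{ intros. rewrite Rabs_mult. apply Rmult_le_compat; try apply Rabs_pos; assumption. }
assert (H11 : d1 ^ 2 + e1 ^ 2 <= E) by (unfold E; generalize (Sq d2), (Sq e2); lra).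
assert (H12 : d1 ^ 2 + e2 ^ 2 <= E) by (unfold E; generalize (Sq d2), (Sq e1); lra).
assert (H21 : d2 ^ 2 + e1 ^ 2 <= E) by (unfold E; generalize (Sq d1), (Sq e2); lra).
assert (H22 : d2 ^ 2 + e2 ^ 2 <= E) by (unfold E; generalize (Sq d1), (Sq e1); lra).
generalize (B _ _ x _ H11 Hx), (B _ _ (- y) _ H12 (N _ _ Hy)), (B _ _ x _ H22 Hx), (B _ _ y _ H21 Hy),
  (B _ _ (m1 * x) _ H11 (MX _ _ Hm1 Hx)), (B _ _ (- (m2 * x)) _ H21 (N _ _ (MX _ _ Hm2 Hx))),
  (B _ _ (- (m1 * y)) _ H21 (N _ _ (MX _ _ Hm1 Hy))), (B _ _ (- (m2 * y)) _ H11 (N _ _ (MX _ _ Hm2 Hy))),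
  (B _ _ (m1 * x) _ H22 (MX _ _ Hm1 Hx)), (B _ _ (m2 * x) _ H12 (MX _ _ Hm2 Hx)),
  (B _ _ (m1 * y) _ H12 (MX _ _ Hm1 Hy)), (B _ _ (- (m2 * y)) _ H22 (N _ _ (MX _ _ Hm2 Hy))).
lra.
Qed.


(** * Symmetry of p about its critical points *)

Section Reflection.

Local Opaque wp wp1 wp2.

Context (a b g2 g3 : R) (L : C -> Prop) (HR : rect_wp a b g2 g3 L).

Context (z1 : C) (Hcrit : wp1 L z1 = 0)
  (Hplus : forall s, 0 <= s < 1 -> ~ L (fst z1 + s * fst z1, snd z1 + s * snd z1))
  (Hminus : forall s, 0 <= s < 1 -> ~ L (fst z1 + s * - fst z1, snd z1 + s * - snd z1)).

Let x := fst z1.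
Let y := snd z1.
Let zp (s : R) : C := (x + s * x, y + s * y).
Let zm (s : R) : C := (x + s * - x, y + s * - y).

(** The difference of p and the sum of p' at the two reflected points satisfy a linear system in
    [s], with zero initial data because p' vanishes at [z1]. Gronwall keeps them zero while both
    segments, towards 2 z1 and towards 0, avoid the poles. *)
Lemma wp_reflect (s : R) : 0 < s < 1 -> wp L (zp s) = wp L (zm s).
Proof.
intros Hs.
assert (Dp : forall t, 0 <= t < 1 -> _) by (intros t Ht; exact (line_derive (wp L) x y x y t _ (rw_d0 a b g2 g3 L HR _ (Hplus t Ht)))).
assert (Dm : forall t, 0 <= t < 1 -> _) by (intros t Ht; exact (line_derive (wp L) x y (- x) (- y) t _ (rw_d0 a b g2 g3 L HR _ (Hminus t Ht)))).
assert (Dp1 : forall t, 0 <= t < 1 -> _) by (intros t Ht; exact (line_derive (wp1 L) x y x y t _ (rw_d1 a b g2 g3 L HR _ (Hplus t Ht)))).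
assert (Dm1 : forall t, 0 <= t < 1 -> _) by (intros t Ht; exact (line_derive (wp1 L) x y (- x) (- y) t _ (rw_d1 a b g2 g3 L HR _ (Hminus t Ht)))).
cbn beta in Dp, Dm, Dp1, Dm1.
pose (d1 := fun t => Re (wp L (zp t)) - Re (wp L (zm t))).
pose (d2 := fun t => Im (wp L (zp t)) - Im (wp L (zm t))).
pose (e1 := fun t => Re (wp1 L (zp t)) + Re (wp1 L (zm t))).
pose (e2 := fun t => Im (wp1 L (zp t)) + Im (wp1 L (zm t))).
(* [m1] and [m2] are the parts of the factor 6 (u + v) in 6 u^2 - 6 v^2 = 6 (u + v) (u - v), for the
   values u, v of p at the two points. *)
pose (m1 := fun t => 6 * (Re (wp L (zp t)) + Re (wp L (zm t)))).
pose (m2 := fun t => 6 * (Im (wp L (zp t)) + Im (wp L (zm t)))).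
assert (D1 : forall t, 0 <= t < 1 -> is_derive d1 t (e1 t * x - e2 t * y)).
{ intros t Ht. assert (H := is_derive_minus _ _ _ _ _ (proj1 (Dp t Ht)) (proj1 (Dm t Ht))).
  match type of H with is_derive _ _ ?v => replace v with (e1 t * x - e2 t * y) in H end; [exact H|].
  unfold minus, plus, opp; simpl. unfold e1, e2, zp, zm. fold x y. ring. }
assert (D2 : forall t, 0 <= t < 1 -> is_derive d2 t (e2 t * x + e1 t * y)).
{ intros t Ht. assert (H := is_derive_minus _ _ _ _ _ (proj2 (Dp t Ht)) (proj2 (Dm t Ht))).
  match type of H with is_derive _ _ ?v => replace v with (e2 t * x + e1 t * y) in H end; [exact H|].
  unfold minus, plus, opp; simpl. unfold e1, e2, zp, zm. fold x y. ring. }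
assert (Quad : forall u v c : C, Re ((6 * (u * u) - c) - (6 * (v * v) - c))%C =
   6 * (Re u + Re v) * (Re u - Re v) - 6 * (Im u + Im v) * (Im u - Im v) /\
   Im ((6 * (u * u) - c) - (6 * (v * v) - c))%C =
   6 * (Re u + Re v) * (Im u - Im v) + 6 * (Im u + Im v) * (Re u - Re v)).
{ intros [u1 u2] [v1 v2] [c1 c2]. cbn. split; ring. }
assert (O : forall t, 0 <= t < 1 ->
   Re (wp2 L (zp t)) - Re (wp2 L (zm t)) = m1 t * d1 t - m2 t * d2 t /\
   Im (wp2 L (zp t)) - Im (wp2 L (zm t)) = m1 t * d2 t + m2 t * d1 t).
{ intros t Ht. destruct (Quad (wp L (zp t)) (wp L (zm t)) (RtoC (g2 / 2))) as [H1 H2].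
  assert (OP : wp2 L (zp t) = (6 * (wp L (zp t) * wp L (zp t)) - RtoC (g2 / 2))%C)
    by exact (rw_ode a b g2 g3 L HR _ (Hplus t Ht)).
  assert (OM : wp2 L (zm t) = (6 * (wp L (zm t) * wp L (zm t)) - RtoC (g2 / 2))%C)
    by exact (rw_ode a b g2 g3 L HR _ (Hminus t Ht)).
  rewrite <- OP, <- OM in H1, H2.
  exact (conj H1 H2). }
assert (F1 : forall t, 0 <= t < 1 -> is_derive e1 t ((m1 t * d1 t - m2 t * d2 t) * x - (m1 t * d2 t + m2 t * d1 t) * y)).
{ intros t Ht. destruct (O t Ht) as [<- <-].
  assert (H := is_derive_plus _ _ _ _ _ (proj1 (Dp1 t Ht)) (proj1 (Dm1 t Ht))).
  match type of H with is_derive _ _ ?v => replace v with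
    ((Re (wp2 L (zp t)) - Re (wp2 L (zm t))) * x - (Im (wp2 L (zp t)) - Im (wp2 L (zm t))) * y) in H end; [exact H|].
  unfold plus; simpl. unfold zp, zm. fold x y. ring. }
assert (F2 : forall t, 0 <= t < 1 -> is_derive e2 t ((m1 t * d2 t + m2 t * d1 t) * x + (m1 t * d1 t - m2 t * d2 t) * y)).
{ intros t Ht. destruct (O t Ht) as [<- <-].
  assert (H := is_derive_plus _ _ _ _ _ (proj2 (Dp1 t Ht)) (proj2 (Dm1 t Ht))).
  match type of H with is_derive _ _ ?v => replace v with
    ((Im (wp2 L (zp t)) - Im (wp2 L (zm t))) * x + (Re (wp2 L (zp t)) - Re (wp2 L (zm t))) * y) in H end; [exact H|].
  unfold plus; simpl. unfold zp, zm. fold x y. ring. }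
pose (E := fun t => d1 t ^ 2 + d2 t ^ 2 + e1 t ^ 2 + e2 t ^ 2).
pose (dE := fun t => 2 * (d1 t * (e1 t * x - e2 t * y) + d2 t * (e2 t * x + e1 t * y)
       + e1 t * ((m1 t * d1 t - m2 t * d2 t) * x - (m1 t * d2 t + m2 t * d1 t) * y)
       + e2 t * ((m1 t * d2 t + m2 t * d1 t) * x + (m1 t * d1 t - m2 t * d2 t) * y))).
assert (HE : forall t, 0 <= t < 1 -> is_derive E t (dE t)).
{ intros t Ht. unfold E. specialize (D1 t Ht). specialize (D2 t Ht). specialize (F1 t Ht). specialize (F2 t Ht).
  assert (P1 := is_derive_pow d1 2 t _ D1). assert (P2 := is_derive_pow d2 2 t _ D2).
  assert (P3 := is_derive_pow e1 2 t _ F1). assert (P4 := is_derive_pow e2 2 t _ F2).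
  assert (H := is_derive_plus _ _ _ _ _ (is_derive_plus _ _ _ _ _ (is_derive_plus _ _ _ _ _ P1 P2) P3) P4).
  match type of H with is_derive _ _ ?v => replace v with (dE t) in H end; [exact H|].
  unfold plus; simpl. unfold dE. ring. }
(* [m1] and [m2] are bounded on closed intervals, so the argument stops at [s0], short of the pole
   met at parameter 1. *)
pose (s0 := (s + 1) / 2). assert (Hs0 : s < s0 < 1) by (unfold s0; lra).
assert (Cm : forall t, 0 <= t < 1 -> continuous m1 t /\ continuous m2 t).
{ intros t Ht. split.
  - apply (is_derive_continuous_R _ _ _ (is_derive_scal _ _ 6 _ (is_derive_plus _ _ _ _ _ (proj1 (Dp t Ht)) (proj1 (Dm t Ht))))).
  - apply (is_derive_continuous_R _ _ _ (is_derive_scal _ _ 6 _ (is_derive_plus _ _ _ _ _ (proj2 (Dp t Ht)) (proj2 (Dm t Ht))))). }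
destruct (continuous_bounded m1 0 s0 ltac:(lra)) as [M1 [HM1 B1]]; [intros t Ht; apply Cm; lra|].
destruct (continuous_bounded m2 0 s0 ltac:(lra)) as [M2 [HM2 B2]]; [intros t Ht; apply Cm; lra|].
assert (HE0 : E 0 = 0).
{ unfold E, d1, d2, e1, e2. replace (zp 0) with z1; [replace (zm 0) with z1; [rewrite Hcrit; cbn; ring|]|].
  - unfold zm, x, y. destruct z1; cbn. f_equal; ring.
  - unfold zp, x, y. destruct z1; cbn. f_equal; ring. }
assert (Hzero : E s = 0).
{ apply (gronwall_zero E dE 0 s0 (4 * (Rabs x + Rabs y) + 8 * ((M1 + M2) * (Rabs x + Rabs y)))).
  - intros t Ht. apply HE. lra.
  - intros t Ht. assert (A1 := Rabs_pos x). assert (A2 := Rabs_pos y).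
    assert (A3 := B1 t ltac:(lra)). assert (A4 := B2 t ltac:(lra)). apply energy_bound; lra.
  - intros t _. unfold E. repeat apply Rplus_le_le_0_compat; apply pow2_ge_0.
  - intros eps Heps. destruct (continuous_eps E 0 eps) as [d [Hd H]]; [|exact Heps|].
    + eapply is_derive_continuous_R. apply HE. lra.
    + exists d. split; [exact Hd|]. intros t Ht Htd. specialize (H t ltac:(apply Rabs_def1; lra)).
      rewrite HE0 in H. apply Rabs_def2 in H. lra.
  - lra. }
assert (Sq : forall u : R, 0 <= u ^ 2) by (intros; apply pow2_ge_0).
assert (Z : d1 s ^ 2 = 0 /\ d2 s ^ 2 = 0).
{ generalize (Sq (d1 s)), (Sq (d2 s)), (Sq (e1 s)), (Sq (e2 s)). unfold E in Hzero. lra. }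
destruct Z as [Z1 Z2]. unfold d1 in Z1. unfold d2 in Z2.
assert (Y1 : Re (wp L (zp s)) - Re (wp L (zm s)) = 0) by nra.
assert (Y2 : Im (wp L (zp s)) - Im (wp L (zm s)) = 0) by nra.
unfold Re, Im in *. apply injective_projections; lra.
Qed.

(** As s tends to 1, one reflected point runs into the pole 0 and the other into 2 z1, so p is
    unbounded near 2 z1. *)
Lemma critical_point_double : L (z1 + z1)%C.
Proof.
apply NNPP. intros Hn.
destruct (qdiff_Lipschitz _ _ _ (rw_d0 a b g2 g3 L HR _ Hn)) as [d [K [Hd [HK H]]]].
set (w := Cmod (wp L (z1 + z1)%C)) in *.
destruct (wp_blowup a b g2 g3 L HR (w + K * d)) as [d' [Hd' H']].
assert (Hz := Cmod_ge_0 z1).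
assert (Hz0 : z1 <> 0).
{ intros E0. apply Hn. rewrite E0. replace (0 + 0)%C with (RtoC 0) by ring. apply (dg_0 (rw_dg HR)). }
assert (Hzpos : 0 < Cmod z1) by (apply Cmod_gt_0; exact Hz0).
pose (t := Rmin (/ 2) (Rmin (d / (2 * Cmod z1)) (d' / (2 * Cmod z1)))).
assert (L1 : t <= / 2) by apply Rmin_l.
assert (L2 : t <= Rmin (d / (2 * Cmod z1)) (d' / (2 * Cmod z1))) by apply Rmin_r.
assert (L3 := Rmin_l (d / (2 * Cmod z1)) (d' / (2 * Cmod z1))).
assert (L4 := Rmin_r (d / (2 * Cmod z1)) (d' / (2 * Cmod z1))).
assert (Ht : 0 < t) by (repeat apply Rmin_glb_lt; try lra; apply Rdiv_lt_0_compat; lra).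
assert (L5 : t <= d / (2 * Cmod z1)) by lra. assert (L6 : t <= d' / (2 * Cmod z1)) by lra.
apply Rle_div_r in L5; [|lra]. apply Rle_div_r in L6; [|lra].
assert (R := wp_reflect (1 - t) ltac:(lra)).
replace (zp (1 - t)) with (z1 + z1 + - t * z1)%C in R
  by (unfold zp, x, y; destruct z1; apply injective_projections; cbn; ring).
replace (zm (1 - t)) with (t * z1)%C in R
  by (unfold zm, x, y; destruct z1; apply injective_projections; cbn; ring).
assert (Ct : Cmod (t * z1) = t * Cmod z1) by (rewrite Cmod_mult, Cmod_R, Rabs_right by lra; reflexivity).
assert (Ct' : Cmod (- t * z1) = t * Cmod z1) by (rewrite Cmod_mult, Cmod_opp, Cmod_R, Rabs_right by lra; reflexivity).
specialize (H (- t * z1)%C ltac:(rewrite Ct'; lra)).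
assert (Hne : (t * z1)%C <> 0) by (apply Cmod_gt_0; rewrite Ct; apply Rmult_lt_0_compat; lra).
specialize (H' _ Hne ltac:(rewrite Ct; lra)).
rewrite <- R in H'. rewrite Ct' in H.
generalize (Cmod_triangle (wp L (z1 + z1)) (wp L (z1 + z1 + - t * z1) - wp L (z1 + z1))).
replace (wp L (z1 + z1) + (wp L (z1 + z1 + - t * z1) - wp L (z1 + z1)))%C
  with (wp L (z1 + z1 + - t * z1)%C) by ring. fold w.
assert (K * (t * Cmod z1) <= K * d) by (apply Rmult_le_compat_l; lra). lra.
Qed.

End Reflection.

(** The critical point omega + i V would make its double a lattice point, although 0 < 2 V < b. *)
Lemma wp1_mid_no_early_zero (a b g2 g3 : R) (L : C -> Prop) (V : R) :
  rect_wp a b g2 g3 L -> 0 < V < b / 2 -> wp1_mid a L V = 0 -> False.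
Proof.
intros HR HV HQ. assert (Ha := rw_a HR).
assert (Hc : wp1 L (a / 2, V) = 0).
{ assert (H := Re_wp1_middle a b g2 g3 L HR V). unfold wp1_mid in HQ. unfold Re, Im in *.
  apply injective_projections; unfold RtoC; cbn [fst snd]; lra. }
assert (H := critical_point_double a b g2 g3 L HR (a / 2, V) Hc).
cbn [fst snd] in H.
assert (Hd : L (a / 2 + a / 2, V + V)).
{ apply H.
  - intros s Hs. apply (rw_inside a b g2 g3 L HR). nra.
  - intros s Hs. apply (rw_inside a b g2 g3 L HR). nra. }
revert Hd. apply (rw_not_multiple_im a b g2 g3 L HR _ _ 0). lra.
Qed.

(** * The hypergeometric integrand *)

Definition hcoef (a b c : R) (n : nat) : R :=
  pochhammer a n * pochhammer b n / (pochhammer c n * INR (Factorial.fact n)).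

Arguments hcoef : simpl never.

Lemma pochhammer_pos (a : R) (n : nat) : 0 < a -> 0 < pochhammer a n.
Proof.
intros Ha. induction n as [|n IH]; cbn [pochhammer]; [lra|].
assert (Hn := pos_INR n). apply Rmult_lt_0_compat; lra.
Qed.

Lemma INR_fact_pos (n : nat) : 0 < INR (Factorial.fact n).
Proof. apply INR_fact_lt_0. Qed.

Lemma hcoef_pos (a b c : R) (n : nat) : 0 < a -> 0 < b -> 0 < c -> 0 < hcoef a b c n.
Proof.
intros. unfold hcoef. apply Rdiv_lt_0_compat; apply Rmult_lt_0_compat;
  auto using pochhammer_pos, INR_fact_pos.
Qed.

Lemma hcoef_S (a b c : R) (n : nat) : 0 < c ->
  hcoef a b c (S n) * ((c + INR n) * (INR n + 1)) = hcoef a b c n * ((a + INR n) * (b + INR n)).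
Proof.
intros Hc. unfold hcoef. rewrite fact_simpl, mult_INR, S_INR. cbn [pochhammer].
assert (H1 := pochhammer_pos c n Hc). assert (H2 := INR_fact_pos n). assert (H3 := pos_INR n).
field. repeat split; lra.
Qed.

(** The two conditions compare (a + n)(b + n) with (c + n)(n + 1) coefficient by coefficient, so
    consecutive coefficients do not increase. *)
Lemma hcoef_le_1 (a b c : R) (n : nat) :
  0 < a -> 0 < b -> 0 < c -> a + b <= c + 1 -> a * b <= c -> hcoef a b c n <= 1.
Proof.
intros Ha Hb Hc H1 H2. induction n as [|n IH].
- unfold hcoef; cbn. lra.
- assert (E := hcoef_S a b c n Hc). assert (H0 := hcoef_pos a b c (S n) Ha Hb Hc).
  assert (H0' := hcoef_pos a b c n Ha Hb Hc). assert (Hn := pos_INR n).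
  assert (Hle : (a + INR n) * (b + INR n) <= (c + INR n) * (INR n + 1)) by nra.
  assert (Hp : 0 < (c + INR n) * (INR n + 1)) by (apply Rmult_lt_0_compat; lra).
  apply (Rmult_le_reg_r ((c + INR n) * (INR n + 1))); [exact Hp|]. rewrite E. nra.
Qed.

Lemma CV_radius_ge_1 (a : nat -> R) : (forall n, Rabs (a n) <= 1) -> Rbar_le 1 (CV_radius a).
Proof.
intros H. destruct (CV_radius_bounded a) as [H1 _]. apply (H1 1).
exists 1. intros n. rewrite pow1, Rmult_1_r. apply H.
Qed.

Lemma hcoef_radius (a b c x : R) :
  0 < a -> 0 < b -> 0 < c -> a + b <= c + 1 -> a * b <= c -> Rabs x < 1 ->
  Rbar_lt (Rabs x) (CV_radius (hcoef a b c)).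
Proof.
intros. apply Rbar_lt_le_trans with 1; [exact H4|]. apply CV_radius_ge_1. intros n.
rewrite Rabs_right; [now apply hcoef_le_1|]. left. now apply hcoef_pos.
Qed.

Lemma Series_zero : Series (fun _ => 0) = 0.
Proof.
rewrite (Series_ext _ (fun _ => 0 * 0)) by (intros; ring). rewrite Series_scal_l. ring.
Qed.

Local Notation hc := (hcoef (1 / 3) (2 / 3) (1 / 2)).
Local Notation hd := (hcoef (1 / 3) (2 / 3) 1).

Lemma hc_radius (x : R) : Rabs x < 1 -> Rbar_lt (Rabs x) (CV_radius hc).
Proof. intros. apply hcoef_radius; lra. Qed.

(** Gauss's differential equation with a + b + 1 = 2 and a b = 2/9; coefficientwise it is the
    recurrence [hcoef_S]. *)
Lemma hc_equation (x : R) : Rabs x < 1 ->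
  x * (1 - x) * PSeries (PS_derive (PS_derive hc)) x
  + (1 / 2 - 2 * x) * PSeries (PS_derive hc) x - 2 / 9 * PSeries hc x = 0.
Proof.
intros Hx. assert (H0 := hc_radius x Hx).
assert (S0 : is_pseries hc x (PSeries hc x)) by (apply PSeries_correct, CV_radius_inside, H0).
assert (S1 : is_pseries (PS_derive hc) x (PSeries (PS_derive hc) x))
  by (apply PSeries_correct, CV_radius_inside; rewrite CV_radius_derive; exact H0).
assert (S2 : is_pseries (PS_derive (PS_derive hc)) x (PSeries (PS_derive (PS_derive hc)) x))
  by (apply PSeries_correct, CV_radius_inside; rewrite !CV_radius_derive; exact H0).
set (f0 := PSeries hc x) in *. set (f1 := PSeries (PS_derive hc) x) in *.
set (f2 := PSeries (PS_derive (PS_derive hc)) x) in *.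
assert (T1 := is_pseries_incr_1 _ _ _ S1).
assert (T2 := is_pseries_incr_1 _ _ _ S2).
assert (T3 := is_pseries_incr_1 _ _ _ T2).
assert (com : forall n : R, mult x n = mult n x) by (intros; apply Rmult_comm).
assert (comc : forall c : R, mult x c = mult c x) by (intros; apply Rmult_comm).
assert (HS := is_pseries_plus _ _ _ _ _ (is_pseries_plus _ _ _ _ _ T2 (is_pseries_scal (- (1)) _ _ _ (com _) T3))
  (is_pseries_plus _ _ _ _ _ (is_pseries_plus _ _ _ _ _ (is_pseries_scal (1 / 2) _ _ _ (com _) S1)
    (is_pseries_scal (- (2)) _ _ _ (com _) T1)) (is_pseries_scal (- (2 / 9)) _ _ _ (com _) S0))).
match type of HS with is_pseries ?s _ ?l =>
  assert (Hz : forall n, s n = 0); [|assert (El : l = 0)] end.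
- intros n. unfold PS_plus, PS_scal, PS_incr_1, PS_derive. cbn beta iota.
  unfold plus, scal, zero; simpl; unfold mult; simpl.
  destruct n as [|n].
  + assert (E := hcoef_S (1 / 3) (2 / 3) (1 / 2) 0 ltac:(lra)). simpl in E |- *. lra.
  + assert (E := hcoef_S (1 / 3) (2 / 3) (1 / 2) (S n) ltac:(lra)).
    destruct n as [|n].
    * simpl in E |- *. lra.
    * change (match n with 0%nat => 1 | S _ => INR n + 1 end) with (INR (S n)).
      rewrite !S_INR in *. lra.
- rewrite <- (is_pseries_unique _ _ _ HS). unfold PSeries.
  rewrite (Series_ext _ (fun _ => 0)); [apply Series_zero|].
  intros n. rewrite Hz. apply Rmult_0_l.
- unfold plus, scal, zero in El; simpl in El; unfold mult in El; simpl in El. lra.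
Qed.

Lemma hc_at_0 : PSeries hc 0 = 1.
Proof. rewrite PSeries_0. unfold hcoef; cbn. lra. Qed.

Lemma sin_sqr_lt_1 (z : R) : - PI / 2 < z < PI / 2 -> Rabs (sin z ^ 2) < 1.
Proof.
intros Hz. assert (Hc := cos_gt_0 z ltac:(lra) ltac:(lra)).
assert (E := sin2_cos2 z). unfold Rsqr in E. rewrite Rabs_right; nra.
Qed.

(* [r z = f (sin z ^ 2) * cos z] solves [r'' = - r / 9] with [r 0 = 1], [r' 0 = 0]. *)
Lemma hc_closed_form (z : R) : - PI / 2 < z < PI / 2 ->
  PSeries hc (sin z ^ 2) * cos z = cos (z / 3).
Proof.
assert (HPI := PI_RGT_0).
pose (f0 := PSeries hc). pose (f1 := PSeries (PS_derive hc)). pose (f2 := PSeries (PS_derive (PS_derive hc))).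
assert (D0 : forall x, Rabs x < 1 -> is_derive f0 x (f1 x)).
{ intros x Hx. apply is_derive_PSeries, hc_radius, Hx. }
assert (D1 : forall x, Rabs x < 1 -> is_derive f1 x (f2 x)).
{ intros x Hx. apply is_derive_PSeries. rewrite CV_radius_derive. apply hc_radius, Hx. }
pose (r := fun z => f0 (sin z ^ 2) * cos z).
pose (r1 := fun z => f1 (sin z ^ 2) * (2 * sin z * cos z ^ 2) - f0 (sin z ^ 2) * sin z).
assert (Dr : forall z, - PI / 2 < z < PI / 2 -> is_derive r z (r1 z)).
{ intros x Hx. unfold r, r1. assert (Hs := sin_sqr_lt_1 x Hx).
  assert (Df := is_derive_comp f0 (fun z => sin z ^ 2) x _ (2 * sin x * cos x) (D0 _ Hs)
     ltac:(auto_derive; [auto|ring])).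
  assert (Dm := is_derive_mult (fun z => f0 (sin z ^ 2)) cos x _ (- sin x) Df (is_derive_cos x) Rmult_comm).
  unfold plus, mult, scal in Dm; simpl in Dm; unfold mult in Dm; simpl in Dm.
  replace (f1 (sin x ^ 2) * (2 * sin x * cos x ^ 2) - f0 (sin x ^ 2) * sin x) with
    (2 * sin x * cos x * f1 (sin x * (sin x * 1)) * cos x + f0 (sin x * (sin x * 1)) * - sin x)
    by (simpl; ring).
  exact Dm. }
assert (Dr1 : forall z, - PI / 2 < z < PI / 2 -> is_derive r1 z (- r z / 9)).
{ intros x Hx. unfold r, r1. assert (Hs := sin_sqr_lt_1 x Hx).
  assert (Df := is_derive_comp f0 (fun z => sin z ^ 2) x _ (2 * sin x * cos x) (D0 _ Hs)
     ltac:(auto_derive; [auto|ring])).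
  assert (Df1 := is_derive_comp f1 (fun z => sin z ^ 2) x _ (2 * sin x * cos x) (D1 _ Hs)
     ltac:(auto_derive; [auto|ring])).
  assert (Dm := is_derive_mult (fun z => f0 (sin z ^ 2)) sin x _ (cos x) Df (is_derive_sin x) Rmult_comm).
  assert (Dm1 := is_derive_mult (fun z => f1 (sin z ^ 2)) (fun z => 2 * sin z * cos z ^ 2) x _
     (2 * cos x ^ 3 - 4 * sin x ^ 2 * cos x) Df1 ltac:(auto_derive; [auto|ring]) Rmult_comm).
  assert (Dd := is_derive_minus _ _ _ _ _ Dm1 Dm).
  unfold minus, opp, plus, mult, scal in Dd; simpl in Dd; unfold mult in Dd; simpl in Dd.
  assert (E := hc_equation (sin x ^ 2) Hs). fold f0 f1 f2 in E.
  replace (- (f0 (sin x ^ 2) * cos x) / 9) with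
    (2 * sin x * cos x * f2 (sin x * (sin x * 1)) * (2 * sin x * (cos x * (cos x * 1))) +
     f1 (sin x * (sin x * 1)) * (2 * (cos x * (cos x * (cos x * 1))) - 4 * (sin x * (sin x * 1)) * cos x) +
     - (2 * sin x * cos x * f1 (sin x * (sin x * 1)) * sin x + f0 (sin x * (sin x * 1)) * cos x)).
  - exact Dd.
  - change (sin x * (sin x * 1)) with (sin x ^ 2).
    set (F2 := f2 (sin x ^ 2)) in *. set (F1 := f1 (sin x ^ 2)) in *. set (F0 := f0 (sin x ^ 2)) in *.
    assert (C : cos x ^ 2 = 1 - sin x ^ 2).
    { generalize (sin2_cos2 x). unfold Rsqr. intros. nra. }
    replace (2 * sin x * cos x * F2 * (2 * sin x * (cos x * (cos x * 1))) +
      F1 * (2 * (cos x * (cos x * (cos x * 1))) - 4 * sin x ^ 2 * cos x) +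
      - (2 * sin x * cos x * F1 * sin x + F0 * cos x))
    with (cos x * (4 * sin x ^ 2 * cos x ^ 2 * F2 + (2 * cos x ^ 2 - 6 * sin x ^ 2) * F1 - F0)) by ring.
    rewrite C.
    replace (4 * sin x ^ 2 * (1 - sin x ^ 2) * F2 + (2 * (1 - sin x ^ 2) - 6 * sin x ^ 2) * F1 - F0)
      with (4 * (sin x ^ 2 * (1 - sin x ^ 2) * F2 + (1 / 2 - 2 * sin x ^ 2) * F1 - 2 / 9 * F0) - F0 / 9) by field.
    rewrite E. field. }
(* Variation of constants: [al] and [be] are the coordinates of the solution with respect to cos
   (z/3) and sin (z/3), hence constant. *)
pose (al := fun z => r z * cos (z / 3) - 3 * r1 z * sin (z / 3)).
pose (be := fun z => r z * sin (z / 3) + 3 * r1 z * cos (z / 3)).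
assert (Dc : forall x, is_derive (fun z => cos (z / 3)) x (- sin (x / 3) / 3)).
{ intros x. auto_derive; [auto|]. unfold Rdiv. field. }
assert (Ds : forall x, is_derive (fun z => sin (z / 3)) x (cos (x / 3) / 3)).
{ intros x. auto_derive; [auto|]. unfold Rdiv. field. }
assert (Dal : forall x, - PI / 2 < x < PI / 2 -> is_derive al x 0).
{ intros x Hx. assert (A1 := is_derive_mult _ _ x _ _ (Dr x Hx) (Dc x) Rmult_comm).
  assert (A2 := is_derive_mult _ _ x _ _ (is_derive_scal _ x 3 _ (Dr1 x Hx)) (Ds x) Rmult_comm).
  assert (A := is_derive_minus _ _ _ _ _ A1 A2).
  unfold minus, opp, plus, mult, scal in A; simpl in A; unfold mult in A; simpl in A.
  match type of A with is_derive _ _ ?v => replace v with 0 in A end; [exact A|]. simpl. field. }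
assert (Dbe : forall x, - PI / 2 < x < PI / 2 -> is_derive be x 0).
{ intros x Hx. assert (A1 := is_derive_mult _ _ x _ _ (Dr x Hx) (Ds x) Rmult_comm).
  assert (A2 := is_derive_mult _ _ x _ _ (is_derive_scal _ x 3 _ (Dr1 x Hx)) (Dc x) Rmult_comm).
  assert (A := is_derive_plus _ _ _ _ _ A1 A2).
  unfold minus, opp, plus, mult, scal in A; simpl in A; unfold mult in A; simpl in A.
  match type of A with is_derive _ _ ?v => replace v with 0 in A end; [exact A|]. simpl. field. }
assert (H00 : al 0 = 1 /\ be 0 = 0).
{ unfold al, be, r, r1. replace (0 / 3) with 0 by field. rewrite cos_0, sin_0.
  replace (0 ^ 2) with 0 by ring. unfold f0. rewrite hc_at_0. split; ring. }
intros Hz.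
assert (Hal : al z = 1).
{ destruct H00 as [<- _]. destruct (Rle_dec 0 z).
  - symmetry. apply constant_of_derive_0; [assumption|]. intros x Hx. apply Dal. lra.
  - apply constant_of_derive_0; [lra|]. intros x Hx. apply Dal. lra. }
assert (Hbe : be z = 0).
{ destruct H00 as [_ <-]. destruct (Rle_dec 0 z).
  - symmetry. apply constant_of_derive_0; [assumption|]. intros x Hx. apply Dbe. lra.
  - apply constant_of_derive_0; [lra|]. intros x Hx. apply Dbe. lra. }
fold f0. fold (r z).
assert (C := sin2_cos2 (z / 3)). unfold Rsqr in C.
replace (r z) with (al z * cos (z / 3) + be z * sin (z / 3)).
- rewrite Hal, Hbe. ring.
- unfold al, be. transitivity (r z * (sin (z / 3) * sin (z / 3) + cos (z / 3) * cos (z / 3))); [ring|].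
  rewrite C. ring.
Qed.

(** Integration by parts. The boundary terms cancel over any interval of length PI; the starting
    points 0 and -PI/2 serve the real and the imaginary period. *)
Lemma wallis (a : R) (n : nat) :
  is_RInt (fun t => (sin t ^ 2) ^ n) a (a + PI) (PI * (pochhammer (1 / 2) n / INR (Factorial.fact n))).
Proof.
induction n as [|n IH].
- replace (PI * (pochhammer (1 / 2) 0 / INR (Factorial.fact 0))) with (scal (a + PI - a) 1).
  + apply (is_RInt_const a (a + PI) 1).
  + unfold scal; simpl; unfold mult; simpl. field.
- pose (F := fun t => - cos t * (sin t * (sin t ^ 2) ^ n)).
  pose (dF := fun t => (2 * INR n + 2) * (sin t ^ 2) ^ S n - (2 * INR n + 1) * (sin t ^ 2) ^ n).
  assert (DF : forall t, is_derive F t (dF t)).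
  { intros t. unfold F, dF. auto_derive; [auto|].
    assert (C : cos t * cos t = 1 - sin t * sin t) by (generalize (sin2_cos2 t); unfold Rsqr; lra).
    destruct n as [|n].
    - simpl. nra.
    - rewrite S_INR. cbn [pred]. set (X := (sin t ^ 2) ^ n).
      replace ((sin t ^ 2) ^ S (S n)) with (sin t ^ 4 * X) by (unfold X; simpl; ring).
      replace ((sin t ^ 2) ^ S n) with (sin t ^ 2 * X) by (unfold X; simpl; ring).
      replace ((sin t * (sin t * 1)) ^ n) with X by reflexivity.
      replace ((sin t * (sin t * 1)) ^ S n) with (sin t ^ 2 * X) by (unfold X; simpl; ring).
      ring_simplify. replace (cos t ^ 2) with (1 - sin t ^ 2) by (simpl; lra). ring. }
  assert (HI : is_RInt dF a (a + PI) (minus (F (a + PI)) (F a))).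
  { apply (is_RInt_derive (V := R_CompleteNormedModule) F).
    - intros t _. apply DF.
    - intros t _. apply (ex_derive_continuous (V := R_NormedModule)). unfold dF. auto_derive. auto. }
  assert (E0 : minus (F (a + PI)) (F a) = 0).
  { unfold F. rewrite neg_cos, neg_sin. replace ((- sin a) ^ 2) with (sin a ^ 2) by ring.
    unfold minus, plus, opp; simpl. ring. }
  rewrite E0 in HI. assert (Hn := pos_INR n).
  assert (H2 := is_RInt_scal (V := R_NormedModule) _ _ _ (/ (2 * INR n + 2)) _
    (is_RInt_plus (V := R_NormedModule) _ _ _ _ _ _ HI (is_RInt_scal (V := R_NormedModule) _ _ _ (2 * INR n + 1) _ IH))).
  unfold scal, plus in H2; simpl in H2; unfold mult in H2; simpl in H2.
  replace (PI * (pochhammer (1 / 2) (S n) / INR (Factorial.fact (S n)))) with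
    (/ (2 * INR n + 2) * (0 + (2 * INR n + 1) * (PI * (pochhammer (1 / 2) n / INR (Factorial.fact n))))).
  + eapply is_RInt_ext; [|exact H2]. intros t _. unfold dF. simpl. field. lra.
  + rewrite fact_simpl, mult_INR, S_INR. cbn [pochhammer]. assert (H := INR_fact_pos n). field. lra.
Qed.

Definition arc_speed (k t : R) : R := cos (asin (k * sin t) / 3) / cos (asin (k * sin t)).

Lemma abs_k_sin (k t : R) : 0 < k < 1 -> -1 < k * sin t < 1.
Proof. intros Hk. generalize (SIN_bound t). nra. Qed.

Lemma asin_range (x : R) : -1 < x < 1 -> - PI / 2 < asin x < PI / 2.
Proof. intros Hx. generalize (asin_bound_lt x Hx). lra. Qed.

Lemma cos_asin_pos (x : R) : -1 < x < 1 -> 0 < cos (asin x).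
Proof. intros Hx. assert (H := asin_range x Hx). apply cos_gt_0; lra. Qed.

Lemma arc_speed_series (k t : R) : 0 < k < 1 -> arc_speed k t = PSeries hc (k ^ 2 * sin t ^ 2).
Proof.
intros Hk. assert (H := abs_k_sin k t Hk). assert (Hr := asin_range _ H).
assert (E := hc_closed_form _ Hr). rewrite sin_asin in E by lra.
assert (Hc := cos_asin_pos _ H). unfold arc_speed. rewrite <- E.
replace ((k * sin t) ^ 2) with (k ^ 2 * sin t ^ 2) by ring. field. lra.
Qed.

Lemma pochhammer_1 (n : nat) : pochhammer 1 n = INR (Factorial.fact n).
Proof.
induction n as [|n IH]; [reflexivity|]. rewrite fact_simpl, mult_INR, S_INR. cbn [pochhammer].
rewrite IH. ring.
Qed.

(** Wallis's factor (1/2)_n / n! replaces (1/2)_n by (1)_n = n! in the denominator, which turns the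
    third parameter 1/2 into 1. *)
Lemma arc_speed_integral (k a : R) : 0 < k < 1 ->
  is_RInt (arc_speed k) a (a + PI) (PI * hypergeom (1 / 3) (2 / 3) 1 (k ^ 2)).
Proof.
intros Hk. set (X := k ^ 2). assert (HX : 0 < X < 1) by (unfold X; nra).
assert (Hx : forall t, 0 <= X * sin t ^ 2 <= X).
{ intros t. generalize (SIN_bound t). intros. assert (0 <= sin t ^ 2 <= 1) by nra. nra. }
assert (Hex : forall x, 0 <= x <= X -> ex_series (fun n => hc n * x ^ n)).
{ intros x Hx'. apply ex_pseries_R, CV_radius_inside, hc_radius. rewrite Rabs_right; lra. }
assert (Hexd : ex_series (fun n => hd n * X ^ n)).
{ apply ex_pseries_R, CV_radius_inside, hcoef_radius; try lra. rewrite Rabs_right; lra. }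
pose (S := (fun N t => sum_n (fun n => hc n * (X * sin t ^ 2) ^ n) N) : nat -> R -> R).
pose (I := (fun N => sum_n (fun n => PI * (hd n * X ^ n)) N) : nat -> R).
assert (HS : forall N, is_RInt (S N) a (a + PI) (I N)).
{ assert (Hterm : forall n, is_RInt (fun t => hc n * (X * sin t ^ 2) ^ n) a (a + PI) (PI * (hd n * X ^ n))).
  { intros n. assert (H := is_RInt_scal (V := R_NormedModule) _ _ _ (hc n * X ^ n) _ (wallis a n)).
    unfold scal in H; simpl in H; unfold mult in H; simpl in H.
    replace (PI * (hd n * X ^ n)) with (hc n * X ^ n * (PI * (pochhammer (1 / 2) n / INR (Factorial.fact n)))).
    - eapply is_RInt_ext; [|exact H]. intros t _. change (hc n * X ^ n * (sin t ^ 2) ^ n = hc n * (X * sin t ^ 2) ^ n). rewrite (Rpow_mult_distr X). ring.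
    - unfold hcoef. rewrite pochhammer_1. assert (H1 := INR_fact_pos n).
      assert (H2 := pochhammer_pos (1 / 2) n ltac:(lra)). field. lra. }
  induction N as [|N IH].
  - unfold S, I. eapply is_RInt_ext; [|rewrite sum_O; apply Hterm]. intros t _. now rewrite sum_O.
  - unfold S, I. rewrite sum_Sn. eapply is_RInt_ext; [|apply (is_RInt_plus (V := R_NormedModule)); [exact IH|apply Hterm]].
    intros t _. unfold S. now rewrite sum_Sn. }
(* The terms are nonnegative and increase with the argument, so the tail at [X] dominates all tails
   at X sin^2 t and the convergence is uniform in [t]. *)
assert (Htail : forall x N, 0 <= x <= X ->
   Rabs (sum_n (fun n => hc n * x ^ n) N - PSeries hc x) <= Series (fun n => hc (Datatypes.S N + n)%nat * X ^ (Datatypes.S N + n))).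
{ intros x N Hx'. unfold PSeries.
  rewrite (Series_incr_n _ (Datatypes.S N)); [|lia|now apply Hex]. cbn [pred].
  rewrite sum_n_Reals.
  match goal with |- Rabs (?s - (?s + ?q)) <= _ => replace (s - (s + q)) with (- q) by ring; rewrite Rabs_Ropp end.
  assert (Hpos : forall n, 0 <= hc (Datatypes.S N + n)%nat * x ^ (Datatypes.S N + n)).
  { intros n. apply Rmult_le_pos; [left; apply hcoef_pos; lra|apply pow_le; lra]. }
  assert (Hle : forall n, hc (Datatypes.S N + n)%nat * x ^ (Datatypes.S N + n) <= hc (Datatypes.S N + n)%nat * X ^ (Datatypes.S N + n)).
  { intros n. apply Rmult_le_compat_l; [left; apply hcoef_pos; lra|apply pow_incr; lra]. }
  rewrite Rabs_right.
  - apply Series_le; [intros n; split; [apply Hpos|apply Hle]|].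
    apply (ex_series_incr_n (fun n => hc n * X ^ n)), Hex. lra.
  - apply Rle_ge. rewrite <- Series_zero. apply Series_le.
    + intros n. split; [lra|apply Hpos].
    + apply (ex_series_incr_n (fun n => hc n * x ^ n)), Hex, Hx'. }
assert (Hlim : filterlim S eventually (locally (arc_speed k : fct_UniformSpace R R_UniformSpace))).
{ apply (filterlim_locally (U := fct_UniformSpace R R_UniformSpace)). intros eps.
  assert (HT : is_lim_seq (fun N => PSeries hc X - sum_n (fun n => hc n * X ^ n) N) 0).
  { replace (Finite 0) with (Finite (PSeries hc X - PSeries hc X)) by (f_equal; ring).
    apply is_lim_seq_minus'; [apply is_lim_seq_const|].
    apply (Series_correct (fun n => hc n * X ^ n)), Hex. lra. }
  apply is_lim_seq_spec in HT. destruct (HT eps) as [N0 HN0].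
  exists N0. intros N HN t. specialize (HN0 N HN).
  cbv [ball]; simpl; unfold AbsRing_ball; simpl; unfold abs, minus, plus, opp; simpl.
  rewrite arc_speed_series by exact Hk. fold X.
  eapply Rle_lt_trans; [apply Htail, Hx|].
  rewrite Rminus_0_r in HN0. apply Rabs_def2 in HN0.
  unfold PSeries in HN0. rewrite (Series_incr_n _ (Datatypes.S N)) in HN0; [|lia|apply Hex; lra].
  cbn [pred] in HN0. rewrite sum_n_Reals in HN0. lra. }
destruct (filterlim_RInt S a (a + PI) eventually eventually_filter (arc_speed k) I HS Hlim) as [If [H1 H2]].
replace (PI * hypergeom (1 / 3) (2 / 3) 1 X) with If; [exact H2|].
assert (Eh : hypergeom (1 / 3) (2 / 3) 1 X = Series (fun n => hd n * X ^ n)) by reflexivity.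
rewrite Eh.
assert (HI : is_lim_seq I (PI * Series (fun n => hd n * X ^ n))).
{ apply (is_lim_seq_ext (fun N => PI * sum_n (fun n => hd n * X ^ n) N)).
  - intros N. symmetry. apply (sum_n_mult_l (K := R_Ring)).
  - apply (is_lim_seq_scal_l _ PI (Series (fun n => hd n * X ^ n))), (Series_correct _ Hexd). }
assert (E1 := is_lim_seq_unique I If H1). assert (E2 := is_lim_seq_unique _ _ HI).
rewrite E1 in E2. now injection E2.
Qed.

(** * The real period *)

Lemma is_derive_asin (x : R) : -1 < x < 1 -> is_derive asin x (/ cos (asin x)).
Proof.
intros Hx. rewrite cos_asin by lra. apply is_derive_Reals.
assert (H := derive_pt_asin x Hx).
replace (/ sqrt (1 - Rsqr x)) with (derive_pt asin x (derivable_pt_asin x Hx))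
  by (rewrite H; unfold Rdiv; ring).
exact (proj2_sig (derivable_pt_asin x Hx)).
Qed.

Lemma is_derive_asin_sin (k t : R) : 0 < k < 1 ->
  is_derive (fun t => asin (k * sin t)) t (k * cos t / cos (asin (k * sin t))).
Proof.
intros Hk. assert (H := abs_k_sin k t Hk).
assert (D := is_derive_comp asin (fun t => k * sin t) t _ (k * cos t) (is_derive_asin _ H)
  ltac:(auto_derive; [auto|ring])).
exact D.
Qed.

Lemma cos_asin_sin_pos (k t : R) : 0 < k < 1 -> 0 < cos (asin (k * sin t)).
Proof. intros Hk. apply cos_asin_pos, abs_k_sin, Hk. Qed.

Lemma sin_3a (x : R) : sin (3 * x) = 3 * sin x - 4 * sin x ^ 3.
Proof.
replace (3 * x) with (2 * x + x) by ring. rewrite sin_plus, sin_2a, cos_2a_sin.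
assert (C := sin2_cos2 x). unfold Rsqr in C.
transitivity (2 * sin x * (cos x * cos x) + (1 - 2 * sin x * sin x) * sin x); [ring|].
replace (cos x * cos x) with (1 - sin x * sin x) by lra. ring.
Qed.

Lemma cos_3a_sin (x : R) : cos (3 * x) = cos x * (1 - 4 * sin x ^ 2).
Proof.
replace (3 * x) with (2 * x + x) by ring. rewrite cos_plus, sin_2a, cos_2a_sin. ring.
Qed.

Section CubicModulus.

Context (k : R) (Hk : 0 < k < 1).

Let z (t : R) : R := asin (k * sin t).
Definition sk (t : R) : R := sin (asin (k * sin t) / 3).
Definition ck (t : R) : R := cos (asin (k * sin t) / 3).

Lemma z_range (t : R) : - PI / 2 < z t < PI / 2.
Proof. apply asin_range, abs_k_sin, Hk. Qed.

Lemma ck_pos (t : R) : 0 < ck t.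
Proof. assert (H := z_range t). assert (HPI := PI_RGT_0). unfold z in H. apply cos_gt_0; lra. Qed.

Lemma sk_triple (t : R) : k * sin t = 3 * sk t - 4 * sk t ^ 3.
Proof.
unfold sk. rewrite <- sin_3a. replace (3 * (asin (k * sin t) / 3)) with (asin (k * sin t)) by field.
assert (H := abs_k_sin k t Hk). rewrite sin_asin; lra.
Qed.

(** This is cos (3 x) = cos x (1 - 4 sin^2 x) at x = z/3. So dt/du is 1 - 4 sin^2 (z/3), in
    agreement with dn3 being the derivative of the inverse of [arc]. *)
Lemma arc_speed_sk (t : R) : arc_speed k t * (1 - 4 * sk t ^ 2) = 1.
Proof.
assert (Hc := cos_asin_sin_pos k t Hk). assert (Hp := ck_pos t).
assert (E : cos (asin (k * sin t)) = ck t * (1 - 4 * sk t ^ 2)).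
{ unfold ck, sk. rewrite <- cos_3a_sin. f_equal. field. }
unfold arc_speed. fold (ck t). rewrite E in *. assert (H : 1 - 4 * sk t ^ 2 <> 0) by (intros H; rewrite H in Hc; lra).
field. split; [exact H|lra].
Qed.

Lemma arc_speed_pos (t : R) : 0 < arc_speed k t.
Proof. apply Rdiv_lt_0_compat; [apply ck_pos|apply cos_asin_sin_pos, Hk]. Qed.

Lemma derive_sk (t : R) : is_derive sk t (arc_speed k t * (k * cos t / 3)).
Proof.
assert (Hc := cos_asin_sin_pos k t Hk).
assert (D := is_derive_comp (fun z => sin (z / 3)) (fun t => asin (k * sin t)) t (ck t / 3) _
  ltac:(unfold ck; auto_derive; [auto|unfold Rdiv; field]) (is_derive_asin_sin k t Hk)).
unfold scal in D; simpl in D; unfold mult in D; simpl in D.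
replace (arc_speed k t * (k * cos t / 3)) with (k * cos t / cos (asin (k * sin t)) * (ck t / 3)); [exact D|].
unfold arc_speed, ck. field. lra.
Qed.

Lemma continuous_arc_speed (t : R) : continuous (arc_speed k) t.
Proof.
assert (Hc := cos_asin_sin_pos k t Hk).
assert (D := is_derive_asin_sin k t Hk).
apply (continuous_comp (fun t => asin (k * sin t)) (fun z => cos (z / 3) / cos z)).
- eapply is_derive_continuous_R. exact D.
- apply (ex_derive_continuous (V := R_NormedModule)). auto_derive. lra.
Qed.

Lemma arc_speed_bounded : exists M, 0 < M /\ forall t, arc_speed k t <= M.
Proof.
exists (/ sqrt (1 - k ^ 2)). assert (Hs : 0 < sqrt (1 - k ^ 2)) by (apply sqrt_lt_R0; nra).
split; [now apply Rinv_0_lt_compat|]. intros t. unfold arc_speed, Rdiv.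
assert (Hc := cos_asin_sin_pos k t Hk). assert (H := abs_k_sin k t Hk).
assert (H1 : sqrt (1 - k ^ 2) <= cos (asin (k * sin t))).
{ rewrite cos_asin by lra. apply sqrt_le_1_alt. rewrite Rsqr_pow2, Rpow_mult_distr. generalize (SIN_bound t). intros.
  assert (sin t ^ 2 <= 1) by nra. assert (0 < k ^ 2) by nra. nra. }
assert (H2 : / cos (asin (k * sin t)) <= / sqrt (1 - k ^ 2)) by now apply Rinv_le_contravar.
assert (H3 : 0 < / cos (asin (k * sin t))) by now apply Rinv_0_lt_compat.
generalize (COS_bound (asin (k * sin t) / 3)). intros. nra.
Qed.

Definition arc (t : R) : R := RInt (arc_speed k) 0 t.

Lemma derive_arc (t : R) : is_derive arc t (arc_speed k t).
Proof.
apply (is_derive_RInt (V := R_NormedModule) (arc_speed k) arc 0 t).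
- apply filter_forall. intros x. apply (RInt_correct (V := R_CompleteNormedModule)).
  apply (ex_RInt_continuous (V := R_CompleteNormedModule)). intros; apply continuous_arc_speed.
- apply continuous_arc_speed.
Qed.

Lemma arc_0 : arc 0 = 0.
Proof. apply (RInt_point (V := R_CompleteNormedModule)). Qed.

Lemma arc_PI : arc PI = PI * hypergeom (1 / 3) (2 / 3) 1 (k ^ 2).
Proof.
apply (is_RInt_unique (V := R_CompleteNormedModule)). assert (H := arc_speed_integral k 0 Hk). now rewrite Rplus_0_l in H.
Qed.

Lemma arc_increasing (s t : R) : s < t -> arc s < arc t.
Proof.
intros Hst. destruct (MVT_derive arc (arc_speed k) s t ltac:(lra)) as [c [_ E]].
{ intros x _. apply derive_arc. }
assert (H := arc_speed_pos c). nra.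
Qed.

Lemma arc_le (M t : R) : (forall t, arc_speed k t <= M) -> 0 <= t -> arc t <= M * t.
Proof.
intros HM Ht. destruct (MVT_derive arc (arc_speed k) 0 t Ht) as [c [_ E]].
{ intros x _. apply derive_arc. }
rewrite arc_0 in E. specialize (HM c). nra.
Qed.

(* [Ak] is the expected value of [1 / (1/3 + p)] at [arc t], coming from the
   ansatz [dn3 = 1 - 4 sin (z/3)^2] with [sin z = k sin t]; [Bk] is its
   derivative with respect to [arc t], and [y'' = Nk y] is the equation of
   [1 / (1/3 + p)]. *)
Definition Ak (t : R) : R := 9 * sk t ^ 2 / k ^ 2.
Definition Bk (t : R) : R := 6 / k * sk t * cos t.

Definition Nk (y : R) : R :=
  2 - 4 * y + (2 - 3 * wp_g2 k / 2) * y ^ 2 + (- (8 / 27) + 2 * wp_g2 k / 3 - 2 * wp_g3 k) * y ^ 3.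

Lemma derive_Ak (t : R) : is_derive Ak t (arc_speed k t * Bk t).
Proof.
assert (D := is_derive_scal _ t (9 / k ^ 2) _ (is_derive_pow sk 2 t _ (derive_sk t))).
simpl in D.
replace (arc_speed k t * Bk t) with (9 / (k * (k * 1)) * ((1 + 1) * (arc_speed k t * (k * cos t / 3)) * (sk t * 1)))
  by (unfold Bk; field; lra).
eapply is_derive_ext; [|exact D]. intros x. unfold Ak. simpl. field. lra.
Qed.

(** With c = 4 k^2 / 27, [Nk k y] is 2 - 4 y + 12 c y^2 - 8 c^2 y^3, half the derivative of 4 y (1 -
    y (1 - c y)^2), and the latter is [Bk] squared at y = [Ak]. *)
Lemma derive_Bk (t : R) : is_derive Bk t (arc_speed k t * Nk (Ak t)).
Proof.
assert (D0 : is_derive cos t (- sin t)) by apply is_derive_cos.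
assert (D := is_derive_mult _ _ t _ _ (is_derive_scal sk t (6 / k) _ (derive_sk t)) D0 Rmult_comm).
unfold plus, mult in D; simpl in D.
assert (G1 := arc_speed_sk t). assert (G0 := arc_speed_pos t). assert (T := sk_triple t).
assert (C := sin2_cos2 t). unfold Rsqr in C.
match type of D with is_derive _ _ ?v => replace (arc_speed k t * Nk (Ak t)) with v; [exact D|] end.
set (s := sk t) in *. set (g := arc_speed k t) in *.
assert (Tk : sin t = (3 * s - 4 * s ^ 3) / k) by (rewrite <- T; field; lra).
unfold Ak. fold s.
transitivity (g * (2 * (1 - sin t * sin t) - 6 / k * s * sin t * (1 - 4 * s ^ 2))).
- transitivity (g * (2 * (cos t * cos t)) - 6 / k * s * sin t * 1); [field; lra|]. rewrite <- G1 at 1.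
  replace (cos t * cos t) with (1 - sin t * sin t) by lra. ring.
- f_equal. rewrite Tk. unfold Nk, wp_g2, wp_g3. field. lra.
Qed.

Lemma sk_0 : sk 0 = 0.
Proof. unfold sk. rewrite sin_0, Rmult_0_r, asin_0. unfold Rdiv. rewrite Rmult_0_l. apply sin_0. Qed.

Lemma sk_PI : sk PI = 0.
Proof. unfold sk. rewrite sin_PI, Rmult_0_r, asin_0. unfold Rdiv. rewrite Rmult_0_l. apply sin_0. Qed.

(** 3 s - 4 s^3 = s (2 + (1 - 4 s^2)) has the sign of s, because 1 - 4 s^2 is positive. *)
Lemma sk_pos (t : R) : 0 < t < PI -> 0 < sk t.
Proof.
intros Ht. assert (H := sin_gt_0 t ltac:(lra) ltac:(lra)). assert (T := sk_triple t).
assert (G1 := arc_speed_sk t). assert (G0 := arc_speed_pos t).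
assert (Hp : 0 < 1 - 4 * sk t ^ 2) by (apply (Rmult_lt_reg_l (arc_speed k t)); lra).
apply Rnot_le_lt. intros Hn.
assert (0 < k * sin t) by (apply Rmult_lt_0_compat; lra).
assert (3 * sk t - 4 * sk t ^ 3 <= 0); [|lra].
replace (3 * sk t - 4 * sk t ^ 3) with (sk t * (2 + (1 - 4 * sk t ^ 2))) by ring. nra.
Qed.

Lemma Ak_range (t : R) : 0 <= Ak t <= 9 / k ^ 2.
Proof.
assert (H := SIN_bound (asin (k * sin t) / 3)). fold (sk t) in H. unfold Ak, Rdiv.
assert (Hik : 0 < / k ^ 2) by (apply Rinv_0_lt_compat; nra).
assert (sk t ^ 2 <= 1) by nra. assert (0 <= sk t ^ 2) by apply pow2_ge_0. split; nra.
Qed.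

Lemma Ak_pos (t : R) : 0 < t < PI -> 0 < Ak t.
Proof.
intros Ht. assert (H := sk_pos t Ht). unfold Ak. apply Rdiv_lt_0_compat; nra.
Qed.

End CubicModulus.

Lemma Nk_difference (k x y M : R) : 0 <= x <= M -> 0 <= y <= M ->
  exists q, Nk k x - Nk k y = (x - y) * q /\
    Rabs q <= 4 + Rabs (2 - 3 * wp_g2 k / 2) * (2 * M)
      + Rabs (- (8 / 27) + 2 * wp_g2 k / 3 - 2 * wp_g3 k) * (3 * (M * M)).
Proof.
intros Hx Hy. unfold Nk. set (n2 := 2 - 3 * wp_g2 k / 2).
set (n3 := - (8 / 27) + 2 * wp_g2 k / 3 - 2 * wp_g3 k).
exists (- (4) + (n2 * (x + y) + n3 * (x * x + x * y + y * y))). split; [ring|].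
apply Rle_trans with (4 + (Rabs n2 * (2 * M) + Rabs n3 * (3 * (M * M)))); [|lra].
eapply Rle_trans; [apply Rabs_triang|]. rewrite Rabs_Ropp, (Rabs_right 4) by lra.
apply Rplus_le_compat_l. eapply Rle_trans; [apply Rabs_triang|].
rewrite !Rabs_mult. assert (N2 := Rabs_pos n2). assert (N3 := Rabs_pos n3).
rewrite (Rabs_right (x + y)), (Rabs_right (x * x + x * y + y * y)) by nra.
apply Rplus_le_compat; apply Rmult_le_compat_l; try assumption; nra.
Qed.

(** The energy estimate for 1/(1/3 + p) on the real axis and for p on the middle line: [g] is the
    speed, and [D * q] the difference of the right sides of the two equations. *)
Lemma energy_bound_1 (D e g q M Kq : R) : 0 <= g <= M -> Rabs q <= Kq ->
  2 * (D * (g * e)) + 2 * (e * (g * (D * q))) <= (M * (1 + Kq)) * (D ^ 2 + e ^ 2).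
Proof.
intros Hg Hq. assert (HKq : 0 <= Kq) by (eapply Rle_trans; [apply Rabs_pos|exact Hq]).
apply Rabs_le_between in Hq.
assert (S1 : 0 <= (D - e) ^ 2) by apply pow2_ge_0. assert (S2 : 0 <= (D + e) ^ 2) by apply pow2_ge_0.
assert (E0 : 0 <= D ^ 2 + e ^ 2) by nra.
assert (H1 : 2 * (D * e) + 2 * (D * e) * q <= (1 + Kq) * (D ^ 2 + e ^ 2)) by nra.
replace (2 * (D * (g * e)) + 2 * (e * (g * (D * q)))) with (g * (2 * (D * e) + 2 * (D * e) * q)) by ring.
apply Rle_trans with (g * ((1 + Kq) * (D ^ 2 + e ^ 2))); [apply Rmult_le_compat_l; lra|].
rewrite Rmult_assoc. apply Rmult_le_compat_r; [|lra]. nra.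
Qed.

Section RealPeriod.

Context (k : R) (Hk : 0 < k < 1) (a b : R) (L : C -> Prop) (HR : rect_wp a b (wp_g2 k) (wp_g3 k) L).

(** The reciprocal [y] of [W] turns the double pole at t = 0 into zero initial data for [y] and
    [y1]; the price is that [W] has to be kept away from 0. *)
Let W (t : R) : R := 1 / 3 + wp_real L (arc k t).
Let y (t : R) : R := / W t.
Let y1 (t : R) : R := - wp1_real L (arc k t) * y t ^ 2.

Lemma arc_pos (t : R) : 0 < t -> 0 < arc k t.
Proof. intros Ht. rewrite <- (arc_0 k). now apply arc_increasing. Qed.

Lemma derive_W (t : R) : 0 < arc k t < a -> is_derive W t (arc_speed k t * wp1_real L (arc k t)).
Proof.
intros Ht.
assert (D := is_derive_comp (wp_real L) (arc k) t _ _ (derive_wp_real _ _ _ _ L HR _ Ht) (derive_arc k Hk t)).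
assert (D' := is_derive_plus (fun _ => 1 / 3) _ t _ _ (is_derive_const (1 / 3) t) D).
unfold plus, zero, scal in D'; simpl in D'; unfold mult in D'; simpl in D'.
rewrite Rplus_0_l in D'. exact D'.
Qed.

Lemma derive_y (t : R) : 0 < arc k t < a -> W t <> 0 -> is_derive y t (arc_speed k t * y1 t).
Proof.
intros Ht HW. assert (D := is_derive_inv W t _ (derive_W t Ht) HW).
replace (arc_speed k t * y1 t) with (- (arc_speed k t * wp1_real L (arc k t)) / W t ^ 2); [exact D|].
unfold y1, y. field. exact HW.
Qed.

(** The first integral eliminates p'^2 from the second derivative of 1/W and leaves a polynomial in
    [y]. *)
Lemma derive_y1 (t : R) : 0 < arc k t < a -> W t <> 0 -> is_derive y1 t (arc_speed k t * Nk k (y t)).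
Proof.
intros Ht HW.
assert (D1 := is_derive_comp (wp1_real L) (arc k) t _ _ (derive_wp1_real _ _ _ _ L HR _ Ht) (derive_arc k Hk t)).
assert (D2 := is_derive_mult _ _ t _ _ (is_derive_opp _ _ _ D1) (is_derive_pow y 2 t _ (derive_y t Ht HW)) Rmult_comm).
assert (FI := wp_real_first_integral _ _ _ _ L HR _ Ht).
match type of D2 with is_derive _ _ ?v => replace (arc_speed k t * Nk k (y t)) with v; [exact D2|] end.
unfold plus, mult, opp, scal; simpl; unfold mult; simpl.
assert (E : wp_real L (arc k t) = / y t - 1 / 3) by (unfold y, W; rewrite Rinv_inv; ring).
assert (Hy : y t <> 0) by (apply Rinv_neq_0_compat, HW).
unfold y1. set (p1 := wp1_real L (arc k t)) in *. set (Y := y t) in *. set (g := arc_speed k t).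
transitivity (g * (- (6 * wp_real L (arc k t) ^ 2 - wp_g2 k / 2) * Y ^ 2 + 2 * p1 ^ 2 * Y ^ 3)); [simpl; ring|].
rewrite FI, E. unfold Nk. f_equal. field. exact Hy.
Qed.

(** Supplies the zero initial data, and the bound on [W] from which the bootstrap starts. *)
Lemma y_near_0 : exists d K, 0 < d /\ 0 <= K /\ forall t, 0 < t < d ->
  9 / k ^ 2 + 2 < W t /\ 0 < y t <= K * t /\ Rabs (y1 t) <= K * t.
Proof.
destruct (wp_real_near_0 _ _ _ _ L HR) as [d [K [Hd [HK H]]]].
destruct (wp_real_blowup _ _ _ _ L HR (9 / k ^ 2 + 2)) as [d' [Hd' H']].
destruct (arc_speed_bounded k Hk) as [M [HM HG]].
pose (e := Rmin (Rmin d d') (/ (K + 1))).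
assert (He : 0 < e) by (repeat apply Rmin_glb_lt; try lra; apply Rinv_0_lt_compat; lra).
assert (E1 : e <= Rmin d d') by apply Rmin_l. assert (E2 : e <= / (K + 1)) by apply Rmin_r.
assert (E3 := Rmin_l d d'). assert (E4 := Rmin_r d d').
(* With u = [arc k t] <= M t, both y <= 2 u^2 and |y1| <= 8 u + 4 K u^5 stay below (12 + 4 K) M
   t. *)
exists (e / M), ((12 + 4 * K) * M). split; [now apply Rdiv_lt_0_compat|]. split; [nra|].
intros t Ht. assert (Hu := arc_pos t ltac:(lra)). assert (Hu' := arc_le k Hk M t HG ltac:(lra)).
assert (Hue : arc k t < e).
{ apply Rle_lt_trans with (1 := Hu'). rewrite Rmult_comm. apply Rlt_div_r; lra. }
specialize (H (arc k t) ltac:(lra)). specialize (H' (arc k t) ltac:(lra)).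
unfold y1, y, W. set (u := arc k t) in *. destruct H as [H1 [H2 _]].
apply Rabs_le_between in H1. set (w := 1 / 3 + wp_real L u) in *.
assert (Hik : 0 < 9 / k ^ 2) by (apply Rdiv_lt_0_compat; nra).
assert (Hw : 0 < w) by (unfold w; lra).
assert (Hu1 : u <= 1) by lra.
assert (HuK : u * (K + 1) <= 1).
{ apply Rle_div_r; [lra|]. unfold Rdiv. lra. }
assert (Hu2 : 0 < u ^ 2) by (apply pow_lt; lra).
assert (Hu4 : 0 < u ^ 3) by (apply pow_lt; lra).
(* [w >= 1/u^2 - K u^2 >= 1/(2 u^2)] *)
assert (Hw2 : / w <= 2 * u ^ 2).
{ replace (2 * u ^ 2) with (/ (/ (2 * u ^ 2))) by (apply Rinv_inv).
  apply Rinv_le_contravar; [apply Rinv_0_lt_compat; lra|].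
  assert (Hi : K * u ^ 2 <= 1 / 3 + / (2 * u ^ 2)).
  { assert (H3 : 0 < / (2 * u ^ 2)) by (apply Rinv_0_lt_compat; lra).
    assert (H4 : K * u <= 1 - u) by lra.
    assert (H5 : K * u ^ 2 <= u * (1 - u)) by (replace (K * u ^ 2) with (u * (K * u)) by ring; apply Rmult_le_compat_l; lra).
    assert (H6 : 0 <= (2 * u - 1) ^ 2) by apply pow2_ge_0. nra. }
  unfold w. assert (/ u ^ 2 = / (2 * u ^ 2) + / (2 * u ^ 2)) by (field; lra). lra. }
assert (Hiw : 0 < / w) by now apply Rinv_0_lt_compat.
split; [unfold w; lra|]. split.
- split; [exact Hiw|]. apply Rle_trans with (2 * u ^ 2); [exact Hw2|].
  assert (2 * u ^ 2 <= 2 * u) by nra. assert (0 < M * t) by (apply Rmult_lt_0_compat; lra). nra.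
- rewrite Rabs_mult, Rabs_Ropp, <- RPow_abs, (Rabs_right (/ w)) by lra.
  assert (HP1 : Rabs (wp1_real L u) <= 2 * / u ^ 3 + K * u).
  { replace (wp1_real L u) with ((wp1_real L u + 2 * / u ^ 3) + - (2 * / u ^ 3)) by ring.
    eapply Rle_trans; [apply Rabs_triang|]. rewrite Rabs_Ropp, (Rabs_right (2 * / u ^ 3)); [lra|].
    apply Rle_ge, Rmult_le_pos; [lra|]. left. now apply Rinv_0_lt_compat. }
  apply Rle_trans with ((2 * / u ^ 3 + K * u) * (2 * u ^ 2) ^ 2).
  + apply Rmult_le_compat; [apply Rabs_pos|apply pow2_ge_0|exact HP1|]. apply pow_incr. lra.
  + replace ((2 * / u ^ 3 + K * u) * (2 * u ^ 2) ^ 2) with (8 * u + 4 * K * (u * u ^ 4)) by (field; lra).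
    assert (u ^ 4 <= 1) by (replace (u ^ 4) with (u ^ 2 * u ^ 2) by ring; assert (u ^ 2 <= 1) by nra; nra).
    assert (0 < M * t) by (apply Rmult_lt_0_compat; lra).
    assert (u * u ^ 4 <= M * t) by nra. nra.
Qed.

(** Conditional comparison: as long as [W] exceeds c > 0, [y] stays in a bounded set on which [Nk]
    is Lipschitz, and Gronwall applies. *)
Lemma inv_wp_real_compare (T c : R) : 0 < c -> T <= PI ->
  (forall t, 0 < t < T -> arc k t < a) -> (forall t, 0 < t < T -> c < W t) ->
  forall t, 0 < t < T -> y t = Ak k t /\ y1 t = Bk k t.
Proof.
intros Hc HT Hu HW t Ht.
destruct y_near_0 as [d [K [Hd [HK H0]]]].
destruct (arc_speed_bounded k Hk) as [M [HM HG]].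
assert (Hin : forall s, 0 < s < T -> 0 < arc k s < a) by (intros s Hs; split; [apply arc_pos; lra|now apply Hu]).
assert (Hy : forall s, 0 < s < T -> 0 <= y s <= Rmax (/ c) (9 / k ^ 2)).
{ intros s Hs. specialize (HW s Hs). split; [left; apply Rinv_0_lt_compat; lra|].
  eapply Rle_trans; [|apply Rmax_l]. apply Rinv_le_contravar; lra. }
assert (HA : forall s, 0 <= Ak k s <= Rmax (/ c) (9 / k ^ 2)).
{ intros s. destruct (Ak_range k Hk s) as [A1 A2]. split; [exact A1|]. eapply Rle_trans; [exact A2|apply Rmax_r]. }
pose (E := fun s => (y s - Ak k s) ^ 2 + (y1 s - Bk k s) ^ 2).
pose (dE := fun s => 2 * ((y s - Ak k s) * (arc_speed k s * (y1 s - Bk k s)))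
   + 2 * ((y1 s - Bk k s) * (arc_speed k s * (Nk k (y s) - Nk k (Ak k s))))).
assert (DE : forall s, 0 < s < T -> is_derive E s (dE s)).
{ intros s Hs. assert (Hne : W s <> 0) by (specialize (HW s Hs); lra).
  assert (D1 := is_derive_pow _ 2 s _ (is_derive_minus _ _ s _ _ (derive_y s (Hin s Hs) Hne) (derive_Ak k Hk s))).
  assert (D2 := is_derive_pow _ 2 s _ (is_derive_minus _ _ s _ _ (derive_y1 s (Hin s Hs) Hne) (derive_Bk k Hk s))).
  assert (D := is_derive_plus _ _ _ _ _ D1 D2).
  match type of D with is_derive _ _ ?v => replace (dE s) with v; [exact D|] end.
  unfold dE, minus, plus, opp; simpl. ring. }
assert (HE : E t = 0).
{ set (m := Rmax (/ c) (9 / k ^ 2)) in *.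
  set (Kq := 4 + Rabs (2 - 3 * wp_g2 k / 2) * (2 * m)
      + Rabs (- (8 / 27) + 2 * wp_g2 k / 3 - 2 * wp_g3 k) * (3 * (m * m))).
  apply (gronwall_zero E dE 0 T (M * (1 + Kq))); [exact DE| | | |exact Ht].
  - intros s Hs. destruct (Nk_difference k _ _ m (Hy s Hs) (HA s)) as [q [Eq Hq]].
    unfold dE, E. rewrite Eq. apply energy_bound_1; [|exact Hq].
    split; [left; apply arc_speed_pos, Hk|apply HG].
  - intros s _. unfold E. apply Rplus_le_le_0_compat; apply pow2_ge_0.
  - intros eps Heps.
    assert (A0 : Ak k 0 = 0) by (unfold Ak; rewrite sk_0; field; lra).
    assert (B0 : Bk k 0 = 0) by (unfold Bk; rewrite sk_0; ring).
    (* All four quantities are at most [r] in modulus, so each square is at most (2 r)^2 <= 4 r and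
       the energy at most 8 r < eps. *)
    pose (r := Rmin 1 (eps / 16)). assert (Hr : 0 < r) by (apply Rmin_glb_lt; lra).
    assert (R1 : r <= 1) by apply Rmin_l. assert (R2 : r <= eps / 16) by apply Rmin_r.
    destruct (continuous_eps (Ak k) 0 r (is_derive_continuous_R _ _ _ (derive_Ak k Hk 0)) Hr) as [dA [HdA CA]].
    destruct (continuous_eps (Bk k) 0 r (is_derive_continuous_R _ _ _ (derive_Bk k Hk 0)) Hr) as [dB [HdB CB]].
    pose (d0 := Rmin (Rmin dA dB) (Rmin d (r / (K + 1)))).
    assert (Hd0 : 0 < d0) by (repeat apply Rmin_glb_lt; try lra; apply Rdiv_lt_0_compat; lra).
    assert (N1 : d0 <= Rmin dA dB) by apply Rmin_l. assert (N2 : d0 <= Rmin d (r / (K + 1))) by apply Rmin_r.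
    assert (N3 := Rmin_l dA dB). assert (N4 := Rmin_r dA dB).
    assert (N5 := Rmin_l d (r / (K + 1))). assert (N6 := Rmin_r d (r / (K + 1))).
    exists d0. split; [exact Hd0|]. intros s Hs Hs'.
    specialize (CA s ltac:(apply Rabs_def1; lra)). specialize (CB s ltac:(apply Rabs_def1; lra)).
    rewrite A0, Rminus_0_r in CA. rewrite B0, Rminus_0_r in CB.
    destruct (H0 s ltac:(lra)) as [_ [[Y1 Y2] Y3]].
    assert (HKs : s * (K + 1) < r) by (apply Rlt_div_r; lra).
    assert (Ys : K * s <= r) by nra.
    apply Rabs_def2 in CA. apply Rabs_def2 in CB. apply Rabs_le_between in Y3.
    assert (S1 : (y s - Ak k s) ^ 2 <= 4 * r) by nra.
    assert (S2 : (y1 s - Bk k s) ^ 2 <= 4 * r) by nra.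
    unfold E. lra. }
unfold E in HE. assert (0 <= (y t - Ak k t) ^ 2) by apply pow2_ge_0.
assert (0 <= (y1 t - Bk k t) ^ 2) by apply pow2_ge_0.
split; nra.
Qed.

(** While [W] exceeds the stated bound, [y] equals [Ak], which is at most 9 / k^2; hence [W] is at
    least k^2 / 9, a strictly better bound. *)
Lemma W_lower_bound (T : R) : T <= PI -> (forall t, 0 < t < T -> arc k t < a) ->
  forall t, 0 < t < T -> / (9 / k ^ 2 + 1) < W t.
Proof.
intros HT Hu. assert (Hik : 0 < 9 / k ^ 2) by (apply Rdiv_lt_0_compat; nra).
apply (bootstrap W T _ (/ (9 / k ^ 2))).
- apply Rinv_lt_contravar; [apply Rmult_lt_0_compat|]; lra.
- intros t Ht. eapply is_derive_continuous_R. apply derive_W. split; [apply arc_pos; lra|now apply Hu].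
- destruct y_near_0 as [d [K [Hd [_ H]]]]. exists d. split; [exact Hd|]. intros t Ht.
  destruct (H t Ht) as [H1 _]. apply Rle_lt_trans with 1; [|lra].
  rewrite <- Rinv_1. apply Rinv_le_contravar; lra.
- intros tau Htau HW t Ht.
  destruct (inv_wp_real_compare tau (/ (9 / k ^ 2 + 1))) with (t := t) as [E _]; try assumption.
  + apply Rinv_0_lt_compat. lra.
  + lra.
  + intros s Hs. apply Hu. lra.
  + assert (HWt := HW t Ht). assert (Hi : 0 < / (9 / k ^ 2 + 1)) by (apply Rinv_0_lt_compat; lra).
    assert (HA := Ak_range k Hk t). rewrite <- E in HA. unfold y in HA.
    rewrite <- (Rinv_inv (W t)). apply Rinv_le_contravar; [apply Rinv_0_lt_compat; lra|lra].
Qed.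

Lemma wp_real_compare (T : R) : T <= PI -> (forall t, 0 < t < T -> arc k t < a) ->
  forall t, 0 < t < T -> 0 < W t /\ Ak k t * W t = 1 /\ y1 t = Bk k t.
Proof.
intros HT Hu t Ht. assert (HW := W_lower_bound T HT Hu).
assert (Hik : 0 < 9 / k ^ 2) by (apply Rdiv_lt_0_compat; nra).
assert (Hi : 0 < / (9 / k ^ 2 + 1)) by (apply Rinv_0_lt_compat; lra).
destruct (inv_wp_real_compare T _ Hi HT Hu HW t Ht) as [E1 E2].
assert (HWt := HW t Ht). split; [lra|]. split; [|exact E2].
rewrite <- E1. unfold y. field. lra.
Qed.

Lemma real_period : a = arc k PI.
Proof.
assert (HPI := PI_RGT_0). assert (Ha := rw_a HR).
destruct (Rtotal_order a (arc k PI)) as [Hlt|[Heq|Hgt]]; [exfalso|exact Heq|exfalso].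
(* A shorter period would put the pole [a] at some tau < PI, where [Ak] is positive and 1/3 + p = 1
   / [Ak] stays bounded. *)
- destruct (IVT_derive (arc k) (arc_speed k) 0 PI a HPI (derive_arc k Hk)) as [tau [Ht Eu]]; [rewrite arc_0; lra|].
  assert (Hu : forall t, 0 < t < tau -> arc k t < a) by (intros t H; rewrite <- Eu; now apply arc_increasing).
  assert (HA := Ak_pos k Hk tau Ht).
  destruct (continuous_eps (Ak k) tau (Ak k tau / 2) (is_derive_continuous_R _ _ _ (derive_Ak k Hk tau)) ltac:(lra)) as [d [Hd CA]].
  destruct (wp_real_blowup _ _ _ _ L HR (2 / Ak k tau)) as [d' [Hd' Hb]].
  destruct (arc_speed_bounded k Hk) as [M [HM HG]].
  (* Small enough for [Ak] to stay above half of [Ak k tau] and for [arc k (tau - e)] to come within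
     [d'] of the pole. *)
  pose (e := Rmin (Rmin (d / 2) (tau / 2)) (d' / (2 * M))).
  assert (He : 0 < e) by (repeat apply Rmin_glb_lt; try lra; apply Rdiv_lt_0_compat; lra).
  assert (E1 : e <= Rmin (d / 2) (tau / 2)) by apply Rmin_l. assert (E2 : e <= d' / (2 * M)) by apply Rmin_r.
  assert (E3 := Rmin_l (d / 2) (tau / 2)). assert (E4 := Rmin_r (d / 2) (tau / 2)).
  apply Rle_div_r in E2; [|lra].
  destruct (MVT_derive (arc k) (arc_speed k) (tau - e) tau ltac:(lra)) as [c [_ Ec]].
  { intros x _. apply derive_arc, Hk. }
  destruct (wp_real_compare tau ltac:(lra) Hu (tau - e) ltac:(lra)) as [H1 [H2 _]].
  specialize (CA (tau - e) ltac:(apply Rabs_def1; lra)). apply Rabs_def2 in CA.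
  assert (Hui := Hu (tau - e) ltac:(lra)). assert (Hup := arc_pos (tau - e) ltac:(lra)).
  specialize (Hb (a - arc k (tau - e))). rewrite (wp_real_reflect _ _ _ _ L HR) in Hb by lra.
  specialize (HG c). assert (HGp := arc_speed_pos k Hk c).
  specialize (Hb ltac:(nra)).
  assert (HW : 2 / Ak k tau < W (tau - e)) by (unfold W; lra).
  apply Rlt_div_l in HW; [|exact HA]. nra.
(* With a longer period p would be finite at [arc k PI], so the product [Ak] (1/3 + p) would tend to
   0, although it equals 1. *)
- assert (Hu : forall t, 0 < t < PI -> arc k t < a).
  { intros t Ht. apply Rlt_trans with (arc k PI); [apply arc_increasing; [exact Hk|lra]|lra]. }
  assert (D := derive_W PI ltac:(split; [apply arc_pos; lra|lra])).
  assert (Cont : continuous (fun t => Ak k t * W t) PI).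
  { apply (continuous_mult (Ak k) W); eapply is_derive_continuous_R; [apply (derive_Ak k Hk)|exact D]. }
  destruct (continuous_eps _ PI 1 Cont Rlt_0_1) as [d [Hd Hc]].
  assert (M1 := Rmin_l (d / 2) (PI / 2)). assert (M2 := Rmin_r (d / 2) (PI / 2)).
  assert (M3 : 0 < Rmin (d / 2) (PI / 2)) by (apply Rmin_glb_lt; lra).
  specialize (Hc (PI - Rmin (d / 2) (PI / 2)) ltac:(apply Rabs_def1; lra)).
  destruct (wp_real_compare PI ltac:(lra) Hu (PI - Rmin (d / 2) (PI / 2)) ltac:(lra)) as [_ [H2 _]].
  rewrite H2 in Hc. replace (Ak k PI) with 0 in Hc by (unfold Ak; rewrite sk_PI; field; lra).
  rewrite Rmult_0_l, Rminus_0_r, Rabs_R1 in Hc. lra.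
Qed.

(** At a/2 the derivative of p vanishes, hence so does [Bk]; since [sk] is positive inside, the
    parameter of a/2 is the zero PI/2 of the cosine. *)
Lemma wp_real_half_period : wp_real L (a / 2) = / Ak k (PI / 2) - 1 / 3.
Proof.
assert (HPI := PI_RGT_0). assert (Ha := rw_a HR). assert (Hp := real_period).
assert (Hu : forall t, 0 < t < PI -> arc k t < a) by (intros t Ht; rewrite Hp; apply arc_increasing; [exact Hk|lra]).
destruct (IVT_derive (arc k) (arc_speed k) 0 PI (a / 2) HPI (derive_arc k Hk)) as [tau [Ht Eu]]; [rewrite arc_0; lra|].
destruct (wp_real_compare PI ltac:(lra) Hu tau Ht) as [H1 [H2 H3]].
unfold y1 in H3. rewrite Eu, (wp1_real_half _ _ _ _ L HR) in H3.
unfold Bk in H3. assert (Hs := sk_pos k Hk tau Ht).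
assert (Hcos : cos tau = 0).
{ assert (Hk6 : 0 < 6 / k * sk k tau) by (apply Rmult_lt_0_compat; [apply Rdiv_lt_0_compat; lra|exact Hs]).
  apply (Rmult_eq_reg_l (6 / k * sk k tau)); lra. }
assert (Et : tau = PI / 2).
{ destruct (Rtotal_order tau (PI / 2)) as [Hlt|[He|Hgt]]; [exfalso|exact He|exfalso].
  - assert (H := cos_gt_0 tau ltac:(lra) ltac:(lra)). lra.
  - assert (H := cos_lt_0 tau ltac:(lra) ltac:(lra)). lra. }
rewrite Et in H2, Eu, H1. unfold W in H2, H1. rewrite Eu in H2, H1.
assert (HA : Ak k (PI / 2) <> 0) by (intros E0; rewrite E0 in H2; lra).
apply (Rmult_eq_reg_l (Ak k (PI / 2))); [|exact HA].
replace (Ak k (PI / 2) * (/ Ak k (PI / 2) - 1 / 3)) with (1 - Ak k (PI / 2) / 3) by (field; exact HA).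
lra.
Qed.

End RealPeriod.

(** * The imaginary period *)

Lemma is_RInt_odd (f : R -> R) (r l : R) :
  (forall x, f (- x) = - f x) -> is_RInt f (- r) r l -> l = 0.
Proof.
intros Hodd H.
assert (H1 : is_RInt f (- r) (- - r) l) by (now rewrite Ropp_involutive).
apply is_RInt_comp_opp in H1.
assert (H2 : is_RInt f r (- r) l).
{ eapply is_RInt_ext; [|exact H1]. intros x _. cbn beta. rewrite Hodd. unfold opp; simpl. ring. }
apply is_RInt_swap in H2.
assert (E1 := is_RInt_unique (V := R_CompleteNormedModule) _ _ _ _ H).
assert (E2 := is_RInt_unique (V := R_CompleteNormedModule) _ _ _ _ H2).
rewrite E1 in E2. unfold opp in E2; simpl in E2. lra.
Qed.

Section ComplementaryModulus.

Context (k : R) (Hk : 0 < k < 1).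

Definition comodulus : R := sqrt (1 - k ^ 2).

Lemma comodulus_sqr : comodulus ^ 2 = 1 - k ^ 2.
Proof. unfold comodulus. apply pow2_sqrt. nra. Qed.

Lemma comodulus_range : 0 < comodulus < 1.
Proof.
assert (H : 0 < comodulus) by (apply sqrt_lt_R0; nra). split; [exact H|]. assert (E := comodulus_sqr). nra.
Qed.

Let zeta (t : R) : R := asin (comodulus * sin t).
(* On the line [Re = omega] the angle [z] of the real axis becomes
   [PI/2 + asin (comodulus * sin t)]. *)
Definition sa (t : R) : R := sin (PI / 6 + asin (comodulus * sin t) / 3).
Definition ca (t : R) : R := cos (PI / 6 + asin (comodulus * sin t) / 3).
Definition mid_speed (t : R) : R := ca t / cos (asin (comodulus * sin t)).

Lemma alpha_range (t : R) : 0 < PI / 6 + asin (comodulus * sin t) / 3 < PI / 3.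
Proof. assert (H := asin_range _ (abs_k_sin comodulus t comodulus_range)). lra. Qed.

Lemma sa_pos (t : R) : 0 < sa t.
Proof. assert (H := alpha_range t). assert (HPI := PI_RGT_0). apply sin_gt_0; lra. Qed.

Lemma ca_pos (t : R) : 0 < ca t.
Proof. assert (H := alpha_range t). assert (HPI := PI_RGT_0). apply cos_gt_0; lra. Qed.

(** Three times the angle in [sa] is PI/2 + zeta. *)
Lemma cos_zeta (t : R) : cos (zeta t) = 3 * sa t - 4 * sa t ^ 3.
Proof.
unfold sa. rewrite <- sin_3a.
replace (3 * (PI / 6 + asin (comodulus * sin t) / 3)) with (PI / 2 + zeta t) by (unfold zeta; field).
symmetry. rewrite cos_sin. reflexivity.
Qed.

Lemma sin_zeta (t : R) : comodulus * sin t = ca t * (4 * sa t ^ 2 - 1).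
Proof.
assert (H := abs_k_sin comodulus t comodulus_range).
replace (ca t * (4 * sa t ^ 2 - 1)) with (- (ca t * (1 - 4 * sa t ^ 2))) by ring.
unfold ca, sa. rewrite <- cos_3a_sin.
replace (3 * (PI / 6 + asin (comodulus * sin t) / 3)) with (PI / 2 + asin (comodulus * sin t)) by field.
rewrite <- sin_cos. symmetry. apply sin_asin. lra.
Qed.

Lemma mid_speed_pos (t : R) : 0 < mid_speed t.
Proof. apply Rdiv_lt_0_compat; [apply ca_pos|apply cos_asin_sin_pos, comodulus_range]. Qed.

Lemma derive_sa (t : R) : is_derive sa t (mid_speed t * (comodulus * cos t / 3)).
Proof.
assert (Hc := cos_asin_sin_pos comodulus t comodulus_range).
assert (D := is_derive_comp (fun z => sin (PI / 6 + z / 3)) (fun t => asin (comodulus * sin t)) t (ca t / 3) _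
  ltac:(unfold ca; auto_derive; [auto|unfold Rdiv; field]) (is_derive_asin_sin comodulus t comodulus_range)).
unfold scal in D; simpl in D; unfold mult in D; simpl in D.
replace (mid_speed t * (comodulus * cos t / 3)) with (comodulus * cos t / cos (asin (comodulus * sin t)) * (ca t / 3)); [exact D|].
unfold mid_speed. field. lra.
Qed.

Lemma continuous_mid_speed (t : R) : continuous mid_speed t.
Proof.
assert (Hc := cos_asin_sin_pos comodulus t comodulus_range).
assert (D := is_derive_asin_sin comodulus t comodulus_range).
apply (continuous_comp (fun t => asin (comodulus * sin t)) (fun z => cos (PI / 6 + z / 3) / cos z)).
- eapply is_derive_continuous_R. exact D.
- apply (ex_derive_continuous (V := R_NormedModule)). auto_derive. lra.
Qed.

(** The height above omega: t = -PI/2 corresponds to omega, and t = PI/2 will turn out to be omega +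
    omega'. *)
Definition mid_arc (t : R) : R := RInt mid_speed (- (PI / 2)) t.

Lemma derive_mid_arc (t : R) : is_derive mid_arc t (mid_speed t).
Proof.
apply (is_derive_RInt (V := R_NormedModule) mid_speed mid_arc (- (PI / 2)) t).
- apply filter_forall. intros x. apply (RInt_correct (V := R_CompleteNormedModule)).
  apply (ex_RInt_continuous (V := R_CompleteNormedModule)). intros; apply continuous_mid_speed.
- apply continuous_mid_speed.
Qed.

Lemma mid_arc_start : mid_arc (- (PI / 2)) = 0.
Proof. apply (RInt_point (V := R_CompleteNormedModule)). Qed.

Lemma mid_arc_end : mid_arc (PI / 2) = sqrt 3 / 2 * PI * hypergeom (1 / 3) (2 / 3) 1 (1 - k ^ 2).
Proof.
assert (Hkp := comodulus_range).
assert (H := arc_speed_integral comodulus (- (PI / 2)) Hkp).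
replace (- (PI / 2) + PI) with (PI / 2) in H by field. rewrite comodulus_sqr in H.
(* The odd part, which appears when cos (PI/6 + y/3) is expanded by the addition formula. *)
pose (f := fun t => sin (asin (comodulus * sin t) / 3) / cos (asin (comodulus * sin t))).
assert (Cf : forall t, continuous f t).
{ intros t. assert (Hc := cos_asin_sin_pos comodulus t Hkp).
  apply (continuous_comp (fun t => asin (comodulus * sin t)) (fun z => sin (z / 3) / cos z)).
  - eapply is_derive_continuous_R. apply (is_derive_asin_sin comodulus t Hkp).
  - apply (ex_derive_continuous (V := R_NormedModule)). auto_derive. lra. }
assert (Hf : is_RInt f (- (PI / 2)) (PI / 2) (RInt f (- (PI / 2)) (PI / 2))).
{ apply (RInt_correct (V := R_CompleteNormedModule)), (ex_RInt_continuous (V := R_CompleteNormedModule)). auto. }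
assert (Hodd : forall x, f (- x) = - f x).
{ intros x. unfold f. rewrite sin_neg. replace (comodulus * - sin x) with (- (comodulus * sin x)) by ring.
  rewrite asin_opp, cos_neg. replace (- asin (comodulus * sin x) / 3) with (- (asin (comodulus * sin x) / 3)) by field.
  rewrite sin_neg. unfold Rdiv. ring. }
rewrite (is_RInt_odd f _ _ Hodd Hf) in Hf.
assert (S := is_RInt_minus (V := R_NormedModule) _ _ _ _ _ _
  (is_RInt_scal (V := R_NormedModule) _ _ _ (cos (PI / 6)) _ H)
  (is_RInt_scal (V := R_NormedModule) _ _ _ (sin (PI / 6)) _ Hf)).
unfold mid_arc. apply (is_RInt_unique (V := R_CompleteNormedModule)).
replace (sqrt 3 / 2 * PI * hypergeom (1 / 3) (2 / 3) 1 (1 - k ^ 2)) with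
  (minus (scal (cos (PI / 6)) (PI * hypergeom (1 / 3) (2 / 3) 1 (1 - k ^ 2))) (scal (sin (PI / 6)) 0)).
- eapply is_RInt_ext; [|exact S]. intros t _. cbn beta.
  change (cos (PI / 6) * arc_speed comodulus t + - (sin (PI / 6) * f t) = mid_speed t).
  unfold arc_speed, f, mid_speed, ca. rewrite cos_plus. unfold Rdiv. ring.
- rewrite cos_PI6. change (sqrt 3 / 2 * (PI * hypergeom (1 / 3) (2 / 3) 1 (1 - k ^ 2)) + - (sin (PI / 6) * 0)
    = sqrt 3 / 2 * PI * hypergeom (1 / 3) (2 / 3) 1 (1 - k ^ 2)). ring.
Qed.

(* Expected value of [p] at [omega + i * mid_arc t] (again [1 / (1/3 + p)] is
   [9 sin^2 / k^2]), and its derivative with respect to [mid_arc t]. *)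
Definition Xk (t : R) : R := k ^ 2 / (9 * sa t ^ 2) - 1 / 3.
Definition Yk (t : R) : R := - (2 * k ^ 2 * comodulus / 27) * (cos t / sa t ^ 3).

Lemma derive_Xk (t : R) : is_derive Xk t (mid_speed t * Yk t).
Proof.
assert (Hs := sa_pos t).
assert (D := is_derive_comp (fun s => k ^ 2 / (9 * s ^ 2) - 1 / 3) sa t (- (2 * k ^ 2 / (9 * sa t ^ 3))) _
  ltac:(auto_derive; [assert (0 < sa t * (sa t * 1)) by (apply Rmult_lt_0_compat; lra); lra|field; lra]) (derive_sa t)).
unfold scal in D; simpl in D; unfold mult in D; simpl in D.
match type of D with is_derive _ _ ?v => replace (mid_speed t * Yk t) with v; [exact D|] end.
unfold Yk. field. lra.
Qed.

Lemma derive_Yk (t : R) : is_derive Yk t (mid_speed t * - (6 * Xk t ^ 2 - wp_g2 k / 2)).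
Proof.
assert (Hs := sa_pos t).
assert (D1 : is_derive (fun s => / s ^ 3) (sa t) (- (3 / sa t ^ 4))).
{ auto_derive; [|field; lra]. assert (0 < sa t * (sa t * (sa t * 1))) by (repeat apply Rmult_lt_0_compat; lra). lra. }
assert (D2 := is_derive_comp (fun s => / s ^ 3) sa t _ _ D1 (derive_sa t)).
assert (D3 := is_derive_scal _ t (- (2 * k ^ 2 * comodulus / 27)) _ (is_derive_mult cos _ t _ _ (is_derive_cos t) D2 Rmult_comm)).
unfold plus, scal, mult in D3; simpl in D3; unfold mult in D3; simpl in D3.
match type of D3 with is_derive _ _ ?v => replace (mid_speed t * - (6 * Xk t ^ 2 - wp_g2 k / 2)) with v; [exact D3|] end.
assert (Hc := cos_zeta t). assert (Hz := sin_zeta t). assert (Hk2 := comodulus_sqr).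
assert (Cp := cos_asin_sin_pos comodulus t comodulus_range). fold (zeta t) in Cp. rewrite Hc in Cp.
assert (EG : ca t = mid_speed t * (3 * sa t - 4 * sa t ^ 3)).
{ unfold mid_speed. fold (zeta t). rewrite Hc. field. lra. }
(* With k' the comodulus: k'^2 cos^2 t = k'^2 - sin^2 zeta = cos^2 zeta - k^2. *)
assert (C2 : comodulus ^ 2 * cos t ^ 2 = (3 * sa t - 4 * sa t ^ 3) ^ 2 - k ^ 2).
{ assert (T := sin2_cos2 t). unfold Rsqr in T.
  assert (T2 := sin2_cos2 (zeta t)). unfold Rsqr in T2. rewrite Hc in T2.
  unfold zeta in T2. assert (Ha := abs_k_sin comodulus t comodulus_range). rewrite sin_asin in T2 by lra.
  replace (comodulus ^ 2 * cos t ^ 2) with (comodulus ^ 2 - (comodulus * sin t) * (comodulus * sin t)).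
  - rewrite Hk2. lra.
  - replace (cos t ^ 2) with (1 - sin t * sin t) by (simpl; lra). ring. }
rewrite EG in Hz. set (s := sa t) in *. set (g := mid_speed t) in *.
transitivity (2 * k ^ 2 / 27 * ((comodulus * sin t) / s ^ 3 + g * (comodulus ^ 2 * cos t ^ 2) / s ^ 4)).
- simpl. field. lra.
- rewrite Hz, C2. unfold Xk, wp_g2. fold s. field. lra.
Qed.

(** The two parametrizations meet at omega: the angle PI/2 - asin k' at t = -PI/2 on the middle line
    is the angle asin k at t = PI/2 on the real axis. *)
Lemma asin_complement : asin k = PI / 2 - asin comodulus.
Proof.
assert (H := acos_asin k ltac:(lra)).
assert (E : asin comodulus = acos k).
{ unfold comodulus. replace (1 - k ^ 2) with (1 - Rsqr k) by (unfold Rsqr; ring).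
  rewrite <- sin_acos by lra. apply asin_sin. assert (B := acos_bound k).
  assert (HPI := PI_RGT_0). assert (B1 := asin_bound k).
  assert (B2 : 0 <= asin k).
  { apply Rnot_lt_le. intros Hn. assert (S := sin_lt_0_var (asin k) ltac:(lra) Hn).
    rewrite sin_asin in S by lra. lra. }
  lra. }
lra.
Qed.

Lemma Xk_start : Xk (- (PI / 2)) = / Ak k (PI / 2) - 1 / 3.
Proof.
assert (Hs := sa_pos (- (PI / 2))).
assert (E : sa (- (PI / 2)) = sk k (PI / 2)).
{ unfold sa, sk. rewrite sin_neg, sin_PI2.
  replace (comodulus * - (1)) with (- comodulus) by ring. rewrite asin_opp, Rmult_1_r, asin_complement. f_equal. field. }
unfold Xk, Ak. rewrite <- E. field. lra.
Qed.

Lemma Yk_start : Yk (- (PI / 2)) = 0.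
Proof. unfold Yk. rewrite cos_neg, cos_PI2. unfold Rdiv. ring. Qed.

Lemma Yk_end : Yk (PI / 2) = 0.
Proof. unfold Yk. rewrite cos_PI2. unfold Rdiv. ring. Qed.

(** Once [Yk] is known to be the derivative of p along the line, this excludes a half period before
    [mid_arc (PI / 2)]. *)
Lemma Yk_neg (t : R) : - (PI / 2) < t < PI / 2 -> Yk t < 0.
Proof.
intros Ht. assert (Hc := cos_gt_0 t ltac:(lra) ltac:(lra)). assert (Hs := sa_pos t). assert (Hkp := comodulus_range).
assert (Hp : 0 < 2 * k ^ 2 * comodulus / 27) by (assert (0 < k ^ 2) by nra; assert (0 < k ^ 2 * comodulus) by (apply Rmult_lt_0_compat; lra); lra).
assert (Hq : 0 < cos t / sa t ^ 3) by (apply Rdiv_lt_0_compat; [lra|apply pow_lt; lra]).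
unfold Yk. nra.
Qed.

Context (a b : R) (L : C -> Prop) (HR : rect_wp a b (wp_g2 k) (wp_g3 k) L).

(** The line carries no pole, so p itself can be compared. The starting value is the one found at
    omega from the real axis. *)
Lemma middle_line_compare (t : R) : - (PI / 2) <= t <= PI / 2 -> wp_mid a L (mid_arc t) = Xk t /\ wp1_mid a L (mid_arc t) = Yk t.
Proof.
assert (HPI := PI_RGT_0).
pose (D := fun s => wp_mid a L (mid_arc s) - Xk s). pose (e := fun s => wp1_mid a L (mid_arc s) - Yk s).
pose (E := fun s => D s ^ 2 + e s ^ 2).
pose (dE := fun s => 2 * (D s * (mid_speed s * e s)) + 2 * (e s * (mid_speed s * (D s * - (6 * (wp_mid a L (mid_arc s) + Xk s)))))).
assert (DQ : forall s, is_derive (fun s => wp_mid a L (mid_arc s)) s (mid_speed s * wp1_mid a L (mid_arc s))).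
{ intros s. exact (is_derive_comp (wp_mid a L) mid_arc s _ _ (derive_wp_mid _ _ _ _ L HR (mid_arc s)) (derive_mid_arc s)). }
assert (DQ1 : forall s, is_derive (fun s => wp1_mid a L (mid_arc s)) s (mid_speed s * - (6 * wp_mid a L (mid_arc s) ^ 2 - wp_g2 k / 2))).
{ intros s. exact (is_derive_comp (wp1_mid a L) mid_arc s _ _ (derive_wp1_mid _ _ _ _ L HR (mid_arc s)) (derive_mid_arc s)). }
assert (DE : forall s, is_derive E s (dE s)).
{ intros s.
  assert (H1 := is_derive_pow _ 2 s _ (is_derive_minus _ _ s _ _ (DQ s) (derive_Xk s))).
  assert (H2 := is_derive_pow _ 2 s _ (is_derive_minus _ _ s _ _ (DQ1 s) (derive_Yk s))).
  assert (H := is_derive_plus _ _ _ _ _ H1 H2).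
  match type of H with is_derive _ _ ?v => replace (dE s) with v; [exact H|] end.
  unfold dE, D, e, minus, plus, opp; simpl. ring. }
assert (CE : forall s, continuous E s) by (intros s; eapply is_derive_continuous_R; apply DE).
assert (E0 : E (- (PI / 2)) = 0).
{ unfold E, D, e. rewrite mid_arc_start, Xk_start, Yk_start, (wp1_mid_0 _ _ _ _ L HR).
  change (wp_mid a L 0) with (wp_real L (a / 2)). rewrite (wp_real_half_period k Hk a b L HR). ring. }
destruct (continuous_bounded mid_speed (- (PI / 2)) (PI / 2) ltac:(lra)) as [M [HM BM]]; [intros; apply continuous_mid_speed|].
destruct (continuous_bounded (fun s => - (6 * (wp_mid a L (mid_arc s) + Xk s))) (- (PI / 2)) (PI / 2) ltac:(lra)) as [Kq [HKq BK]].
{ intros x _. eapply is_derive_continuous_R.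
  apply (is_derive_opp (fun s => 6 * (wp_mid a L (mid_arc s) + Xk s))), is_derive_scal.
  apply (is_derive_plus (fun s => wp_mid a L (mid_arc s)) Xk); [apply DQ|apply derive_Xk]. }
assert (Hin : forall s, - (PI / 2) < s < PI / 2 -> E s = 0).
{ apply (gronwall_zero E dE _ _ (M * (1 + Kq))).
  - intros s _. apply DE.
  - intros s Hs. unfold dE, E. apply energy_bound_1; [|apply BK; lra].
    assert (H := BM s ltac:(lra)). apply Rabs_le_between in H. assert (H2 := mid_speed_pos s). lra.
  - intros s _. unfold E. apply Rplus_le_le_0_compat; apply pow2_ge_0.
  - intros eps Heps. destruct (continuous_eps E _ eps (CE (- (PI / 2))) Heps) as [d [Hd H]].
    exists d. split; [exact Hd|]. intros s Hs Hs'. specialize (H s ltac:(apply Rabs_def1; lra)).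
    rewrite E0 in H. apply Rabs_def2 in H. lra. }
intros Ht.
assert (Hall : E t = 0).
{ destruct (Req_dec t (- (PI / 2))) as [->|Hn1]; [exact E0|].
  (* Gronwall covers the open interval; the right end, which decides the half period, follows by
     continuity. *)
  destruct (Req_dec t (PI / 2)) as [->|Hn2]; [|apply Hin; lra].
  apply NNPP. intros Hne.
  destruct (continuous_eps E _ (Rabs (E (PI / 2))) (CE (PI / 2)) (Rabs_pos_lt _ Hne)) as [d [Hd H]].
  assert (M1 := Rmin_l (d / 2) (PI / 2)). assert (M2 := Rmin_r (d / 2) (PI / 2)).
  assert (M3 : 0 < Rmin (d / 2) (PI / 2)) by (apply Rmin_glb_lt; lra).
  specialize (H (PI / 2 - Rmin (d / 2) (PI / 2)) ltac:(apply Rabs_def1; lra)).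
  rewrite Hin in H by lra. rewrite Rminus_0_l, Rabs_Ropp in H. lra. }
unfold E in Hall. assert (0 <= D t ^ 2) by apply pow2_ge_0. assert (0 <= e t ^ 2) by apply pow2_ge_0.
assert (D t = 0) by nra. assert (e t = 0) by nra. unfold D, e in *. split; lra.
Qed.

Lemma imaginary_period : b / 2 = mid_arc (PI / 2).
Proof.
assert (HPI := PI_RGT_0). assert (Hb := rw_b HR).
assert (Hpos : 0 < mid_arc (PI / 2)).
{ destruct (MVT_derive mid_arc mid_speed (- (PI / 2)) (PI / 2) ltac:(lra)) as [c [_ Ec]].
  { intros x _. apply derive_mid_arc. }
  rewrite mid_arc_start in Ec. assert (H := mid_speed_pos c). nra. }
destruct (Rtotal_order (b / 2) (mid_arc (PI / 2))) as [Hlt|[Heq|Hgt]]; [exfalso|exact Heq|exfalso].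
(* If b/2 came earlier, p' would vanish at a parameter where [Yk] is negative. *)
- destruct (IVT_derive mid_arc mid_speed (- (PI / 2)) (PI / 2) (b / 2) ltac:(lra) derive_mid_arc) as [t [Ht' Et]];
    [rewrite mid_arc_start; lra|].
  destruct (middle_line_compare t ltac:(lra)) as [_ H]. rewrite Et, (wp1_mid_half _ _ _ _ L HR) in H.
  assert (H2 := Yk_neg t Ht'). lra.
(* If it came later, p would have a critical point strictly between omega and omega + omega'. *)
- destruct (middle_line_compare (PI / 2) ltac:(lra)) as [_ H]. rewrite Yk_end in H.
  exact (wp1_mid_no_early_zero a b _ _ L (mid_arc (PI / 2)) HR ltac:(lra) H).
Qed.

End ComplementaryModulus.

(** * Periods of dn3, and reduction to a rectangular lattice *)

Lemma Cmult_cancel_l (x y z : C) : x <> 0 -> (x * y = x * z)%C -> y = z.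
Proof.
intros Hx E. replace y with (/ x * (x * y))%C by (field; exact Hx). rewrite E. field. exact Hx.
Qed.

(** On the sphere the relation makes delta the image of p under a Moebius map, invertible because
    kappa is nonzero; in particular p and delta have the same periods. *)
Lemma shen_relation_injective (kappa : R) (p delta : C -> option C) (z z' : C) :
  0 < kappa < 1 -> shen_relation kappa p delta -> (p z = p z' <-> delta z = delta z').
Proof.
intros Hk H. assert (H1 := H z). assert (H2 := H z'). clear H.
assert (Hc : (4 / 9 * kappa ^ 2)%C <> 0).
{ intros E. assert (E2 : RtoC (4 / 9 * kappa ^ 2) = 0).
  { rewrite <- E, RtoC_mult, RtoC_pow, RtoC_div by lra. reflexivity. }
  apply RtoC_inj in E2. nra. }
set (c := (4 / 9 * kappa ^ 2)%C) in *.
destruct (p z) as [u|], (p z') as [u'|], (delta z) as [v|], (delta z') as [v'|];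
  try contradiction; split; intros E; try discriminate; try reflexivity.
- injection E as <-. f_equal.
  assert (Hu : (1 / 3 + u)%C <> 0) by (intros E; rewrite E in H1; apply Hc; rewrite <- H1; ring).
  assert (E3 : (1 - v)%C = (1 - v')%C).
  { apply (Cmult_cancel_l (1 / 3 + u)%C); [exact Hu|]. rewrite Cmult_comm, H1, Cmult_comm, H2. reflexivity. }
  replace v with (1 - (1 - v))%C by ring. rewrite E3. ring.
- injection E as <-. f_equal.
  assert (Hv : (1 - v)%C <> 0) by (intros E; rewrite E in H1; apply Hc; rewrite <- H1; ring).
  assert (E3 : (1 / 3 + u)%C = (1 / 3 + u')%C) by (apply (Cmult_cancel_l (1 - v)%C); [exact Hv|congruence]).
  replace u with (1 / 3 + u - 1 / 3)%C by (set (q := (1 / 3)%C); ring).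
  rewrite E3. set (q := (1 / 3)%C). ring.
- injection E as <-. rewrite H2 in H1. exfalso. apply Hc. rewrite <- H1. ring.
- injection E as <-. rewrite H1 in H2. exfalso. apply Hc. rewrite <- H2. ring.
- f_equal. replace u with (1 / 3 + u - 1 / 3)%C by (set (q := (1 / 3)%C); ring).
  rewrite H1. replace u' with (1 / 3 + u' - 1 / 3)%C by (set (q := (1 / 3)%C); ring).
  rewrite H2. reflexivity.
- injection E as <-. rewrite H2 in H1. exfalso. apply Hc. rewrite <- H1. ring.
- injection E as <-. rewrite H1 in H2. exfalso. apply Hc. rewrite <- H2. ring.
- f_equal. replace v with (1 - (1 - v))%C by ring. rewrite H1.
  replace v' with (1 - (1 - v'))%C by ring. rewrite H2. reflexivity.
Qed.

Lemma wp_of_lattice_value (L : C -> Prop) (p : C -> option C) (z : C) :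
  L 0 -> is_wp_of_lattice L p -> ~ L z -> p z = Some (wp L z).
Proof.
intros L0 Hp Hz. destruct (proj2 (Hp z) Hz) as [s [Hs ->]]. f_equal.
assert (Hz0 : z <> 0) by (intros ->; contradiction).
assert (E : eis L 2 z = s).
{ apply lsum_unique. eapply has_sum_ext; [reflexivity| |exact Hs].
  intros w [Hw Hw0]. unfold eis_term; cbn [Nat.eqb].
  assert (Hzw : (z - w)%C <> 0).
  { intros E. apply Hz. replace z with (z - w + w)%C by ring. rewrite E. now rewrite Cplus_0_l. }
  field. split; assumption. }
unfold wp. rewrite E. field. exact Hz0.
Qed.

Lemma rectangular_wp (a b g2 g3 : R) (L : C -> Prop) (p : C -> option C) :
  0 < a -> 0 < b ->
  (forall x y, L (x, y) <-> exists m n : Z, x = IZR m * a /\ y = IZR n * b) ->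
  (forall w, L w -> is_period p w) -> is_wp_of_lattice L p ->
  lattice_invariants L (RtoC g2) (RtoC g3) -> rect_wp a b g2 g3 L.
Proof.
intros Ha Hb Hmem Hper Hp [G4 [G6 [H4 [H6 [E4 E6]]]]].
assert (HL := discrete_group_rectangular a b L Ha Hb Hmem).
(* The Eisenstein sums are real because the invariants are. *)
assert (Hreal : forall (g n : R) (G : C), n <> 0 -> RtoC g = (RtoC n * G)%C -> G = RtoC (g / n)).
{ intros g n G Hn E. assert (Hn' : RtoC n <> 0) by (intros E0; apply RtoC_inj in E0; contradiction).
  rewrite RtoC_div by exact Hn. rewrite E. field. exact Hn'. }
constructor; try assumption.
- eapply cube_summable_of_wp; eassumption.
- intros z w Hz Hw.
  assert (Hzw : ~ L (z + w)%C).
  { intros H. apply Hz. replace z with (z + w - w)%C by ring. now apply (dg_minus HL). }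
  assert (E := Hper w Hw z).
  rewrite !(wp_of_lattice_value L p) in E by (try assumption; apply (dg_0 HL)).
  congruence.
- rewrite <- (Hreal g2 60 G4 ltac:(lra) E4). eapply has_sum_ext; [reflexivity| |exact H4].
  intros w [_ Hw]. cbn beta. field. exact Hw.
- rewrite <- (Hreal g3 140 G6 ltac:(lra) E6). eapply has_sum_ext; [reflexivity| |exact H6].
  intros w [_ Hw]. cbn beta. field. exact Hw.
Qed.

Theorem theorem5 (kappa : R) (p delta : C -> option C) :
  0 < kappa < 1 ->
  is_weierstrass_p (RtoC (wp_g2 kappa)) (RtoC (wp_g3 kappa)) p ->
  shen_relation kappa p delta ->
  (forall w w' : C,
      fundamental_periods p w w' <-> fundamental_periods delta w w') /\
  (forall omega omega' : C,
      fundamental_periods p (2 * omega)%C (2 * omega')%C ->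
      strictly_positive omega ->
      strictly_positive (- Ci * omega')%C ->
      omega = RtoC (1 / 2 * PI * hypergeom (1 / 3) (2 / 3) 1 (kappa ^ 2)) /\
      omega' = (Ci * RtoC (sqrt 3 / 2 * PI
                           * hypergeom (1 / 3) (2 / 3) 1 (1 - kappa ^ 2)))%C).
Proof.
intros Hk [w1 [w2 [Hind [Hinv Hwp]]]] Hshen.
assert (Hpd : forall w, is_period p w <-> is_period delta w).
{ intros w. split; intros H z; apply (shen_relation_injective kappa p delta); auto. }
split.
- intros w w'. unfold fundamental_periods.
  split; intros [H1 H2]; (split; [exact H1|]); intros u; rewrite <- H2; [symmetry|]; apply Hpd.
- intros [x0 x1] [y0 y1] [_ Hfund] [Ho1 Ho2] [Ho1' Ho2'].
  unfold Re, Im in Ho1, Ho2, Ho1', Ho2'. cbn in Ho1, Ho2, Ho1', Ho2'.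
  (* Positivity of omega and of - i omega' means omega = x0 and omega' = i y1 with [x0] and [y1]
     real and positive, so the period lattice is rectangular. *)
  assert (Hx1 : x1 = 0) by lra. assert (Hy0 : y0 = 0) by lra. subst x1 y0.
  assert (Hy1 : 0 < y1) by lra.
  set (L := lattice w1 w2) in *.
  assert (Hper : forall w, is_period p w <-> L w) by (apply wp_periods; assumption).
  (* The lattice defining p is its group of periods, so it is also generated by the given
     fundamental pair. *)
  assert (Hmem : forall x y, L (x, y) <-> exists m n : Z, x = IZR m * (2 * x0) /\ y = IZR n * (2 * y1)).
  { intros x y. rewrite <- Hper, Hfund. unfold lattice.
    split; intros [m [n E]]; exists m, n.
    - injection E as E1 E2. cbn in E1, E2. split; lra.
    - destruct E as [-> ->]. apply injective_projections; cbn; ring. }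
  assert (HR : rect_wp (2 * x0) (2 * y1) (wp_g2 kappa) (wp_g3 kappa) L).
  { apply (rectangular_wp _ _ _ _ L p); try assumption; try lra. intros w. apply Hper. }
  split.
  + assert (E := real_period kappa Hk _ _ L HR). rewrite (arc_PI kappa Hk) in E.
    unfold RtoC. f_equal. lra.
  + assert (E := imaginary_period kappa Hk _ _ L HR). rewrite (mid_arc_end kappa Hk) in E.
    rewrite <- E. apply injective_projections; cbn; field.
Qed.
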